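(* Assume $Eh^2>0$. Let $\mu$ be a Parisi measure and $c$ the smallest value of its support. For each $0\le t<1$ there exists a unique $u_t\in[0,c]$ such that $\varphi_c(u_t,t)=0$. Moreover, $\varphi_c(c,t)<0$ for $0\le t<1$, and $\varphi_c(c,1)=0$.
   Context: All Gaussian random variables are centered. $\xi:\mathbb R\to\mathbb R$ is a convex function with $\xi(x)=\xi(-x)$, $\xi''(x)>0$ for $x\neq0$, $\xi^{(3)}(x)\ge0$ for $x>0$, such that for every $N$ there is a centered Gaussian process on $\Sigma_N=\{-1,+1\}^N$ with covariance $N\xi\bigl(\frac1N\sum_{i\le N}\sigma_i^1\sigma_i^2\bigr)$; $\theta(x)=x\xi'(x)-\xi(x)$. $h$ is a real random variable with $E|h|<\infty$ and $Eh^2>0$. Parisi functional. For an integer $k\ge0$ and sequences $\mathbf m: m_0=0\le m_1\le\dots\le m_k\le m_{k+1}=1$, $\mathbf q: q_0=0\le q_1\le\dots\le q_{k+1}\le q_{k+2}=1$, let $z_0,\dots,z_{k+1}$ be independent Gaussian, independent of $h$, with $Ez_p^2=\xi'(q_{p+1})-\xi'(q_p)$. Put $X_{k+2}=\log\cosh(h+\sum_{0\le p\le k+1}z_p)$ and, decreasingly for $1\le p\le k+1$, $X_p=\frac1{m_p}\log E_p\exp m_pX_{p+1}$ ($X_p=E_pX_{p+1}$ if $m_p=0$), where $E_p$ is expectation in $z_p,\dots,z_{k+1}$; $X_0=EX_1$. Set $\mathcal P_k(\mathbf m,\mathbf q)=\log2+X_0-\frac12\sum_{p=1}^{k+1}m_p(\theta(q_{p+1})-\theta(q_p))$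 and $\mathcal P(\xi,h)=\inf_{k,\mathbf m,\mathbf q}\mathcal P_k(\mathbf m,\mathbf q)$. The triplet $(k,\mathbf m,\mathbf q)$ is identified with the probability measure $\mu$ on $[0,1]$ supported on $\{q_1,\dots,q_{k+1}\}$ with $\mu([0,q_p])=m_p$ for $1\le p\le k+1$. Parisi measure. $(k,\mathbf m,\mathbf q)$ satisfies condition $\mathrm{MIN}(\varepsilon)$ if $0=m_0<m_1<\dots<m_k<m_{k+1}=1$, $0=q_0<q_1<\dots<q_{k+1}<q_{k+2}=1$, $\mathcal P_k(\mathbf m,\mathbf q)\le\mathcal P(\xi,h)+\varepsilon$, and $\mathcal P_k(\mathbf m,\mathbf q)$ is the minimum of $\mathcal P_k$ over all choices of $\mathbf m,\mathbf q$ (for this $k$). The associated measure is then called $\varepsilon$-stationary. A Parisi measure is a probability measure $\mu$ on $[0,1]$ which is the weak limit of some sequence $(\mu_n)$ with $\mu_n$ $\varepsilon_n$-stationary, $\varepsilon_n\downarrow0$. When $Eh^2>0$ one has $0<c<1$ for the smallest value $c$ of its support. The functions $\Phi$ and $\varphi_v$. For a discrete measure $\nu$ associated to $(k,\mathbf m,\mathbf q)$, $\Phi_\nu:\mathbb R\times[0,1]\to\mathbb R$ is the solution of $\partial_q\Phi=-\frac{\xi''(q)}2\bigl(\partial_x^2\Phi+\nu([0,q])(\partial_x\Phi)^2\bigr)$, $\Phi(x,1)=\log\cosh x$; explicitly, for $q_p\le q<q_{p+1}$, $\Phi_\nu(x,q)=\frac1{m_p}\log E\exp m_p\Phi_\nu\bigl(x+g\sqrt{\xi'(q_{p+1})-\xi'(q)},q_{p+1}\bigr)$,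 $g$ standard Gaussian (with $E\,\Phi_\nu(\cdot)$ in place if $m_p=0$). For the Parisi measure $\mu$ with approximating sequence $(\mu_n)$, $\Phi=\lim_n\Phi_{\mu_n}$ (uniform limit; it exists, and $\partial_x^i\Phi=\lim_n\partial_x^i\Phi_{\mu_n}$ uniformly for $i=1,2,3$). For $0<v<1$, $0\le u\le v$, $0\le t\le1$, $$\varphi_v(u,t)=E\,\frac{\partial\Phi}{\partial x}(h+\chi_1,v)\frac{\partial\Phi}{\partial x}(h+\chi_2,v)-u,$$ where $\chi_1,\chi_2$ are jointly Gaussian, independent of $h$, with $E\chi_1^2=E\chi_2^2=\xi'(v)$, $E\chi_1\chi_2=t\xi'(u)$. *)

(* Defs.v *)
From HB Require Import structures.
From mathcomp Require Import all_boot all_order all_algebra.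
From mathcomp Require Import all_classical all_reals all_analysis.

Set Implicit Arguments.
Unset Strict Implicit.
Unset Printing Implicit Defensive.

Import Order.TTheory GRing.Theory Num.Theory.
Import numFieldNormedType.Exports.

Local Open Scope ring_scope.
Local Open Scope classical_set_scope.

Section gaussian.
Context {R : realType}.

Definition std_gauss : probability (measurableTypeR R) R := normal_prob 0 1.

(* [s = 0] is allowed: [X] is then almost surely [0].  ([normal_prob 0 0] is
   not the Dirac mass at 0, hence the scaled standard Gaussian.) *)
Definition centered_gaussian d (T : measurableType d) (P : probability T R)
    (X : T -> R) : Prop :=
  exists s : R, forall A : set R, measurable A ->
    P (X @^-1` A) = std_gauss ((fun g => s * g) @^-1` A).

Definition centered_gaussian_process d (T : measurableType d)
    (P : probability T R) (I : finType) (X : I -> {RV P >-> R})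
    (K : I -> I -> R) : Prop :=
  (forall a : I -> R,
     centered_gaussian P (fun w => \sum_(i : I) a i * X i w)) /\
  (forall i j : I, covariance P (X i) (X j) = (K i j)%:E).

End gaussian.

Section mixture.
Context {R : realType}.

(* The configuration space {-1, 1}^N, a spin being (-1) ^+ b for b : bool. *)
Definition spin (N : nat) (s : {ffun 'I_N -> bool}) (i : 'I_N) : R :=
  (-1) ^+ (s i).

Definition overlap (N : nat) (s1 s2 : {ffun 'I_N -> bool}) : R :=
  N%:R^-1 * \sum_(i < N) spin s1 i * spin s2 i.

Record is_mixture (xi : R -> R) : Prop := IsMixture {
  mixture_derivable : forall x : R, derivable xi x 1 ;
  mixture_derivable2 : forall x : R, derivable (derive1 xi) x 1 ;
  mixture_derivable3 : forall x : R, 0 < x -> derivable (derive1n 2 xi) x 1 ;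
  mixture_convex : convex_function [set: R^o] xi ;
  mixture_even : forall x : R, xi x = xi (- x) ;
  mixture_deriv2 : forall x : R, x != 0 -> 0 < derive1n 2 xi x ;
  mixture_deriv3 : forall x : R, 0 < x -> 0 <= derive1n 3 xi x ;
  mixture_gaussian : forall N : nat, (0 < N)%N ->
    exists (d : measure_display) (T : measurableType d) (P : probability T R)
           (H : {ffun 'I_N -> bool} -> {RV P >-> R}),
      centered_gaussian_process H
        (fun s1 s2 => N%:R * xi (overlap s1 s2)) }.

Definition theta (xi : R -> R) (x : R) : R := x * derive1 xi x - xi x.

End mixture.

Section parisi_functional.
Context {R : realType}.
Implicit Types (xi : R -> R) (k p : nat) (m q : nat -> R).

Definition logcosh (x : R) : R := ln ((expR x + expR (- x)) / 2).

(* Only m 0, ..., m k.+1 and q 0, ..., q k.+2 are meaningful. *)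
Record triplet := Triplet {
  tk : nat ;
  tm : nat -> R ;
  tq : nat -> R }.

Definition admissible k m q : Prop :=
  [/\ m 0%N = 0, forall p, (p <= k)%N -> m p <= m p.+1, m k.+1 = 1,
      q 0%N = 0
    & (forall p, (p <= k.+1)%N -> q p <= q p.+1) /\ q k.+2 = 1].

Definition strictly_admissible k m q : Prop :=
  [/\ m 0%N = 0, forall p, (p <= k)%N -> m p < m p.+1, m k.+1 = 1,
      q 0%N = 0
    & (forall p, (p <= k.+1)%N -> q p < q p.+1) /\ q k.+2 = 1].

(* A random variable depending on h, z_0, ..., z_{k+1} is represented as a
   function of the value y of h and of the sequence z of values of the z_p. *)

Definition set_coord (z : nat -> R) (p : nat) (a : R) : nat -> R :=
  fun j => if j == p then a else z j.

(* expectation in the single variable z_p, of variance xi' q_{p+1} - xi' q_p *)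
Definition E_coord xi q p (F : R -> (nat -> R) -> R) : R -> (nat -> R) -> R :=
  fun y z => \int[std_gauss]_g
    F y (set_coord z p (Num.sqrt (derive1 xi (q p.+1) - derive1 xi (q p)) * g)).

(* expectation in z_p, ..., z_{k+1} *)
Definition E_from xi k q p (F : R -> (nat -> R) -> R) : R -> (nat -> R) -> R :=
  foldr (E_coord xi q) F (iota p (k.+2 - p)).

(* [X_down xi k m q j] is X_{k+2-j}. *)
Fixpoint X_down xi k m q (j : nat) : R -> (nat -> R) -> R :=
  match j with
  | 0%N => fun y z => logcosh (y + \sum_(0 <= p < k.+2) z p)
  | j'.+1 =>
    let p := (k.+1 - j')%N in
    let X := X_down xi k m q j' in
    if m p == 0 then E_from xi k q p X
    else fun y z =>
      (m p)^-1 * ln (E_from xi k q p (fun y z => expR (m p * X y z)) y z)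
  end.

Definition parisi_X xi k m q p : R -> (nat -> R) -> R :=
  X_down xi k m q (k.+2 - p).

(* The expectation in z_0, ..., z_{k+1} does not depend on the values of the
   sequence at which it is evaluated. *)
Definition parisi_X0 d (T : measurableType d) (P : probability T R)
    (h : T -> R) xi k m q : R :=
  \int[P]_w E_from xi k q 0 (parisi_X xi k m q 1) (h w) (fun=> 0).

Definition parisi_functional d (T : measurableType d) (P : probability T R)
    (h : T -> R) xi k m q : R :=
  ln 2 + parisi_X0 P h xi k m q
  - 2^-1 * \sum_(1 <= p < k.+2) m p * (theta xi (q p.+1) - theta xi (q p)).

Definition parisi_value d (T : measurableType d) (P : probability T R)
    (h : T -> R) xi : \bar R :=
  ereal_inf [set v : \bar R | exists k m q,
    admissible k m q /\ v = (parisi_functional P h xi k m q)%:E].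

Definition MIN d (T : measurableType d) (P : probability T R) (h : T -> R)
    xi (eps : R) (tau : triplet) : Prop :=
  [/\ strictly_admissible (tk tau) (tm tau) (tq tau),
      ((parisi_functional P h xi (tk tau) (tm tau) (tq tau))%:E
         <= parisi_value P h xi + eps%:E)%E
    & forall m q, admissible (tk tau) m q ->
        parisi_functional P h xi (tk tau) (tm tau) (tq tau)
          <= parisi_functional P h xi (tk tau) m q].

End parisi_functional.

Arguments triplet : clear implicits.

Section parisi_measure.
Context {R : realType}.
Implicit Types (mu : probability (measurableTypeR R) R).

Definition associated_measure (tau : triplet R) mu : Prop :=
  mu [set x | exists2 p, (1 <= p <= (tk tau).+1)%N & x = tq tau p] = 1%E /\
  forall p, (1 <= p <= (tk tau).+1)%N ->
    mu `[0, tq tau p]%classic = (tm tau p)%:E.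

Definition weak_limit01 (nu : nat -> probability (measurableTypeR R) R) mu
    : Prop :=
  forall f : R -> R, {within `[0, 1]%classic, continuous f} ->
    (\int[nu n]_(x in `[0, 1]%classic) f x) @[n --> \oo]
      --> \int[mu]_(x in `[0, 1]%classic) f x.

(* [tau] represents a sequence of eps_n-stationary measures, eps_n decreasing
   to 0, with weak limit [mu].  A Parisi measure is a [mu] for which there is
   such a [tau]. *)
Definition parisi_measure_along d (T : measurableType d) (P : probability T R)
    (h : T -> R) (xi : R -> R) (tau : nat -> triplet R) mu : Prop :=
  mu `[0, 1]%classic = 1%E /\
  exists (eps : nat -> R) (nu : nat -> probability (measurableTypeR R) R),
    [/\ nonincreasing_seq eps, eps @ \oo --> 0,
        forall n, MIN P h xi (eps n) (tau n),
        forall n, associated_measure (tau n) (nu n)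
      & weak_limit01 nu mu].

Definition measure_support mu : set R :=
  [set x | forall U : set R, open U -> U x -> (0 < mu U)%E].

Definition is_smallest (A : set R) (c : R) : Prop := A c /\ lbound A c.

End parisi_measure.

Section parisi_pde.
Context {R : realType}.
Implicit Types (xi : R -> R) (m q : nat -> R).

Definition log_exp_step (mp v : R) (F : R -> R) (x : R) : R :=
  if mp == 0 then \int[std_gauss]_g F (x + g * Num.sqrt v)
  else mp^-1 * ln (\int[std_gauss]_g expR (mp * F (x + g * Num.sqrt v))).

(* [PhiD_rec xi m q n p x s] is Phi(x, s) for q_p <= s <= 1, where n is the
   number k + 2 - p of intervals [q_p, q_{p+1}[, ..., [q_{k+1}, 1[ *)
Fixpoint PhiD_rec xi m q (n p : nat) (x s : R) : R :=
  match n with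
  | 0%N => logcosh x
  | n'.+1 =>
    if s < q p.+1 then
      log_exp_step (m p) (derive1 xi (q p.+1) - derive1 xi s)
        (fun y => PhiD_rec xi m q n' p.+1 y (q p.+1)) x
    else PhiD_rec xi m q n' p.+1 x s
  end.

Definition PhiD xi (tau : triplet R) (x s : R) : R :=
  PhiD_rec xi (tm tau) (tq tau) (tk tau).+2 0 x s.

Definition is_Phi xi (tau : nat -> triplet R) (Phi : R -> R -> R) : Prop :=
  {uniform [set: R] `*` `[0, 1]%classic,
    (fun n (xs : R * R) => PhiD xi (tau n) xs.1 xs.2) @ \oo
      --> (fun xs : R * R => Phi xs.1 xs.2)}.

(* With a standard Gaussian triple (g, g1, g2) independent of h,
   chi_i = sqrt (t xi'(u)) g + sqrt (xi'(v) - t xi'(u)) g_i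
   has variance xi'(v) and covariance t xi'(u); the radicands are nonnegative
   for 0 <= u <= v and 0 <= t <= 1. *)
Definition varphi d (T : measurableType d) (P : probability T R) (h : T -> R)
    xi (Phi : R -> R -> R) (v u t : R) : R :=
  let dPhi x := derive1 (fun y => Phi y v) x in
  let chi g gi := Num.sqrt (t * derive1 xi u) * g
                  + Num.sqrt (derive1 xi v - t * derive1 xi u) * gi in
  \int[P]_w \int[std_gauss]_g \int[std_gauss]_g1 \int[std_gauss]_g2
    (dPhi (h w + chi g g1) * dPhi (h w + chi g g2)) - u.

End parisi_pde.

(* Main.v *)
From HB Require Import structures.
Require Import Defs.
From mathcomp Require Import all_boot all_order all_algebra.
From mathcomp Require Import all_classical all_reals all_analysis.
From mathcomp Require Import measurable_realfun.
From mathcomp Require Import ring lra.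

Set Implicit Arguments.
Unset Strict Implicit.
Unset Printing Implicit Defensive.

Import Order.TTheory GRing.Theory Num.Theory.
Import numFieldNormedType.Exports.

Local Open Scope ring_scope.
Local Open Scope classical_set_scope.

(** Write [D] for the slope of [Phi] at time [c], and [V] for [xi' c].  Given
    the common part of the two Gaussian variables, the two factors in [varphi]
    are independent with the same law.  Hence, by [varphi_cross],
    [varphi c u t = X (t * xi' u) - u], where [X s] is the mean square of the
    heat evolution of [D] during the time [V - s], taken at [h] plus a Gaussian
    of variance [s].  Jensen's inequality makes [X] nondecreasing, and
    [X s < X V] for [s < V] because [D] is strictly increasing.  Averaging one
    of two independent Gaussian variables decreases the variance in the other
    one ([heat_variance]), which makes [X] midpoint convex.  Since [xi'] is
    convex on the half line and vanishes at 0, the function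
    [u |-> varphi c u t] is continuous and midpoint convex on [[0, c]], and it
    is nonnegative at 0.

    The theorem then follows from [X V = c] and [0 < c].  For [t < 1] the value
    at [u = c] is [X (t * V) - c < 0]; the intermediate value theorem gives a
    zero, and a convex function that vanishes somewhere and is negative at [c]
    remains negative in between.  For [t = 1] the value at [u = c] is 0.

    The identity [X V = c], that is [E (D (h + sqrt V * g) ^ 2) = c]
    ([self_overlap]), is a first-order optimality condition.  It is obtained at
    a finite level, by comparing a minimizer with two competitors.  Moving all
    the mass of [[0, b]] to a point [b] slightly above [c] replaces the solution
    on [[0, b]] by a heat flow.  The loss is bounded below by a Cameron-Martin
    shift with drift [D] followed by Jensen's inequality, and this gives the
    upper bound ([right_inequality]).  Moving that mass to the left of a point
    [a] slightly below [c] inserts a step on [[a, b]], which is bounded above by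
    the second-order expansion [step_upper] of a step in its parameter; this
    gives the lower bound ([left_inequality]).  By weak convergence the mass on
    the left of any point below [c] tends to 0, while the mass on the left of
    any point above [c] stays away from 0; so one can divide by that mass, let
    the level tend to infinity, and then let [a] and [b] tend to [c].

    What controls the slopes is a class of even convex functions, stable under
    the recursion ([parisi_class]), with second differences between
    [2 log cosh y * exp (- 2 F x)] and [4 y ^ 2].  The upper bound makes the
    slopes Lipschitz and makes uniformly close functions have close slopes
    ([pc_slope_close]), so that the uniform convergence to [Phi] passes to [D].
    The lower bound makes [D] strictly increasing.  As [D] is odd, [c = 0] would
    mean [E (D h ^ 2) = 0], hence [h = 0] almost surely, against the hypothesis
    on [h]: this is [0 < c]. *)

(** * Gaussian integrals *)
Section gauss_basic.
Context {R : realType}.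
Local Notation leb := (@lebesgue_measure R).
Local Notation gamma := (@std_gauss R).
Implicit Types (f F G : R -> R).

Local Notation pdf := (normal_pdf (0:R) 1).

Lemma pdfE (x : R) : pdf x = normal_peak 1 * expR (- x ^+ 2 / 2).
Proof.
rewrite normal_pdfE ?oner_neq0// /normal_fun subr0 expr1n -mulr_natl mulr1.
by [].
Qed.

Lemma affine_subst G (s m : R) : 0 < s -> continuous G -> (forall x, 0 <= G x) ->
  (\int[leb]_x (G x)%:E = \int[leb]_x (G (s * x + m) * s)%:E)%E.
Proof.
move=> s0 cG G0.
pose F (x : R) : R := s * x + m.
have dF (x : R) : is_derive (x : R^o) (1 : R^o) (F : R^o -> R^o) s.
  apply: (@is_derive_eq _ R^o R^o _ _ _ _ _ (is_deriveD (is_deriveZ s (is_derive_id x (1 : R^o))) (is_derive_cst (m : R^o) x (1 : R^o)))).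
  by rewrite addr0 scaler1.
have F'E : F^`()%classic = cst s.
  by apply/funext => x; rewrite derive1E; have := dF x => /@derive_val ->.
rewrite (@increasing_ge0_integration_by_substitutionT R F G)//.
- by apply: eq_integral => x _; rewrite F'E.
- by move=> x y xy; rewrite /F ltrD2r ltr_pM2l.
- by rewrite F'E => ?; exact: cvg_cst.
- by rewrite F'E; exact: is_cvg_cst.
- by rewrite F'E; exact: is_cvg_cst.
- apply/cvgrNyPle => A; near do rewrite /F -lerBrDr mulrC -ler_pdivlMr//.
- apply/cvgryPge => A; near do rewrite /F -lerBlDr mulrC -ler_pdivrMr//.
Unshelve. all: end_near. Qed.

(** The Gaussian measure is defined by its values on sets; its Radon-Nikodym
    derivative with respect to the Lebesgue measure is almost everywhere the
    usual density. *)
Lemma gauss_density (f : R -> \bar R) : (forall x, 0 <= f x)%E ->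
  measurable_fun [set: measurableTypeR R] f ->
  (\int[gamma]_x f x = \int[leb]_x (f x * (pdf x)%:E))%E.
Proof.
move=> f0 mf.
have dom := @normal_prob_dominates R 0 1.
rewrite -(Radon_Nikodym_SigmaFinite.change_of_variables dom f0 measurableT mf).
have mRN : measurable_fun [set: measurableTypeR R]
    (Radon_Nikodym_SigmaFinite.f (normal_prob 0 1) leb).
  by apply: (measurable_int leb); exact: Radon_Nikodym_SigmaFinite.f_integrable.
have mpdf : measurable_fun [set: measurableTypeR R] (fun x : R => (pdf x)%:E).
  by apply/measurable_EFinP; exact: measurable_normal_pdf.
apply: ae_eq_integral => //.
- exact: emeasurable_funM.
- exact: emeasurable_funM.
apply: ae_eqe_mul2l; apply: integral_ae_eq => //=.
- exact: Radon_Nikodym_SigmaFinite.f_integrable.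
- by move=> E _ mE; rewrite -Radon_Nikodym_SigmaFinite.f_integral.
Qed.

(** This class of integrands is stable under sums, products and affine
    substitutions, so that integrability is checked along the structure of the
    integrand. *)
Definition egrow f := continuous f /\
  exists C a, [/\ 0 <= C, 0 <= a & forall x, `|f x| <= C * expR (a * `|x|)].

Lemma continuous_measurableT f : continuous f -> measurable_fun [set: measurableTypeR R] f.
Proof. exact: continuous_measurable_fun. Qed.

Lemma integral_gauss_exp_lin (a : R) :
  (\int[gamma]_x (expR (a * x))%:E = (expR (a ^+ 2 / 2))%:E)%E.
Proof.
have cexp : continuous (fun x : R => expR (a * x)).
  move=> x; apply: continuous_comp; last exact: continuous_expR.
  by apply: cvgM; [exact: cvg_cst|exact: cvg_id].
rewrite gauss_density//; last first.
  by apply/measurable_EFinP; exact: continuous_measurableT.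
rewrite (_ : (fun _ => _) = (fun x : R => (expR (a ^+ 2 / 2) * pdf (x - a))%:E)); last first.
  apply/funext => x; rewrite -EFinM !pdfE mulrCA [in RHS]mulrCA -!expRD.
  by congr (_ * expR _)%:E; field.
under eq_integral do rewrite EFinM.
rewrite ge0_integralZl//=; last 2 first.
- apply/measurable_EFinP/measurableT_comp; first exact: measurable_normal_pdf.
  exact: measurable_funB.
- by move=> x _; rewrite lee_fin normal_pdf_ge0.
  rewrite -[RHS]mule1; congr (_ * _)%E.
rewrite -[RHS](@integral_normal_pdf R 0 1).
rewrite [RHS](@affine_subst _ 1 (- a))//.
- by apply: eq_integral => x _; rewrite mulr1 mul1r.
- by apply: continuous_normal_pdf; exact: oner_neq0.
- by move=> x; exact: normal_pdf_ge0.
Qed.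

Lemma integrable_gauss_exp_abs (a : R) :
  gamma.-integrable setT (fun x => (expR (a * `|x|))%:E).
Proof.
have cexp (b : R) : continuous (fun x : R => expR (b * x)).
  move=> x; apply: continuous_comp; last exact: continuous_expR.
  by apply: cvgM; [exact: cvg_cst|exact: cvg_id].
have ie b : gamma.-integrable setT (fun x => (expR (b * x))%:E).
  apply/integrableP; split.
    by apply/measurable_EFinP; exact: continuous_measurableT.
  under eq_integral do rewrite /= ger0_norm ?expR_ge0//.
  by rewrite integral_gauss_exp_lin ltry.
apply: (@le_integrable _ _ _ gamma setT measurableT _
  (fun x => (expR (a * x))%:E + (expR (- a * x))%:E)%E) => //.
- apply/measurable_EFinP; apply: continuous_measurableT => x.
  apply: continuous_comp; last exact: continuous_expR.
  by apply: cvgM; [exact: cvg_cst|exact: norm_continuous].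
- move=> x _; rewrite -EFinD /= lee_fin (ger0_norm (expR_ge0 _)).
  rewrite (ger0_norm (addr_ge0 (expR_ge0 _) (expR_ge0 _))).
  have [x0|x0] := leP 0 x.
    by rewrite ger0_norm// lerDl expR_ge0.
  by rewrite ltr0_norm// mulrN mulNr lerDr expR_ge0.
- exact: integrableD.
Qed.

Lemma egrow_integrable f : egrow f -> gamma.-integrable setT (EFin \o f).
Proof.
move=> [cf [C [a [C0 a0 fC]]]].
apply: (@le_integrable _ _ _ gamma setT measurableT _
  (fun x => C%:E * (expR (a * `|x|))%:E)%E) => //.
- by apply/measurable_EFinP; exact: continuous_measurableT.
- move=> x _; rewrite -EFinM /= lee_fin.
  by rewrite [leRHS]ger0_norm ?mulr_ge0 ?expR_ge0.
- by apply: integrableZl => //; exact: integrable_gauss_exp_abs.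
Qed.

Lemma egrow_cst (c : R) : egrow (fun=> c).
Proof.
split; first exact: cst_continuous.
by exists `|c|, 0; split => // x; rewrite mul0r expR0 mulr1.
Qed.

Lemma egrow_id : egrow (fun x => x).
Proof.
split; first by move=> x; exact: cvg_id.
exists 1, 1; split => // x; rewrite !mul1r.
by apply: le_trans (expR_ge1Dx _); rewrite lerDr.
Qed.

Lemma egrowD f F : egrow f -> egrow F -> egrow (fun x => f x + F x).
Proof.
move=> [cf [C [a [C0 a0 fC]]]] [cF [D [b [D0 b0 FD]]]]; split.
  by move=> x; apply: cvgD; [exact: cf|exact: cF].
exists (C + D), (a + b); split; rewrite ?addr_ge0// => x.
apply: le_trans (ler_normD _ _) _; rewrite mulrDl lerD//.
  apply: le_trans (fC x) _; rewrite ler_wpM2l// ler_expR ler_wpM2r//.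
  by rewrite lerDl.
apply: le_trans (FD x) _; rewrite ler_wpM2l// ler_expR ler_wpM2r//.
by rewrite lerDr.
Qed.

Lemma egrowM f F : egrow f -> egrow F -> egrow (fun x => f x * F x).
Proof.
move=> [cf [C [a [C0 a0 fC]]]] [cF [D [b [D0 b0 FD]]]]; split.
  by move=> x; apply: cvgM; [exact: cf|exact: cF].
exists (C * D), (a + b); split; rewrite ?addr_ge0 ?mulr_ge0// => x.
by rewrite normrM mulrDl expRD mulrACA ler_pM.
Qed.

Lemma egrowN f : egrow f -> egrow (fun x => - f x).
Proof.
move=> [cf [C [a [C0 a0 fC]]]]; split; first by move=> x; apply: cvgN; exact: cf.
by exists C, a; split => // x; rewrite normrN.
Qed.

Lemma egrowB f F : egrow f -> egrow F -> egrow (fun x => f x - F x).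
Proof. by move=> ? ?; apply: egrowD => //; exact: egrowN. Qed.

Lemma egrowZ (c : R) f : egrow f -> egrow (fun x => c * f x).
Proof. by move=> ?; apply: egrowM => //; exact: egrow_cst. Qed.

Lemma egrow_norm f : egrow f -> egrow (fun x => `|f x|).
Proof.
move=> [cf [C [a [C0 a0 fC]]]]; split.
  by move=> x; apply: continuous_comp; [exact: cf|exact: norm_continuous].
by exists C, a; split => // x; rewrite normr_id.
Qed.

Lemma egrow_affine (c s : R) f : egrow f -> egrow (fun x => f (c + s * x)).
Proof.
move=> [cf [C [a [C0 a0 fC]]]]; split.
  move=> x; apply: continuous_comp; last exact: cf.
  apply: cvgD; first exact: cvg_cst.
  by apply: cvgM; [exact: cvg_cst|exact: cvg_id].
exists (C * expR (a * `|c|)), (a * `|s|); split;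
  rewrite ?mulr_ge0 ?expR_ge0// => x.
apply: le_trans (fC _) _; rewrite -mulrA -expRD ler_wpM2l// ler_expR.
by rewrite -mulrA -mulrDr ler_wpM2l// -normrM ler_normD.
Qed.

End gauss_basic.

Section gauss_conv.
Context {R : realType}.
Local Notation leb := (@lebesgue_measure R).
Local Notation gamma := (@std_gauss R).
Local Notation mR := (measurableTypeR R).
Implicit Types (f F G : R -> R).
Local Notation pdf := (normal_pdf (0:R) 1).

Lemma measurable_pdf : measurable_fun [set: mR] pdf.
Proof. exact: measurable_normal_pdf. Qed.

Lemma gauss_density_cont f : continuous f -> (forall x, 0 <= f x) ->
  (\int[gamma]_x (f x)%:E = \int[leb]_x (f x * pdf x)%:E)%E.
Proof.
move=> cf f0; apply: gauss_density => [x|]; first by rewrite lee_fin.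
by apply/measurable_EFinP; exact: continuous_measurableT.
Qed.

Lemma gauss_sym_ge0 f : continuous f -> (forall x, 0 <= f x) ->
  (\int[gamma]_x (f (- x))%:E = \int[gamma]_x (f x)%:E)%E.
Proof.
move=> cf f0.
have cfN : continuous (fun x => f (- x)).
  by move=> x; apply: continuous_comp; [apply: oppr_continuous|exact: cf].
rewrite !gauss_density_cont//.
have mN : measurable_fun [set: mR] (-%R : _ -> mR).
  by apply: (@continuous_measurableT R); exact: oppr_continuous.
pose g (x : mR) : \bar R := (f x * pdf x)%:E.
have mg : measurable_fun [set: mR] g.
  apply/measurable_EFinP; apply: measurable_funM; last exact: measurable_pdf.
  exact: continuous_measurableT.
have g0 x : (0 <= g x)%E by rewrite lee_fin mulr_ge0// normal_pdf_ge0.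
have := @ge0_integral_pushforward _ _ mR mR R _ mN leb setT g measurableT mg
  (fun x _ => g0 x).
rewrite preimage_setT => E; transitivity (\int[leb]_x (g \o -%R) x)%E.
  by apply: eq_integral => x _; rewrite /g/= !pdfE sqrrN.
rewrite -E; apply: eq_measure_integral => A mA _; exact: lebesgue_measureN.
Qed.

(** Completing the square: the standard Gaussian density of the plane is
    invariant under the orthogonal reflection with coefficients [s] and [r]. *)
Lemma pdf_rotate (z x s r : R) : r != 0 -> s ^+ 2 + r ^+ 2 = 1 ->
  pdf (r^-1 * z - r^-1 * s * x) * pdf x =
  pdf z * pdf (r^-1 * x + - (r^-1 * s * z)).
Proof.
move=> r0 sr; rewrite !pdfE [LHS]mulrACA [RHS]mulrACA -!expRD.
congr (_ * expR _).
have -> : - (r^-1 * z - r^-1 * s * x) ^+ 2 / 2 + - x ^+ 2 / 2 =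
  - ((z - s * x) ^+ 2 + r ^+ 2 * x ^+ 2) / (2 * r ^+ 2) by field.
have -> : - z ^+ 2 / 2 + - (r^-1 * x + - (r^-1 * s * z)) ^+ 2 / 2 =
  - ((x - s * z) ^+ 2 + r ^+ 2 * z ^+ 2) / (2 * r ^+ 2) by field.
by have -> : r ^+ 2 = 1 - s ^+ 2; [rewrite -sr; ring|congr (- _ / _); ring].
Qed.

(** After the change of variables [z = s * a + r * b], the reflection
    [pdf_rotate] and the Tonelli theorem leave the total mass of a Gaussian as
    inner integral. *)
Lemma gauss_conv_ge0 f (s r : R) : continuous f -> (forall x, 0 <= f x) ->
  0 <= r -> s ^+ 2 + r ^+ 2 = 1 -> 0 <= s ->
  (\int[gamma]_a \int[gamma]_b (f (s * a + r * b))%:E =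
   \int[gamma]_x (f x)%:E)%E.
Proof.
move=> cf f0; rewrite le_eqVlt => /predU1P[<-|r0] sr s0.
  have -> : s = 1.
    by move: sr; rewrite expr0n addr0 => /eqP; rewrite sqrf_eq1 => /orP[/eqP//|/eqP sN]; move: s0; rewrite sN lerNr oppr0 ler10.
  apply: eq_integral => a _; rewrite mul1r.
  under eq_integral do rewrite mul0r addr0.
  by rewrite integral_cst//= probability_setT mule1.
have rne : r != 0 by rewrite gt_eqF.
have caff (m c : R) : continuous (fun b : R => m + c * b).
  move=> x; apply: cvgD; first exact: cvg_cst.
  by apply: cvgM; [exact: cvg_cst|exact: cvg_id].
have cfaff (m c : R) : continuous (fun b : R => f (m + c * b) : R).
  by move=> x; apply: (continuous_comp (caff m c x)); exact: cf.
have cpaff (m c : R) : continuous (fun b : R => pdf (m + c * b)).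
  move=> x; apply: (continuous_comp (caff m c x)).
  by apply: continuous_normal_pdf; exact: oner_neq0.
pose k (z : mR * mR) : \bar R :=
  ((f z.2 * (pdf (r^-1 * z.2 - r^-1 * s * z.1) * r^-1)) * pdf z.1)%:E.
have k0 z : (0 <= k z)%E.
  by rewrite lee_fin !mulr_ge0 ?normal_pdf_ge0 ?invr_ge0// ltW.
have mf2 : measurable_fun [set: mR * mR] (fun z => f z.2).
  by apply: measurableT_comp => //; exact: continuous_measurableT.
have mk : measurable_fun [set: mR * mR] k.
  apply/measurable_EFinP; apply: measurable_funM; last first.
    by apply: measurableT_comp => //; exact: measurable_pdf.
  apply: measurable_funM => //; apply: measurable_funM => //.
  apply: (measurableT_comp measurable_pdf).
  by apply: measurable_funB; apply: measurable_funM.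
have inner a : (\int[gamma]_b (f (s * a + r * b))%:E * (pdf a)%:E =
    \int[leb]_z k (a, z))%E.
  rewrite gauss_density_cont//.
  rewrite muleC -ge0_integralZl//=; last 3 first.
  - apply/measurable_EFinP; apply: measurable_funM; last exact: measurable_pdf.
    exact: continuous_measurableT.
  - by move=> x _; rewrite lee_fin mulr_ge0// normal_pdf_ge0.
  - by rewrite lee_fin normal_pdf_ge0.
  rewrite /k/= [RHS](@affine_subst _ _ r (s * a)) //=.
  - apply: eq_integral => x _; congr _%:E.
    rewrite (_ : r^-1 * (r * x + s * a) - r^-1 * s * a = x); last by field.
    by rewrite (addrC (r * x)); field.
  - move=> x; apply: cvgM; last exact: cvg_cst.
    apply: cvgM; first exact: cf.
    apply: cvgM; last exact: cvg_cst.
    rewrite (_ : (fun y => _) = (fun y => pdf (- (r^-1 * s * a) + r^-1 * y))); last first.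
      by apply/funext => y; rewrite addrC.
    by rewrite addrC; exact: cpaff.
  - by move=> x; have := k0 (a, x); rewrite lee_fin.
rewrite gauss_density//; last 2 first.
- by move=> a; apply: integral_ge0 => b _; rewrite lee_fin.
- have := @measurable_fun_fubini_tonelli_F _ _ mR mR R gamma
    (fun z => (f (s * z.1 + r * z.2))%:E).
  apply; last by move=> z; rewrite lee_fin.
  apply/measurable_EFinP; apply: (measurableT_comp (continuous_measurableT cf)).
  by apply: measurable_funD; apply: measurable_funM.
under eq_integral do rewrite inner.
rewrite (fubini_tonelli k)//= gauss_density_cont//.
apply: eq_integral => z _; rewrite /k/=.
transitivity (\int[leb]_x ((f z * pdf z)%:E * (pdf (r^-1 * x + (- (r^-1 * s * z))) * r^-1)%:E))%E.
  apply: eq_integral => x _; rewrite -EFinM; congr _%:E.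
  have := pdf_rotate z x rne sr.
  set A := pdf _ => E; set B := pdf (_ + _) in E *.
  by transitivity (f z * (A * pdf x) / r); [ring|rewrite E; ring].
rewrite /k; under eq_integral do rewrite EFinM.
rewrite ge0_integralZl//=; last 3 first.
- apply/measurable_EFinP; apply: measurable_funM => //.
  apply: continuous_measurableT.
  rewrite (_ : (fun _ => _) = (fun x => pdf (- (r^-1 * s * z) + r^-1 * x))); last first.
    by apply/funext => x; rewrite addrC.
  exact: cpaff.
- by move=> x _; rewrite lee_fin mulr_ge0 ?normal_pdf_ge0// invr_ge0 ltW.
- by rewrite lee_fin mulr_ge0 ?normal_pdf_ge0.
rewrite -[RHS]mule1; congr (_ * _)%E.
rewrite -[RHS](@integral_normal_pdf R 0 1).
rewrite [RHS](@affine_subst _ _ r^-1 (- (r^-1 * s * z))) ?invr_gt0//.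
  by apply: continuous_normal_pdf; exact: oner_neq0.
by move=> x; exact: normal_pdf_ge0.
Qed.

End gauss_conv.

Section gauss_expectation.
Context {R : realType}.
Local Notation gamma := (@std_gauss R).
Local Notation mR := (measurableTypeR R).
Implicit Types (f F G : R -> R).
Local Notation pdf := (normal_pdf (0:R) 1).

Lemma gauss_EFin f : egrow f ->
  (\int[gamma]_x (f x)%:E)%E = (\int[gamma]_x f x)%:E.
Proof.
by move=> /egrow_integrable fi; rewrite /Rintegral fineK//; exact: integrable_fin_num.
Qed.

Lemma le_gauss f F : egrow f -> egrow F -> (forall x, f x <= F x) ->
  \int[gamma]_x f x <= \int[gamma]_x F x.
Proof.
by move=> ef eF fF; apply: le_Rintegral => //; exact: egrow_integrable.
Qed.

Lemma gaussD f F : egrow f -> egrow F ->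
  \int[gamma]_x (f x + F x) = \int[gamma]_x f x + \int[gamma]_x F x.
Proof. by move=> ? ?; apply: RintegralD => //; exact: egrow_integrable. Qed.

Lemma gaussB f F : egrow f -> egrow F ->
  \int[gamma]_x (f x - F x) = \int[gamma]_x f x - \int[gamma]_x F x.
Proof. by move=> ? ?; apply: RintegralB => //; exact: egrow_integrable. Qed.

Lemma gaussZ (c : R) f : egrow f ->
  \int[gamma]_x (c * f x) = c * \int[gamma]_x f x.
Proof. by move=> ?; apply: RintegralZl => //; exact: egrow_integrable. Qed.

Lemma gauss_lin (a b : R) f F : egrow f -> egrow F ->
  \int[gamma]_x (a * f x + b * F x) = a * \int[gamma]_x f x + b * \int[gamma]_x F x.
Proof.
by move=> ef eF; rewrite gaussD; [rewrite (gaussZ a)// (gaussZ b)|exact: egrowZ|exact: egrowZ].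
Qed.

Lemma gauss_cst (c : R) : \int[gamma]_x c = c.
Proof.
rewrite Rintegral_cst//; set m := (X in fine X).
by have -> : m = 1%E; [exact: (@probability_setT _ _ _ gamma)|rewrite mulr1].
Qed.

Lemma gauss_ge0 f : (forall x, 0 <= f x) -> 0 <= \int[gamma]_x f x.
Proof. by move=> f0; exact: Rintegral_ge0. Qed.

Lemma eq_gauss f F : f =1 F -> \int[gamma]_x f x = \int[gamma]_x F x.
Proof. by move=> fF; apply: eq_Rintegral => x _. Qed.

Lemma eq_egrow f F : f =1 F -> egrow f -> egrow F.
Proof. by move=> /funext ->. Qed.

Lemma gauss_ge f (c : R) : egrow f -> (forall x, c <= f x) -> c <= \int[gamma]_x f x.
Proof.
by move=> ef cf; rewrite -[leLHS]gauss_cst le_gauss//; exact: egrow_cst.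
Qed.

Lemma gauss_le f (c : R) : egrow f -> (forall x, f x <= c) -> \int[gamma]_x f x <= c.
Proof.
by move=> ef cf; rewrite -[leRHS]gauss_cst le_gauss//; exact: egrow_cst.
Qed.

Lemma egrow_expZ (c a : R) : 0 <= c -> 0 <= a ->
  egrow (fun x => c * expR (a * `|x|)).
Proof.
move=> c0 a0; split; last first.
  by exists c, a; split => // x; rewrite ger0_norm// mulr_ge0// expR_ge0.
move=> x; apply: cvgM; first exact: cvg_cst.
apply: continuous_comp; last exact: continuous_expR.
by apply: cvgM; [exact: cvg_cst|exact: norm_continuous].
Qed.

(** Reduces a signed integrand to nonnegative ones, to which the Tonelli theorem
    applies. *)
Lemma egrow_split f : egrow f -> exists p n,
  [/\ egrow p, egrow n, forall x, 0 <= p x, forall x, 0 <= n x & f = (fun x => p x - n x)].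
Proof.
move=> ef; have [_ [C [a [C0 a0 fC]]]] := ef.
pose n (x : R) : R := C * expR (a * `|x|).
have en : egrow n by exact: egrow_expZ.
exists (fun x => f x + n x), n; split => //.
- exact: egrowD.
- move=> x; have := fC x; rewrite ler_norml => /andP[+ _].
  by rewrite -lerBlDr sub0r.
- by move=> x; rewrite mulr_ge0// expR_ge0.
- by apply/funext => x; rewrite addrK.
Qed.

Lemma egrow_scale (s : R) f : egrow f -> egrow (fun x => f (s * x)).
Proof.
move=> ef; rewrite (_ : (fun _ => _) = (fun x => f (0 + s * x))); first exact: egrow_affine.
by apply/funext => x; rewrite add0r.
Qed.

Lemma gauss_sym f : egrow f -> \int[gamma]_x f (- x) = \int[gamma]_x f x.
Proof.
have E (p : R -> R) : egrow p -> egrow (fun x => p (- x)).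
  move=> ep; have -> : (fun x => p (- x)) = (fun x => p (-1 * x)).
    by apply/funext => x; rewrite mulN1r.
  exact: egrow_scale.
move=> /egrow_split[p [n [ep en p0 n0 ->]]]; rewrite !gaussB//; [|exact: E..].
by rewrite /Rintegral !gauss_sym_ge0//; [case: en|case: ep].
Qed.

Let sqrt_conv (v w : R) : 0 <= v -> 0 <= w -> v + w != 0 ->
  (Num.sqrt v / Num.sqrt (v + w)) ^+ 2 + (Num.sqrt w / Num.sqrt (v + w)) ^+ 2 = 1.
Proof.
move=> v0 w0 vw; rewrite !expr_div_n !sqr_sqrtr ?addr_ge0//.
by rewrite -mulrDl divff.
Qed.

Lemma gauss_conv_sqrt_ge0 f (v w : R) : egrow f -> (forall x, 0 <= f x) -> 0 <= v -> 0 <= w ->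
  (\int[gamma]_a \int[gamma]_b (f (Num.sqrt v * a + Num.sqrt w * b))%:E =
   \int[gamma]_x (f (Num.sqrt (v + w) * x))%:E)%E.
Proof.
move=> ef f0 v0 w0.
have [vw|vw] := eqVneq (v + w) 0.
  have v00 : v = 0 by apply/eqP; rewrite eq_le v0 -vw lerDl w0.
  have w00 : w = 0 by apply/eqP; rewrite eq_le w0 -vw lerDr v0.
  rewrite v00 w00 addr0 sqrtr0; apply: eq_integral => a _.
  under eq_integral do rewrite !mul0r addr0.
  by rewrite mul0r integral_cst//= probability_setT mule1.
have vw0 : Num.sqrt (v + w) != 0.
  by rewrite gt_eqF// sqrtr_gt0 lt_def vw addr_ge0.
have [cf _] := egrow_scale (Num.sqrt (v + w)) ef.
have q0 (u : R) : 0 <= Num.sqrt u / Num.sqrt (v + w) by rewrite divr_ge0 ?sqrtr_ge0.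
have := gauss_conv_ge0 cf (fun x => f0 _) (q0 w) (sqrt_conv v0 w0 vw) (q0 v).
move=> <-; apply: eq_integral => a _; apply: eq_integral => b _.
by congr (f _)%:E; field.
Qed.

Lemma gauss_conv f (v w : R) : egrow f -> 0 <= v -> 0 <= w ->
  \int[gamma]_a \int[gamma]_b f (Num.sqrt v * a + Num.sqrt w * b) =
  \int[gamma]_x f (Num.sqrt (v + w) * x).
Proof.
move=> /egrow_split[p [n [ep en p0 n0 ->]]] v0 w0.
pose I (q : R -> R) (a : R) : R := \int[gamma]_b q (Num.sqrt v * a + Num.sqrt w * b).
have IE (q : R -> R) (a : R) : egrow q -> (\int[gamma]_b (q (Num.sqrt v * a + Num.sqrt w * b))%:E)%E = (I q a)%:E.
  by move=> eq; rewrite gauss_EFin//; exact: egrow_affine.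
have Iint (q : R -> R) : egrow q -> (forall x, 0 <= q x) ->
    gamma.-integrable setT (EFin \o I q).
  move=> eq q0; apply/integrableP; split.
    rewrite (_ : EFin \o _ = fun a => (\int[gamma]_b (q (Num.sqrt v * a + Num.sqrt w * b))%:E)%E); last first.
      by apply/funext => a; rewrite IE.
    have := @measurable_fun_fubini_tonelli_F _ _ mR mR R gamma
      (fun z => (q (Num.sqrt v * z.1 + Num.sqrt w * z.2))%:E).
    apply; last by move=> z; rewrite lee_fin.
    have [cq _] := eq.
    apply/measurable_EFinP; apply: (measurableT_comp (continuous_measurableT cq)).
    by apply: measurable_funD; apply: measurable_funM.
  rewrite (_ : (\int[gamma]_x _ = \int[gamma]_a \int[gamma]_b (q (Num.sqrt v * a + Num.sqrt w * b))%:E)%E); last first.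
    by apply: eq_integral => a _; rewrite IE//= ger0_norm// gauss_ge0.
  by rewrite gauss_conv_sqrt_ge0// gauss_EFin ?ltry//; exact: egrow_scale.
rewrite [RHS]gaussB; [|exact: egrow_scale..].
have -> : (fun a => \int[gamma]_b (p (Num.sqrt v * a + Num.sqrt w * b) - n (Num.sqrt v * a + Num.sqrt w * b)))
   = (fun a => I p a - I n a).
  by apply/funext => a; rewrite gaussB//; exact: egrow_affine.
rewrite RintegralB//; [|exact: Iint..].
rewrite /Rintegral -!gauss_conv_sqrt_ge0//; congr (fine _ - fine _);
 by apply: eq_integral => a _; rewrite IE.
Qed.

Lemma gauss_exp (a : R) : \int[gamma]_x expR (a * x) = expR (a ^+ 2 / 2).
Proof. by rewrite /Rintegral integral_gauss_exp_lin. Qed.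

Lemma egrow_exp_lin (a : R) : egrow (fun x => expR (a * x)).
Proof.
split.
  move=> x; apply: continuous_comp; last exact: continuous_expR.
  by apply: cvgM; [exact: cvg_cst|exact: cvg_id].
exists 1, `|a|; split => // x; rewrite mul1r ger0_norm ?expR_ge0// ler_expR.
by rewrite -normrM ler_norm.
Qed.

Lemma gauss_mean : \int[gamma]_x x = 0.
Proof.
have := gauss_sym (@egrow_id R).
rewrite (eq_gauss (F := fun x => -1 * x)); last by move=> x; rewrite mulN1r.
by rewrite gaussZ ?mulN1r; [lra|exact: egrow_id].
Qed.

(** The Cameron-Martin formula in dimension one. *)
Lemma gauss_shift f (th : R) : egrow f -> (forall x, 0 <= f x) ->
  \int[gamma]_x f x = \int[gamma]_x (f (x + th) * expR (- th * x - th ^+ 2 / 2)).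
Proof.
move=> [cf _] f0; rewrite /Rintegral; congr fine.
rewrite !gauss_density_cont//.
- rewrite [LHS](@affine_subst _ _ 1 th)//.
  + apply: eq_integral => x _; congr _%:E; rewrite mul1r mulr1 -mulrA; congr (_ * _).
    by rewrite !pdfE mulrCA -expRD; congr (_ * expR _); field.
  + move=> x; apply: cvgM; first exact: cf.
    by apply: continuous_normal_pdf; exact: oner_neq0.
  + by move=> x; rewrite mulr_ge0// normal_pdf_ge0.
- move=> x; apply: cvgM.
    apply: continuous_comp; last exact: cf.
    by apply: cvgD; [exact: cvg_id|exact: cvg_cst].
  apply: continuous_comp; last exact: continuous_expR.
  apply: cvgD; last exact: cvg_cst.
  by apply: cvgM; [exact: cvg_cst|exact: cvg_id].
- by move=> x; rewrite mulr_ge0// expR_ge0.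
Qed.

End gauss_expectation.

(** * The recursion step *)
Section exp_ineq.
Context {R : realType}.
Implicit Types (a b c l m x y : R).

Lemma expR_tangent a c : expR c * (1 + (a - c)) <= expR a.
Proof.
have -> : expR a = expR c * expR (a - c) by rewrite -expRD addrC subrK.
by rewrite ler_wpM2l ?expR_ge0// expR_ge1Dx.
Qed.

Lemma expR_convex l a b : 0 <= l -> l <= 1 ->
  expR (l * a + (1 - l) * b) <= l * expR a + (1 - l) * expR b.
Proof.
move=> l0 l1; set c := _ + _.
have ha := ler_wpM2l l0 (expR_tangent a c).
have l1' : 0 <= 1 - l by rewrite subr_ge0.
have hb := ler_wpM2l l1' (expR_tangent b c).
apply: le_trans (lerD ha hb).
rewrite [leRHS](_ : _ = expR c * (1 + (l * a + (1 - l) * b - c))); last by ring.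
by rewrite subrr addr0 mulr1.
Qed.

(** For [0 <= m <= 1] the map [x |-> x ^ m] is concave; the case [m = 0] is its
    logarithmic limit. *)
Lemma expR_power_concave m l a b f : 0 <= m -> m <= 1 -> 0 <= l -> l <= 1 ->
  l * expR a + (1 - l) * expR b <= expR f ->
  l * expR (m * a) + (1 - l) * expR (m * b) <= expR (m * f).
Proof.
move=> m0 m1 l0 l1 H.
have l1' : 0 <= 1 - l by rewrite subr_ge0.
have P c : expR (m * c) <= expR (m * f) * (1 + m * (expR (c - f) - 1)).
  have := expR_convex (c - f) 0 m0 m1.
  rewrite mulr0 addr0 expR0 => h.
  have -> : expR (m * c) = expR (m * f) * expR (m * (c - f)).
    by rewrite -expRD -mulrDr addrC subrK.
  rewrite ler_wpM2l ?expR_ge0//.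
  by apply: le_trans h _; rewrite le_eqVlt; apply/orP; left; apply/eqP; ring.
apply: le_trans (lerD (ler_wpM2l l0 (P a)) (ler_wpM2l l1' (P b))) _.
rewrite [leLHS](_ : _ = expR (m * f) *
  (1 + m * ((l * expR (a - f) + (1 - l) * expR (b - f)) - 1))); last by ring.
rewrite -[leRHS]mulr1 ler_wpM2l ?expR_ge0// gerDl mulr_ge0_le0// subr_le0.
rewrite !expRB !mulrA -mulrDl ler_pdivrMr ?expR_gt0// mul1r.
exact: H.
Qed.

Lemma expR_power_concave0 l a b f : 0 <= l -> l <= 1 ->
  l * expR a + (1 - l) * expR b <= expR f -> l * a + (1 - l) * b <= f.
Proof.
move=> l0 l1 H.
have l1' : 0 <= 1 - l by rewrite subr_ge0.
have P c : expR f * (1 + (c - f)) <= expR c by exact: expR_tangent.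
have := le_trans (lerD (ler_wpM2l l0 (P a)) (ler_wpM2l l1' (P b))) H.
rewrite [leLHS](_ : _ = expR f * (1 + (l * a + (1 - l) * b - f))); last by ring.
by rewrite -[leRHS]mulr1 ler_pM2l ?expR_gt0// gerDl subr_le0.
Qed.

End exp_ineq.

Section regular_class.
Context {R : realType}.
Local Notation gamma := (@std_gauss R).
Local Notation T := log_exp_step.
Implicit Types (F G : R -> R) (m v w x y : R).

Definition nonexpansive F := forall x y, `|F x - F y| <= `|x - y|.

Lemma nonexpansive_continuous F : nonexpansive F -> continuous F.
Proof.
move=> lF x; apply/cvgrPdist_lt => e e0; near=> y.
apply: le_lt_trans (lF _ _) _; near: y.
exact: (@cvgr_dist_lt _ _ _ _ _ id x).
Unshelve. all: end_near. Qed.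

Lemma nonexpansive_le F x y : nonexpansive F -> F x <= F y + `|x - y|.
Proof. by move=> /(_ x y); rewrite ler_distl => /andP[_]; rewrite addrC. Qed.

Lemma nonexpansive_egrow F : nonexpansive F -> egrow F.
Proof.
move=> lF; split; first exact: nonexpansive_continuous.
exists (`|F 0| + 1), 1; split; rewrite ?addr_ge0// => x.
have := lF x 0; rewrite subr0 => h1.
have h2 : `|F x| <= `|F 0| + `|x|.
  have -> : F x = F 0 + (F x - F 0) by rewrite addrC subrK.
  by apply: le_trans (ler_normD _ _) _; rewrite lerD2l.
have h3 : `|x| <= expR `|x| by apply: le_trans (expR_ge1Dx _); rewrite lerDr.
have h4 : 1 <= expR `|x| by rewrite -[leLHS]expR0 ler_expR.
apply: le_trans h2 _; rewrite mul1r mulrDl mul1r lerD//.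
by rewrite ler_peMr.
Qed.

Lemma egrow_exp_nonexpansive F (c d : R) : nonexpansive F -> egrow (fun x => expR (c * F x + d)).
Proof.
move=> lF; split.
  move=> x; apply: continuous_comp; last exact: continuous_expR.
  apply: cvgD; last exact: cvg_cst.
  by apply: cvgM; [exact: cvg_cst|exact: nonexpansive_continuous].
exists (expR (`|c| * `|F 0| + d)), `|c|; split; rewrite ?expR_ge0// => x.
rewrite ger0_norm ?expR_ge0// -expRD ler_expR addrAC lerD2r.
apply: le_trans (ler_norm _) _; rewrite normrM -mulrDr ler_wpM2l//.
have := lF x 0; rewrite subr0 => h1.
have -> : F x = F 0 + (F x - F 0) by rewrite addrC subrK.
by apply: le_trans (ler_normD _ _) _; rewrite lerD2l.
Qed.

Lemma egrow_move F x v : egrow F -> egrow (fun g => F (x + g * Num.sqrt v)).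
Proof.
move=> eF; rewrite (_ : (fun g => F (x + g * Num.sqrt v)) =
   (fun g => F (x + Num.sqrt v * g))); first exact: egrow_affine.
by apply/funext => g; rewrite mulrC.
Qed.

Lemma egrow_nonexp_move F x v : nonexpansive F -> egrow (fun g => F (x + g * Num.sqrt v)).
Proof. by move=> lF; apply: egrow_move; exact: nonexpansive_egrow. Qed.

Lemma egrow_exp_move F (c d x v : R) : nonexpansive F ->
  egrow (fun g => expR (c * (F (x + g * Num.sqrt v) - d))).
Proof.
move=> lF; apply: (egrow_move (F := fun y => expR (c * (F y - d)))).
rewrite (_ : (fun y => _) = (fun y => expR (c * F y + (- (c * d))))).
  exact: egrow_exp_nonexpansive.
by apply/funext => y; rewrite mulrBr.
Qed.

Lemma step0E v F x : T 0 v F x = \int[gamma]_g F (x + g * Num.sqrt v).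
Proof. by rewrite /log_exp_step eqxx. Qed.

Lemma gauss_expB F (c d x v : R) : nonexpansive F ->
  \int[gamma]_g expR (c * (F (x + g * Num.sqrt v) - d)) =
  expR (- (c * d)) * \int[gamma]_g expR (c * F (x + g * Num.sqrt v)).
Proof.
move=> lF; rewrite -gaussZ.
  by apply: eq_gauss => g; rewrite -expRD mulrBr addrC.
have := egrow_exp_move c 0 x v lF; congr (egrow _); apply/funext => g.
by rewrite subr0.
Qed.

Lemma gauss_exp_gt0 F (c x v : R) : nonexpansive F ->
  0 < \int[gamma]_g expR (c * F (x + g * Num.sqrt v)).
Proof.
move=> lF; set I := \int[_]_g _.
have e1 : egrow (fun g => c * (F (x + g * Num.sqrt v) - 0)).
  by apply: egrowZ; apply: egrowB; [exact: egrow_nonexp_move|exact: egrow_cst].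
have : expR (\int[gamma]_g (c * (F (x + g * Num.sqrt v) - 0))) <= I.
  set a := \int[gamma]_g _.
  have : \int[gamma]_g (expR a * (1 + (c * (F (x + g * Num.sqrt v) - 0) - a))) <= I.
    have <- : \int[gamma]_g expR (c * (F (x + g * Num.sqrt v) - 0)) = I.
      by apply: eq_gauss => g; rewrite subr0.
    apply: le_gauss; last by move=> g; exact: expR_tangent.
    - apply: egrowZ; apply: egrowD; first exact: egrow_cst.
      by apply: egrowB => //; exact: egrow_cst.
    - exact: egrow_exp_move.
  rewrite gaussZ; last first.
    by apply: egrowD; [exact: egrow_cst|apply: egrowB => //; exact: egrow_cst].
  rewrite gaussD; [|exact: egrow_cst|by apply: egrowB => //; exact: egrow_cst].
  rewrite gaussB//; last exact: egrow_cst.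
  by rewrite !gauss_cst subrr addr0 mulr1.
exact: lt_le_trans (expR_gt0 _).
Qed.

(** The step [T m v F x] is the constant [c] for which the Gaussian mean of
    [expR (m * (F - c))] is 1.  This turns every bound on a step into a bound on
    such a mean, where no logarithm is left ([step_le] and [step_ge]). *)
Lemma step_spec m v F x : m != 0 -> nonexpansive F ->
  \int[gamma]_g expR (m * (F (x + g * Num.sqrt v) - T m v F x)) = 1.
Proof.
move=> m0 lF; rewrite gauss_expB// /log_exp_step (negbTE m0) mulVKf//.
by rewrite expRN lnK ?posrE ?gauss_exp_gt0// mulVf// gt_eqF// gauss_exp_gt0.
Qed.

Lemma step_le m v F x (c : R) : 0 < m -> nonexpansive F ->
  \int[gamma]_g expR (m * (F (x + g * Num.sqrt v) - c)) <= 1 -> T m v F x <= c.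
Proof.
move=> m0 lF; rewrite gauss_expB// expRN mulrC ler_pdivrMr ?expR_gt0// mul1r => h.
rewrite /log_exp_step gt_eqF// ler_pdivrMl// -ler_expR lnK// posrE.
exact: gauss_exp_gt0.
Qed.

Lemma step_ge m v F x (c : R) : 0 < m -> nonexpansive F ->
  1 <= \int[gamma]_g expR (m * (F (x + g * Num.sqrt v) - c)) -> c <= T m v F x.
Proof.
move=> m0 lF; rewrite gauss_expB// expRN mulrC ler_pdivlMr ?expR_gt0// mul1r => h.
rewrite /log_exp_step gt_eqF// ler_pdivlMl// -ler_expR lnK// posrE.
exact: gauss_exp_gt0.
Qed.

(** Monotonicity, invariance under constants and translations in one statement. *)
Lemma step_mono m v F G x y (c : R) : 0 <= m -> nonexpansive F -> nonexpansive G ->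
  (forall z, F (x + z) <= G (y + z) + c) -> T m v F x <= T m v G y + c.
Proof.
move=> + lF lG FG; rewrite le_eqVlt => /predU1P[<-|m0].
  rewrite !step0E -[in leRHS](gauss_cst c) -gaussD; [|exact: egrow_nonexp_move|exact: egrow_cst].
  by apply: le_gauss => //; [exact: egrow_nonexp_move|apply: egrowD; [exact: egrow_nonexp_move|exact: egrow_cst]].
apply: step_le => //; rewrite -[leRHS](@step_spec m v G y) ?gt_eqF//.
apply: le_gauss; [exact: egrow_exp_move|exact: egrow_exp_move|move=> g].
by rewrite ler_expR ler_pM2l// opprD addrA addrAC lerD2r lerBlDr.
Qed.

Lemma step_nonexpansive m v F : 0 <= m -> nonexpansive F -> nonexpansive (T m v F).
Proof.
move=> m0 lF x y.
have K a b z : F (a + z) <= F (b + z) + `|a - b|.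
  have -> : a - b = (a + z) - (b + z) by ring.
  exact: nonexpansive_le.
rewrite ler_distl; apply/andP; split.
  by rewrite lerBlDr; apply: step_mono => // z; rewrite distrC; exact: K.
by apply: step_mono => // z; exact: K.
Qed.

Lemma step_ge_step0 m v F x : 0 <= m -> nonexpansive F -> T 0 v F x <= T m v F x.
Proof.
rewrite le_eqVlt => /predU1P[<-//|m0] lF; apply: step_ge => //.
set c := T 0 v F x.
have e1 : egrow (fun g => F (x + g * Num.sqrt v) - c).
  by apply: egrowB; [exact: egrow_nonexp_move|exact: egrow_cst].
have <- : \int[gamma]_g (1 + m * (F (x + g * Num.sqrt v) - c)) = 1.
  rewrite gaussD; [|exact: egrow_cst|exact: egrowZ].
  rewrite gaussZ// gaussB; [|exact: egrow_nonexp_move|exact: egrow_cst].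
  by rewrite !gauss_cst /c step0E subrr mulr0 addr0.
apply: le_gauss; [|exact: egrow_exp_move|by move=> g; exact: expR_ge1Dx].
by apply: egrowD; [exact: egrow_cst|exact: egrowZ].
Qed.

Lemma heat_v0 F x : T 0 0 F x = F x.
Proof.
rewrite step0E sqrtr0; under eq_Rintegral do rewrite mulr0 addr0.
exact: gauss_cst.
Qed.

Lemma heat_conv (f : R -> R) (v w x : R) : egrow f -> 0 <= v -> 0 <= w ->
  T 0 v (T 0 w f) x = T 0 (v + w) f x.
Proof.
move=> ef v0 w0; rewrite !step0E.
have e : egrow (fun z => f (x + z)).
  by apply: eq_egrow (egrow_affine x 1 ef) => z; rewrite mul1r.
transitivity (\int[gamma]_a \int[gamma]_b f (x + (Num.sqrt v * a + Num.sqrt w * b))).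
  apply: eq_gauss => a; rewrite step0E; apply: eq_gauss => b; congr f; ring.
rewrite (gauss_conv e v0 w0); apply: eq_gauss => z; congr f; ring.
Qed.

(** For a fixed parameter, the steps form a semigroup in the variance. *)
Lemma step_conv m v w F x : 0 <= v -> 0 <= w -> 0 <= m -> nonexpansive F ->
  T m v (T m w F) x = T m (v + w) F x.
Proof.
move=> v0 w0 m0 lF.
have C (f : R -> R) : egrow f ->
    \int[gamma]_a \int[gamma]_b f (x + a * Num.sqrt v + b * Num.sqrt w) =
    \int[gamma]_g f (x + g * Num.sqrt (v + w)).
  move=> ef; have := heat_conv x ef v0 w0; rewrite !step0E => <-.
  by apply: eq_gauss => a; rewrite step0E.
have [m00|mn0] := eqVneq m 0.
  rewrite m00 !step0E -C; last exact: nonexpansive_egrow.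
  by apply: eq_gauss => a; rewrite step0E.
have mp : 0 < m by rewrite lt_def mn0.
have E1 : egrow (fun y => expR (m * F y)).
  have := egrow_exp_nonexpansive m 0 lF; congr (egrow _).
  by apply/funext => y; rewrite addr0.
rewrite {1 3}/log_exp_step (negbTE mn0) -(C (fun y => expR (m * F y)))//.
congr (_ * ln _); apply: eq_gauss => a.
rewrite /log_exp_step (negbTE mn0) mulVKf// lnK// posrE.
exact: gauss_exp_gt0.
Qed.

Lemma step_v0 m F x : nonexpansive F -> T m 0 F x = F x.
Proof.
move=> lF; rewrite /log_exp_step sqrtr0.
have [m0|m0] := eqVneq m 0.
  by under eq_Rintegral do rewrite mulr0 addr0; rewrite gauss_cst.
by under eq_Rintegral do rewrite mulr0 addr0; rewrite gauss_cst expRK mulKf.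
Qed.

(** Cameron-Martin shift followed by Jensen's inequality.  The drift [al] is a
    constant, so that these bounds compose exactly over successive steps. *)
Lemma step_shift_ge m v F x (al : R) : 0 <= m -> 0 <= v -> nonexpansive F ->
  T 0 v F (x + m * v * al) - m * v * al ^+ 2 / 2 <= T m v F x.
Proof.
rewrite le_eqVlt => /predU1P[<-|m0] v0 lF.
  by rewrite !(mul0r, addr0, subr0).
apply: step_ge => //; set c := _ - _.
(* The Gaussian variable is shifted by [th], so that [x] moves by [m * v * al]. *)
pose th := m * Num.sqrt v * al.
rewrite (gauss_shift th); [|exact: egrow_exp_move|by move=> g; exact: expR_ge0].
pose A (g : R) : R := F (x + m * v * al + g * Num.sqrt v) - c.
have AE (g : R) : F (x + (g + th) * Num.sqrt v) - c = A g.
  rewrite /A; congr (F _ - c); rewrite /th mulrDl -!addrA; congr (x + _).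
  by rewrite addrC; congr (_ + _); rewrite -[in RHS](sqr_sqrtr v0); ring.
have eA : egrow A by apply: egrowB; [exact: egrow_nonexp_move|exact: egrow_cst].
have e2 : egrow (fun g => - th * g - th ^+ 2 / 2).
  by apply: egrowB; [apply: egrowZ; exact: egrow_id|exact: egrow_cst].
have E1 : \int[gamma]_g (1 + (m * A g + (- th * g - th ^+ 2 / 2))) = 1.
  rewrite gaussD; [|exact: egrow_cst|by apply: egrowD => //; exact: egrowZ].
  rewrite gaussD//; last exact: egrowZ.
  rewrite gaussZ//.
  have -> : \int[gamma]_g A g = T 0 v F (x + m * v * al) - c.
    by rewrite gaussB; [rewrite gauss_cst step0E|exact: egrow_nonexp_move|exact: egrow_cst].
  have -> : \int[gamma]_g (- th * g - th ^+ 2 / 2) = - th ^+ 2 / 2.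
    rewrite gaussB; [|by apply: egrowZ; exact: egrow_id|exact: egrow_cst].
    rewrite gauss_cst gaussZ; last exact: egrow_id.
    by rewrite gauss_mean mulr0 sub0r mulNr.
  rewrite gauss_cst /c /th; set H := T 0 _ _ _.
  by rewrite !exprMn sqr_sqrtr//; field.
rewrite -[leLHS]E1; apply: le_gauss.
- by apply: egrowD; [exact: egrow_cst|apply: egrowD => //; exact: egrowZ].
- apply: egrowM.
    have := egrow_exp_move m c (x + m * v * al) v lF; congr (egrow _); apply/funext => g.
    by rewrite AE.
  apply: eq_egrow (egrowZ (expR (- (th ^+ 2 / 2))) (egrow_exp_lin (- th))) => g.
  by rewrite -expRD addrC.
- by move=> g; rewrite AE -expRD; exact: expR_ge1Dx.
Qed.

End regular_class.

(** * A class of functions stable under the recursion *)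
Section parisi_class.
Context {R : realType}.
Local Notation gamma := (@std_gauss R).
Local Notation T := log_exp_step.
Implicit Types (F G : R -> R) (m v w x y : R).

(** The last two fields are integrated forms of the differential inequalities
    [F'' + F' ^ 2 <= 1] and [expR (- 2 * F) <= F''], which are equalities for
    [log cosh]; stated as bounds on second differences, they pass through the
    recursion step and to pointwise limits. *)
Record parisi_class F : Prop := ParisiClass {
  pc_lip : nonexpansive F ;
  pc_convex : forall l x y, 0 <= l -> l <= 1 ->
    F (l * x + (1 - l) * y) <= l * F x + (1 - l) * F y ;
  pc_even : forall x, F (- x) = F x ;
  pc_upper : forall x y, expR (F (x + y)) + expR (F (x - y)) <=
    (expR y + expR (- y)) * expR (F x) ;
  pc_lower : forall x y, 2 * logcosh y * expR (- 2 * F x) <=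
    F (x + y) + F (x - y) - 2 * F x }.

Lemma expR_logcosh x : expR (logcosh x) = (expR x + expR (- x)) / 2.
Proof. by rewrite /logcosh lnK// posrE divr_gt0// addr_gt0 ?expR_gt0. Qed.

Lemma logcosh_ge0 x : 0 <= logcosh x.
Proof.
rewrite -ler_expR expR0 expR_logcosh ler_pdivlMr// mul1r.
by have := expR_ge1Dx x; have := expR_ge1Dx (- x); lra.
Qed.

Lemma logcosh_gt0 x : x != 0 -> 0 < logcosh x.
Proof.
move=> x0; rewrite -ltr_expR expR0 expR_logcosh ltr_pdivlMr// mul1r.
by have := expR_gt1Dx x0; have := expR_ge1Dx (- x); lra.
Qed.

Lemma logcosh_le x : logcosh x <= 2 * x ^+ 2.
Proof.
rewrite -ler_expR expR_logcosh ler_pdivrMr//.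
wlog x0 : x / 0 <= x => [H|].
  have [|x0] := leP 0 x; first exact: H.
  by have := H (- x); rewrite opprK sqrrN addrC; apply; rewrite oppr_ge0 ltW.
(* Beyond [1 / 2] one has [x <= 2 * x ^+ 2]; below it the geometric series bounds apply. *)
have [x1|x1] := leP x (2^-1); last first.
  have h : expR x <= expR (2 * x ^+ 2) by rewrite ler_expR; nra.
  have h' : expR (- x) <= expR (2 * x ^+ 2) by rewrite ler_expR; nra.
  by rewrite mulr_natr mulr2n lerD.
have h1 : expR x <= (1 - x)^-1.
  rewrite -[leLHS]invrK -expRN lef_pV2 ?posrE ?expR_gt0//; last by lra.
  exact: (expR_ge1Dx (- x)).
have h2 : expR (- x) <= (1 + x)^-1.
  rewrite -[leLHS]invrK -expRN opprK lef_pV2 ?posrE ?expR_gt0//; last by lra.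
  exact: expR_ge1Dx.
have h3 := expR_ge1Dx (2 * x ^+ 2).
have h4 : (1 - x)^-1 + (1 + x)^-1 <= (1 + 2 * x ^+ 2) * 2.
  have -> : (1 - x)^-1 + (1 + x)^-1 = 2 / (1 - x ^+ 2) by field; rewrite !gt_eqF//; nra.
  have p : 0 < 1 - x ^+ 2 by nra.
  have q : 0 <= x ^+ 2 * (1 - 2 * x ^+ 2) by apply: mulr_ge0; nra.
  by rewrite ler_pdivrMr//; lra.
by lra.
Qed.

Lemma logcosh_parisi_class : parisi_class (@logcosh R).
Proof.
have C0 (x : R) : 0 < (expR x + expR (- x)) / 2 :> R by rewrite divr_gt0// addr_gt0 ?expR_gt0.
have K (x : R) : expR (x - logcosh x) + expR (- x - logcosh x) = 2.
  rewrite !expRB -mulrDl expR_logcosh; field.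
  by rewrite gt_eqF// addr_gt0 ?expR_gt0.
split.
- have H (x y : R) : logcosh x <= logcosh y + `|x - y|.
    rewrite -ler_expR expRD !expR_logcosh mulrAC ler_pM2r// mulrDl -!expRD.
    by apply: lerD; rewrite ler_expR; have := ler_norm (x - y);
       have := ler_norm (- (x - y)); rewrite normrN; lra.
  move=> x y; rewrite ler_distl; apply/andP; split; rewrite ?H//.
  by rewrite lerBlDr distrC.
- move=> l x y l0 l1; set a := _ + _; set b := _ + _.
  rewrite -subr_le0 -(ler_expR _ 0) expR0 expRB expR_logcosh.
  have H (s : R) : expR (s * a - b) <= l * expR (s * x - logcosh x) + (1 - l) * expR (s * y - logcosh y).
    apply: le_trans (expR_convex _ _ l0 l1).
    by rewrite ler_expR /a /b le_eqVlt; apply/orP; left; apply/eqP; ring.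
  have h := lerD (H 1) (H (-1)).
  have h2 : expR (1 * a - b) + expR (-1 * a - b) <= 2.
    apply: le_trans h _; rewrite !mul1r !mulN1r.
    have KK (p q r s : R) : p + r = 2 -> q + s = 2 ->
        l * p + (1 - l) * q + (l * r + (1 - l) * s) <= 2.
      move=> pr qs.
      rewrite [leLHS](_ : _ = l * (p + r) + (1 - l) * (q + s)); last by ring.
      by rewrite pr qs -mulrDl addrC subrK mul1r.
    by apply: KK; exact: K.
  have -> : (expR a + expR (- a)) / 2 / expR b = (expR (1 * a - b) + expR (-1 * a - b)) / 2.
    by rewrite mul1r mulN1r !expRB; ring.
  by rewrite ler_pdivrMr// [leRHS]mul1r.
- by move=> x; rewrite /logcosh opprK addrC.
- move=> x y; rewrite !expR_logcosh opprB opprD !expRD.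
  by rewrite le_eqVlt; apply/orP; left; apply/eqP; ring.
- move=> x y; set t := expR (- 2 * logcosh x).
  have t1 : t <= 1 by rewrite -expR0 ler_expR; have := logcosh_ge0 x; lra.
  have t0 : 0 <= t by exact: expR_ge0.
  rewrite -ler_expR.
  have -> : 2 * logcosh y * t = t * (2 * logcosh y) + (1 - t) * 0 by ring.
  apply: le_trans (expR_convex _ _ t0 t1) _; rewrite expR0.
  have E2 (z : R) : expR (2 * logcosh z) = ((expR z + expR (- z)) / 2) ^+ 2.
    by rewrite expRM_natl expR_logcosh.
  have tE : t = (((expR x + expR (- x)) / 2) ^+ 2)^-1.
    by rewrite -E2 -expRN -mulNr.
  rewrite tE expRB expRD !expR_logcosh !E2 opprB opprD !expRD !expRN.
  have := expR_gt0 x; have := expR_gt0 y.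
  set a := expR x; set b := expR y => b0 a0.
  rewrite le_eqVlt; apply/orP; left; apply/eqP; field.
  by rewrite !gt_eqF// addr_gt0// mulr_gt0.
Qed.

Let convex_aux (m l a b c s t : R) : 0 <= m -> a <= l * b + (1 - l) * c ->
  m * (a - (l * s + (1 - l) * t)) <= l * (m * (b - s)) + (1 - l) * (m * (c - t)).
Proof. by move=> m0 /(ler_wpM2l m0); lra. Qed.

(** Naming a term by an equation makes it atomic for the arithmetic that
    follows. *)
Let name (a : R) : {t | t = a}. Proof. by exists a. Qed.

(** [l] and [1 - l] are the weights of [expR tp] and [expR tm] in their sum, and
    [K] is the logarithm of that sum divided by [2 cosh y]. *)
Let sum_expR_weights (tp tm y : R) : exists l K, [/\ 0 <= l, l <= 1,
  forall a b f, expR a + expR b <= (expR y + expR (- y)) * expR f ->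
    l * expR (a - tp) + (1 - l) * expR (b - tm) <= expR (f - K) &
  forall f, K <= f -> expR tp + expR tm <= (expR y + expR (- y)) * expR f].
Proof.
have : 0 < expR y + expR (- y) by rewrite addr_gt0 ?expR_gt0.
move: (expR y + expR (- y)) => C C0.
have H0 := expR_gt0 tp; have H := expR_gt0 tm.
exists (expR tp / (expR tp + expR tm)), (ln ((expR tp + expR tm) / C)).
have S0 : 0 < expR tp + expR tm by rewrite addr_gt0.
have l1E : 1 - expR tp / (expR tp + expR tm) = expR tm / (expR tp + expR tm).
  by field; rewrite gt_eqF.
have KE : expR (ln ((expR tp + expR tm) / C)) = (expR tp + expR tm) / C.
  by rewrite lnK// posrE divr_gt0.
split.
- by rewrite divr_ge0// ltW.
- by rewrite -subr_ge0 l1E divr_ge0// ltW.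
- move=> a b f; rewrite l1E !expRB KE.
  move: (expR tp) (expR tm) (expR a) (expR b) (expR f) H H0 S0 => p m A B D m0 p0 S0 h.
  rewrite [leLHS](_ : _ = (A + B) / (p + m)); last by field; rewrite !gt_eqF.
  rewrite [leRHS](_ : _ = C * D / (p + m)); last by field; rewrite !gt_eqF.
  by rewrite ler_pM2r// invr_gt0.
- by move=> f; rewrite -ler_expR KE ler_pdivrMr// mulrC.
Qed.

Let lower_aux (m a b c s t u r : R) : 0 <= m -> r <= b + c - 2 * a ->
  m * (a - u + (u - (s + t) / 2) + r / 2) <= 2^-1 * (m * (b - s)) + (1 - 2^-1) * (m * (c - t)).
Proof. by move=> m0 /(ler_wpM2l m0); lra. Qed.

Let tilt_aux (X m d c Y : R) : 0 <= X ->
  X + m * (d * X + c * (X * Y)) <= X * expR (m * (d + c * Y)).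
Proof.
move=> X0; rewrite [leLHS](_ : _ = X * (1 + m * (d + c * Y))); last by ring.
by rewrite ler_wpM2l// expR_ge1Dx.
Qed.

Let final_aux (t p q e E X : R) : t - (p + q) / 2 + X <= 0 -> e / 2 * E <= X ->
  e * E <= p + q - 2 * t.
Proof. by lra. Qed.

(** The inequalities are checked through [step_le] or [step_ge], by a pointwise
    bound inside the Gaussian mean.  For [pc_upper] the weights of [sum_expR_weights]
    turn the bound into concavity of [x |-> x ^ m], which needs [m <= 1].  For
    [pc_lower] the exponential is expanded at first order; with [A] the
    recentred function, what is left is that [expR ((m - 2) * A)] has mean at
    least 1, because [m <= 2] and [A] has nonpositive mean. *)
Lemma step_parisi_class m v F : 0 <= m -> m <= 1 -> parisi_class F ->
  parisi_class (T m v F).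
Proof.
move=> m0 m1 [lF cF eF uF dF].
have lT := step_nonexpansive v m0 lF.
have eB (x c : R) : egrow (fun g => F (x + g * Num.sqrt v) - c).
  by apply: egrowB; [exact: egrow_nonexp_move|exact: egrow_cst].
have IB (x c : R) : \int[gamma]_g (F (x + g * Num.sqrt v) - c) = T 0 v F x - c.
  by rewrite gaussB ?gauss_cst ?step0E//; [exact: egrow_nonexp_move|exact: egrow_cst].
split; first exact: lT.
- move=> l x y l0 l1; have l1' : 0 <= 1 - l by rewrite subr_ge0.
  have P (z : R) : F (l * x + (1 - l) * y + z) <= l * F (x + z) + (1 - l) * F (y + z).
    have -> : l * x + (1 - l) * y + z = l * (x + z) + (1 - l) * (y + z) by ring.
    exact: cF.
  move: m0; rewrite le_eqVlt => /predU1P[<-|mp].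
    rewrite !step0E -gauss_lin; [|exact: egrow_nonexp_move..].
    apply: le_gauss => //; first exact: egrow_nonexp_move.
    by apply: egrowD; apply: egrowZ; exact: egrow_nonexp_move.
  have mn : m != 0 by rewrite gt_eqF.
  apply: step_le => //.
  have E1 : \int[gamma]_g (l * expR (m * (F (x + g * Num.sqrt v) - T m v F x)) +
     (1 - l) * expR (m * (F (y + g * Num.sqrt v) - T m v F y))) = 1.
    rewrite gauss_lin; [|exact: egrow_exp_move..].
    transitivity (l * 1 + (1 - l) * 1); last by rewrite !mulr1 addrC subrK.
    by congr (_ * _ + _ * _); exact: step_spec.
  rewrite -[leRHS]E1; apply: le_gauss; first exact: egrow_exp_move.
    by apply: egrowD; apply: egrowZ; exact: egrow_exp_move.
  move=> g; apply: le_trans (expR_convex _ _ l0 l1); rewrite ler_expR.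
  by apply: convex_aux; [exact: ltW|exact: P].
- move=> x; rewrite /log_exp_step.
  have sg (H : R -> R) : egrow (fun y => H (F y)) ->
      \int[gamma]_g H (F (- x + g * Num.sqrt v)) = \int[gamma]_g H (F (x + g * Num.sqrt v)).
    move=> eH; rewrite -gauss_sym; last exact: (egrow_move _ _ eH).
    by apply: eq_gauss => g; rewrite -eF opprD opprK mulNr opprK.
  have [_|_] := eqVneq m 0; first by apply: (sg id); exact: nonexpansive_egrow.
  congr (_ * ln _); apply: (sg (fun t => expR (m * t))).
  apply: eq_egrow (egrow_exp_nonexpansive m 0 lF) => g.
  by rewrite addr0.
- move=> x y.
  have [tp tpE] := name (T m v F (x + y)).
  have [tm tmE] := name (T m v F (x - y)).
  have [l [K [l0 l1 H HS]]] := sum_expR_weights tp tm y.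
  rewrite -tpE -tmE; apply: HS.
  have P (z : R) : l * expR (F (x + y + z) - tp) + (1 - l) * expR (F (x - y + z) - tm) <= expR (F (x + z) - K).
    apply: H; have := uF (x + z) y.
    rewrite (_ : x + z + y = x + y + z); last by ring.
    by rewrite (_ : x + z - y = x - y + z); last by ring.
  move: m0; rewrite le_eqVlt => /predU1P[m00|mp].
    rewrite -m00 -subr_ge0 -IB.
    have <- : \int[gamma]_g (l * (F (x + y + g * Num.sqrt v) - tp) +
        (1 - l) * (F (x - y + g * Num.sqrt v) - tm)) = 0.
      rewrite gauss_lin; [|exact: eB..].
      rewrite (IB (x + y) tp) (IB (x - y) tm) [in T 0 v F (x + y)]m00 [in T 0 v F (x - y)]m00 -tpE -tmE; ring.
    apply: le_gauss => //; first by apply: egrowD; exact: egrowZ (eB _ _).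
    by move=> g; apply: expR_power_concave0 => //; exact: P.
  apply: step_ge => //.
  have mn : m != 0 by rewrite gt_eqF.
  have E1 : \int[gamma]_g (l * expR (m * (F (x + y + g * Num.sqrt v) - tp)) +
      (1 - l) * expR (m * (F (x - y + g * Num.sqrt v) - tm))) = 1.
    rewrite gauss_lin; [|exact: egrow_exp_move..].
    rewrite tpE tmE; transitivity (l * 1 + (1 - l) * 1); last by rewrite !mulr1 addrC subrK.
    by congr (_ * _ + _ * _); exact: step_spec.
  rewrite -[leLHS]E1; apply: le_gauss; last 2 first.
  + exact: egrow_exp_move.
  + by move=> g; apply: expR_power_concave => //; exact: ltW.
  by apply: egrowD; apply: egrowZ; exact: egrow_exp_move.
- move=> x y.
  have [e eE] := name (2 * logcosh y); rewrite -eE.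
  have e0 : 0 <= e by rewrite eE mulr_ge0// logcosh_ge0.
  have [tp tpE] := name (T m v F (x + y)).
  have [tm tmE] := name (T m v F (x - y)).
  have [t tE] := name (T m v F x).
  rewrite -tpE -tmE -tE.
  have P (z : R) : e * expR (- 2 * F (x + z)) <= F (x + y + z) + F (x - y + z) - 2 * F (x + z).
    have := dF (x + z) y; rewrite -eE.
    rewrite (_ : x + z + y = x + y + z); last by ring.
    by rewrite (_ : x + z - y = x - y + z); last by ring.
  pose W (g : R) : R := expR (- 2 * (F (x + g * Num.sqrt v) - t)).
  have WE (g : R) : expR (- 2 * F (x + g * Num.sqrt v)) = expR (- 2 * t) * W g.
    by rewrite /W -expRD; congr expR; ring.
  have eW : egrow W by exact: egrow_exp_move.
  move: m0; rewrite le_eqVlt => /predU1P[m00|mp].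
    have eD : egrow (fun g => (F (x + y + g * Num.sqrt v) - tp) + (F (x - y + g * Num.sqrt v) - tm)).
      exact: egrowD.
    have eL : egrow (fun g => 1 + - 2 * (F (x + g * Num.sqrt v) - t)).
      by apply: egrowD; [exact: egrow_cst|exact: egrowZ].
    have : \int[gamma]_g (e * expR (- 2 * t) * (1 + - 2 * (F (x + g * Num.sqrt v) - t))) <=
      \int[gamma]_g (((F (x + y + g * Num.sqrt v) - tp) + (F (x - y + g * Num.sqrt v) - tm) - 2 * (F (x + g * Num.sqrt v) - t)) + (tp + tm - 2 * t)).
      apply: le_gauss.
      + exact: egrowZ.
      + apply: egrowD; last exact: egrow_cst.
        by apply: egrowB => //; exact: egrowZ.
      move=> g; have := P (g * Num.sqrt v); rewrite WE => h.
      apply: (@le_trans _ _ (e * (expR (- 2 * t) * W g))).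
        by rewrite -mulrA ler_wpM2l// ler_wpM2l ?expR_ge0//; exact: expR_ge1Dx.
      by apply: le_trans h _; rewrite le_eqVlt; apply/orP; left; apply/eqP; ring.
    rewrite (gaussZ _ eL).
    have -> : \int[gamma]_g (1 + - 2 * (F (x + g * Num.sqrt v) - t)) = 1.
      rewrite gaussD; [|exact: egrow_cst|exact: egrowZ].
      by rewrite gauss_cst (gaussZ (-2) (eB x t)) (IB x t) tE -m00 subrr mulr0 addr0.
    rewrite mulr1 => h; apply: le_trans h _.
    rewrite gaussD; [|by apply: egrowB => //; exact: egrowZ|exact: egrow_cst].
    rewrite gauss_cst gaussB//; last exact: egrowZ.
    rewrite gaussD// (gaussZ 2 (eB x t)) (IB x t) (IB (x + y) tp) (IB (x - y) tm).
    rewrite [in T 0 v F (x + y)]m00 [in T 0 v F (x - y)]m00 [in T 0 v F x]m00 -tpE -tmE -tE.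
    by rewrite le_eqVlt; apply/orP; left; apply/eqP; ring.
  have mn : m != 0 by rewrite gt_eqF.
  pose dl := t - (tp + tm) / 2.
  pose A (g : R) : R := F (x + g * Num.sqrt v) - t.
  have eA : egrow A by exact: eB.
  have H1 : \int[gamma]_g (expR (m * A g) + m * (dl * expR (m * A g) + e / 2 * expR (- 2 * t) * expR ((m - 2) * A g))) <= 1.
    have E1 : \int[gamma]_g (2^-1 * expR (m * (F (x + y + g * Num.sqrt v) - tp)) +
        (1 - 2^-1) * expR (m * (F (x - y + g * Num.sqrt v) - tm))) = 1.
      rewrite gauss_lin; [|exact: egrow_exp_move..].
      transitivity (2^-1 * 1 + (1 - 2^-1) * 1 : R); last by rewrite !mulr1 addrC subrK.
      by rewrite tpE tmE; congr (_ * _ + _ * _); exact: step_spec.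
    rewrite -[leRHS]E1; apply: le_gauss.
    + apply: egrowD; first exact: egrow_exp_move.
      by apply: egrowZ; apply: egrowD; apply: egrowZ; exact: egrow_exp_move.
    + by apply: egrowD; apply: egrowZ; exact: egrow_exp_move.
    move=> g; apply: le_trans (expR_convex _ _ _ _); last 2 first.
    + by rewrite invr_ge0.
    + by rewrite invf_le1// ler1n.
    apply: (@le_trans _ _ (expR (m * (A g + dl + e / 2 * expR (- 2 * F (x + g * Num.sqrt v)))))); last first.
      rewrite ler_expR (_ : e / 2 * expR (- 2 * F (x + g * Num.sqrt v)) =
        e * expR (- 2 * F (x + g * Num.sqrt v)) / 2); last by rewrite mulrAC.
      by apply: lower_aux; [exact: ltW|exact: P].
    rewrite WE.
    have -> : expR ((m - 2) * A g) = expR (m * A g) * W g.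
      by rewrite /W -expRD /A; congr expR; rewrite mulrBl mulNr.
    have -> : m * (A g + dl + e / 2 * (expR (- 2 * t) * W g)) =
        m * A g + m * (dl + e / 2 * expR (- 2 * t) * W g).
      by rewrite -addrA mulrDr (mulrA (e / 2)).
    by rewrite expRD; apply: tilt_aux; exact: expR_ge0.
  move: H1; rewrite gaussD; [|exact: egrow_exp_move|by apply: egrowZ; apply: egrowD; apply: egrowZ; exact: egrow_exp_move].
  rewrite gaussZ; last by apply: egrowD; apply: egrowZ; exact: egrow_exp_move.
  rewrite gauss_lin; [|exact: egrow_exp_move..].
  have -> : \int[gamma]_g expR (m * A g) = 1 by rewrite /A tE; exact: step_spec.
  have H2 : 1 <= \int[gamma]_g expR ((m - 2) * A g).
    apply: (@le_trans _ _ (\int[gamma]_g (1 + (m - 2) * A g))); last first.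
      apply: le_gauss; [|exact: egrow_exp_move|by move=> g; exact: expR_ge1Dx].
      by apply: egrowD; [exact: egrow_cst|exact: egrowZ].
    rewrite gaussD; [|exact: egrow_cst|exact: egrowZ].
    rewrite (gaussZ _ eA) (IB x t) gauss_cst lerDl mulr_le0//.
      by rewrite subr_le0 (le_trans m1)// ler1n.
    by rewrite tE subr_le0 step_ge_step0// ltW.
  rewrite gerDl pmulr_rle0// mulr1 => H3.
  have H4 : e / 2 * expR (-2 * t) <= e / 2 * expR (-2 * t) * (\int[gamma]_g expR ((m - 2) * A g)).
    by rewrite ler_peMr// mulr_ge0 ?expR_ge0// divr_ge0.
  exact: final_aux H3 H4.
Qed.

End parisi_class.

(** * Elementary inequalities for the exponential *)
Section calculus.
Context {R : realType}.
Implicit Types (f F G : R -> R) (x y z : R).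

Lemma nondecreasing_from0 f (df : R -> R) :
  (forall x, is_derive (x : R^o) (1 : R^o) (f : R^o -> R^o) (df x)) ->
  (forall x, 0 <= x -> 0 <= df x) -> forall x, 0 <= x -> f 0 <= f x.
Proof.
move=> H df0 x; rewrite le_eqVlt => /predU1P[<-//|x0].
have cf : {within `[0, x], continuous f}.
  apply: continuous_subspaceT => y.
  have [d _] := H y.
  by apply: differentiable_continuous; exact/derivable1_diffP.
have [c /itvP c0 E] := MVT x0 (fun y _ => H y) cf.
by rewrite -subr_ge0 E mulr_ge0// ?subr_ge0 ?(ltW x0)// df0// c0.
Qed.

(** A family closed under differentiation: each inequality below reduces to
    the one for the derivative. *)
Definition exp_poly (p : {poly R}) (a b : R) : R -> R :=
  horner p + (a \*: (expR : R -> R) + b \*: (expR \o -%R : R -> R)).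

Lemma exp_polyE p a b x : exp_poly p a b x = p.[x] + (a * expR x + b * expR (- x)).
Proof. by []. Qed.

Lemma is_derive_exp_poly p a b x :
  is_derive (x : R^o) (1 : R^o) (exp_poly p a b : R^o -> R^o) (exp_poly (deriv p) a (- b) x).
Proof.
have D2 : is_derive (x : R^o) (1 : R^o) (expR \o -%R : R^o -> R^o) (expR (- x) * -1).
  exact: (is_derive1_comp (is_derive_expR (- x)) (is_deriveNid (x : R^o) (1 : R^o))).
apply: (is_derive_eq (is_deriveD (is_derive_poly p x)
  (is_deriveD (is_deriveZ a (is_derive_expR x)) (is_deriveZ b D2)))).
by rewrite exp_polyE /GRing.scale/= mulrN1 mulrN mulNr.
Qed.

Lemma exp_poly_nondecreasing p a b :
  (forall x, 0 <= x -> 0 <= exp_poly (deriv p) a (- b) x) ->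
  forall x, 0 <= x -> exp_poly p a b 0 <= exp_poly p a b x.
Proof. exact: (@nondecreasing_from0 (exp_poly p a b) _ (is_derive_exp_poly p a b)). Qed.

Local Notation cubic c0 c1 c2 c3 :=
  ((c0)%:P + (c1) *: 'X + (c2) *: 'X^2 + (c3) *: 'X^3 : {poly R}).

Lemma expRN_le2 x : 0 <= x -> expR (- x) <= 1 - x + x ^+ 2 / 2.
Proof.
move=> x0; have h : forall y, 0 <= y -> 0 <= exp_poly (deriv (cubic 1 (-1) 2^-1 0)) 0 (- -1) y.
  move=> y y0; rewrite exp_polyE !(derivD, derivZ, derivC, derivX, derivXn) !hornerE /=.
  by have := expR_ge1Dx (- y); lra.
have := @exp_poly_nondecreasing (cubic 1 (-1) 2^-1 0) 0 (-1) h x x0.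
by rewrite !exp_polyE !hornerE /= oppr0 expR0; lra.
Qed.

Lemma expRN_ge3 x : 0 <= x -> 1 - x + x ^+ 2 / 2 - x ^+ 3 / 6 <= expR (- x).
Proof.
move=> x0; have h : forall y, 0 <= y -> 0 <= exp_poly (deriv (cubic (-1) 1 (- 2^-1) 6^-1)) 0 (- 1) y.
  move=> y y0; rewrite exp_polyE !(derivD, derivZ, derivC, derivX, derivXn) !hornerE /=.
  by have := expRN_le2 y0; lra.
have := @exp_poly_nondecreasing (cubic (-1) 1 (- 2^-1) 6^-1) 0 1 h x x0.
by rewrite !exp_polyE !hornerE /= oppr0 expR0; lra.
Qed.

Lemma expR_sinh_ge x : 0 <= x -> 2 * x <= expR x - expR (- x).
Proof.
move=> x0; have h : forall y, 0 <= y -> 0 <= exp_poly (deriv (cubic 0 (-2) 0 0)) 1 (- -1) y.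
  move=> y y0; rewrite exp_polyE !(derivD, derivZ, derivC, derivX, derivXn) !hornerE /=.
  by have := expR_ge1Dx y; have := expR_ge1Dx (- y); lra.
have := @exp_poly_nondecreasing (cubic 0 (-2) 0 0) 1 (-1) h x x0.
by rewrite !exp_polyE !hornerE /= oppr0 expR0; lra.
Qed.

(** The sharp constant [1 / 2] of the quadratic term is what makes the
    first-order expansion of an exponential mean exact. *)
Lemma expR_le_cubic x :
  expR x <= 1 + x + x ^+ 2 / 2 + `|x| ^+ 3 / 2 * expR `|x|.
Proof.
have [x0|x0] := leP 0 x; last first.
  have x0' : 0 <= - x by rewrite oppr_ge0 ltW.
  have := expRN_le2 x0'; rewrite opprK sqrrN => h.
  by apply: le_trans h _; rewrite lerDl mulr_ge0 ?expR_ge0// divr_ge0// exprn_ge0.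
rewrite ger0_norm//.
suff H : 1 <= (1 + x + x ^+ 2 / 2) * expR (- x) + x ^+ 3 / 2.
  have := ler_wpM2r (expR_ge0 x) H; rewrite mul1r => h; apply: le_trans h _.
  have E := expRxMexpNx_1 x.
  rewrite [leLHS](_ : _ = (1 + x + x ^+ 2 / 2) * (expR x * expR (- x)) + x ^+ 3 / 2 * expR x).
    by rewrite E mulr1.
  by ring.
have e0 := expR_ge0 (- x).
have q0 : 0 <= 1 + x + x ^+ 2 / 2 by rewrite !addr_ge0// divr_ge0// sqr_ge0.
(* The cubic term alone suffices for [2 <= x]; otherwise [expRN_ge3] does. *)
have [x2|x2] := leP 2 x.
  apply: (@le_trans _ _ (x ^+ 3 / 2)); last by rewrite lerDr mulr_ge0.
  have : 4 <= x ^+ 2 by nra.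
  by rewrite exprSr; nra.
have := ler_wpM2l q0 (expRN_ge3 x0).
have : 0 <= x ^+ 3 * (4 + x - x ^+ 2) by rewrite mulr_ge0 ?exprn_ge0//; nra.
by lra.
Qed.

Lemma expR_cosh_ge x : x ^+ 2 <= expR x + expR (- x) - 2.
Proof.
wlog x0 : x / 0 <= x => [H|].
  have [|x0] := leP 0 x; first exact: H.
  by have := H (- x); rewrite opprK sqrrN (addrC (expR (- x))); apply; rewrite oppr_ge0 ltW.
have x2 : 0 <= x / 2 by rewrite divr_ge0.
have := expR_sinh_ge x2; rewrite mulrC divfK// => h.
have -> : expR x + expR (- x) - 2 = (expR (x / 2) - expR (- (x / 2))) ^+ 2.
  have E := expRxMexpNx_1 (x / 2).
  rewrite {1 2}(splitr x) opprD !expRD sqrrB E; ring.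
by rewrite ler_sqr ?nnegrE// (le_trans x0).
Qed.

End calculus.

(** * Slopes *)
Section slopes.
Context {R : realType}.
Implicit Types (F G : R -> R) (x y z : R).

Lemma pc_second F x y : parisi_class F -> F (x + y) + F (x - y) - 2 * F x <= 4 * y ^+ 2.
Proof.
move=> [_ _ _ uF _]; have := uF x y.
have -> : expR y + expR (- y) = 2 * expR (logcosh y).
  by rewrite expR_logcosh mulrC divfK.
rewrite -mulrA -expRD => h.
have l0 : 0 <= 2^-1 :> R by rewrite invr_ge0.
have l1 : 2^-1 <= 1 :> R by rewrite invf_le1// ler1n.
have := expR_convex (F (x + y)) (F (x - y)) l0 l1.
have -> : 1 - 2^-1 = 2^-1 :> R by field.
rewrite -!mulrDr => h2.
have : expR (2^-1 * (F (x + y) + F (x - y))) <= expR (logcosh y + F x).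
  by apply: le_trans h2 _; rewrite mulrC ler_pdivrMr// mulrC.
by rewrite ler_expR; have := logcosh_le y; lra.
Qed.

Lemma convex_slopes F x y z : (forall l x y, 0 <= l -> l <= 1 ->
    F (l * x + (1 - l) * y) <= l * F x + (1 - l) * F y) -> 0 < y -> 0 < z ->
  (F x - F (x - y)) / y <= (F (x + z) - F x) / z.
Proof.
move=> cF y0 z0.
have yz : 0 < y + z by rewrite addr_gt0.
pose l := z / (y + z).
have l0 : 0 <= l by rewrite divr_ge0 ?ltW.
have lE : 1 - l = y / (y + z) by rewrite /l; field; rewrite gt_eqF.
have l1 : l <= 1 by rewrite -subr_ge0 lE divr_ge0 ?ltW.
have := cF l (x - y) (x + z) l0 l1; rewrite lE.
have -> : l * (x - y) + y / (y + z) * (x + z) = x.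
  by rewrite /l; field; rewrite gt_eqF.
rewrite /l (_ : _ + _ = (z * F (x - y) + y * F (x + z)) / (y + z)); last by ring.
rewrite ler_pdivlMr// => h.
rewrite ler_pdivrMr// mulrAC ler_pdivlMr//.
lra.
Qed.

(** By convexity the supremum of the left difference quotients is a subgradient,
    and [pc_second] bounds the distance to the tangent. *)
Lemma pc_slope F x : parisi_class F ->
  exists D, forall y, 0 <= F (x + y) - F x - D * y <= 4 * y ^+ 2.
Proof.
move=> pF; have cF := pc_convex pF.
pose A : set R := [set s | exists2 y, 0 < y & s = (F x - F (x - y)) / y].
have A0 : A !=set0 by exists ((F x - F (x - 1)) / 1); exists 1.
have Aub z : 0 < z -> ubound A ((F (x + z) - F x) / z).
  by move=> z0 _ [y y0 ->]; exact: convex_slopes.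
have sA : has_sup A by split => //; exists ((F (x + 1) - F x) / 1); exact: Aub.
pose D := sup A.
have Dr z : 0 < z -> D * z <= F (x + z) - F x.
  by move=> z0; rewrite -ler_pdivlMr//; apply: ge_sup => //; exact: Aub.
have Dl y : 0 < y -> F x - F (x - y) <= D * y.
  by move=> y0; rewrite -ler_pdivrMr//; apply: (ub_le_sup sA.2); exists y.
exists D => y.
have S := pc_second x y pF.
have [y0|y0|->] := ltrgt0P y.
- by have := Dr _ y0; have := Dl _ y0; lra.
- have y0' : 0 < - y by rewrite oppr_gt0.
  have := Dr _ y0'; have := Dl _ y0'; rewrite opprK !mulrN; lra.
- by rewrite addr0 mulr0 subrr subr0 expr0n mulr0 lexx.
Qed.

Lemma quadratic_derive1 F x D (C : R) : 0 <= C ->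
  (forall y, `|F (x + y) - F x - D * y| <= C * y ^+ 2) -> derive1 F x = D.
Proof.
move=> C0 H; rewrite /derive1; apply/cvg_lim => //.
apply/cvgrPdist_le => e e0.
have d0 : 0 < e / (C + 1) by rewrite divr_gt0// ltr_pwDr.
near=> h.
have h0 : h != 0 by near: h; exact: nbhs_dnbhs_neq.
have hd : `|h| <= e / (C + 1).
  near: h; apply: nbhs_dnbhs; near=> h.
  have : `|0 - h| < e / (C + 1).
    by near: h; exact: (@cvgr_dist_lt _ _ _ _ _ id 0).
  by rewrite sub0r normrN => /ltW.
have -> : D - h^-1 *: (F (h + x) - F x) = - (h^-1 * (F (x + h) - F x - D * h)).
  by rewrite /GRing.scale/= (addrC h); field.
rewrite normrN normrM normfV ler_pdivrMl ?normr_gt0//.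
apply: le_trans (H h) _; rewrite -(real_normK (num_real h)) expr2 mulrCA ler_wpM2l//.
apply: le_trans (_ : (C + 1) * `|h| <= e); first by rewrite ler_wpM2r// lerDl.
by rewrite mulrC -ler_pdivlMr// ltr_pwDr.
Unshelve. all: end_near. Qed.

Lemma pc_taylor F x y : parisi_class F ->
  0 <= F (x + y) - F x - derive1 F x * y <= 4 * y ^+ 2.
Proof.
move=> /pc_slope => /(_ x)[D H]; rewrite (@quadratic_derive1 F x D 4)// => z.
by have /andP[h1 h2] := H z; rewrite ger0_norm.
Qed.

Lemma le_of_quadratic (a C : R) : (forall y, 0 < y -> a * y <= C * y ^+ 2) -> 0 <= C -> a <= 0.
Proof.
move=> H C0; rewrite leNgt; apply/negP => a0.
have C1 : 0 < C + 1 by rewrite ltr_pwDr.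
have [y yE] : exists y, y = a / (C + 1) by exists (a / (C + 1)).
have y0 : 0 < y by rewrite yE divr_gt0.
have := H y y0; rewrite expr2 mulrA ler_pM2r// leNgt => /negP; apply.
have -> : a = (C + 1) * y by rewrite yE mulrC divfK// gt_eqF.
by rewrite ltr_pM2r// ltrDl.
Qed.

Lemma pc_slope_le1 F x : parisi_class F -> `|derive1 F x| <= 1.
Proof.
move=> pF; have lF := pc_lip pF.
have L y : `|F (x + y) - F x| <= `|y| by have := lF (x + y) x; rewrite addrAC subrr add0r.
rewrite ler_norml; apply/andP; split.
  rewrite -subr_le0; apply: (@le_of_quadratic _ 4) => // y y0.
  have := pc_taylor x (- y) pF; have := L (- y).
  rewrite normrN (gtr0_norm y0) ler_norml sqrrN mulrN => /andP[_ h] /andP[h1 _].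
  have := pc_taylor x y pF; have := L y.
  by rewrite (gtr0_norm y0) ler_norml => /andP[h3 _] /andP[_ h4]; lra.
rewrite -subr_le0; apply: (@le_of_quadratic _ 4) => // y y0.
have := pc_taylor x y pF; have := L y.
rewrite (gtr0_norm y0) ler_norml => /andP[_ h] /andP[h1 _].
have q : 0 <= 4 * y ^+ 2 by rewrite mulr_ge0// sqr_ge0.
by lra.
Qed.

Lemma pc_slope_mono F x z : parisi_class F ->
  0 <= (derive1 F z - derive1 F x) * (z - x) <= 8 * (z - x) ^+ 2.
Proof.
move=> pF; have := pc_taylor x (z - x) pF; have := pc_taylor z (x - z) pF.
have -> : x + (z - x) = z by ring.
have -> : z + (x - z) = x by ring.
by move=> /andP[a b] /andP[c d]; apply/andP; split; lra.
Qed.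

Lemma pc_slope_lip F x z : parisi_class F -> `|derive1 F z - derive1 F x| <= 8 * `|z - x|.
Proof.
move=> pF; have [->|zx] := eqVneq z x; first by rewrite !subrr normr0 mulr0.
have p : 0 < `|z - x| by rewrite normr_gt0 subr_eq0.
rewrite -(ler_pM2r p) -mulrA -expr2 real_normK ?num_real// -normrM.
by have /andP[h1 h2] := pc_slope_mono x z pF; rewrite ger0_norm.
Qed.

(** Compare the increments of [F] and [G] over a distance [r]: their tangents at
    [x] are accurate up to [4 * r ^+ 2]. *)
Lemma pc_slope_close F G x (r : R) : 0 < r -> parisi_class F -> parisi_class G ->
  (forall y, `|F y - G y| <= r ^+ 2) -> `|derive1 F x - derive1 G x| <= 6 * r.
Proof.
move=> r0 + + FG.
have H (F' G' : R -> R) : parisi_class F' -> parisi_class G' ->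
   (forall y, `|F' y - G' y| <= r ^+ 2) -> derive1 F' x - derive1 G' x <= 6 * r.
  move=> pF pG FG'; rewrite -(ler_pM2r r0).
  have := pc_taylor x r pF; have := pc_taylor x r pG.
  have := FG' (x + r); have := FG' x; rewrite !ler_norml.
  by move=> /andP[a b] /andP[c d] /andP[e f] /andP[g h]; lra.
move=> pF pG; rewrite ler_norml; apply/andP; split; last exact: H.
by rewrite lerNl opprB; apply: H => // y; rewrite distrC.
Qed.

End slopes.

(** * Expansion of the step in its parameter *)
Section step_upper.
Context {R : realType}.
Local Notation gamma := (@std_gauss R).
Local Notation T := log_exp_step.
Implicit Types (F G : R -> R) (m v w x y : R).

Lemma egrow_pow (n : nat) : egrow (fun g : R => g ^+ n).
Proof.
elim: n => [|n IH]; first by apply: eq_egrow (egrow_cst 1) => g; rewrite expr0.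
by apply: eq_egrow (egrowM (@egrow_id R) IH) => g; rewrite exprS.
Qed.

(** The second moment is read off the exponential moments, since
    [(a * g) ^+ 2] is at most [expR (a * g) + expR (- a * g) - 2] and the mean of
    the latter is [a ^+ 2] at leading order. *)
Lemma gauss_square_le1 : \int[gamma]_g g ^+ 2 <= 1.
Proof.
set V := \int[_]_g _.
have e2 := egrow_pow 2.
have H (a : R) : 0 < a -> a <= 1 -> V <= 1 + a ^+ 2.
  move=> a0 a1.
  have a20 : 0 < a ^+ 2 by rewrite exprn_gt0.
  have : \int[gamma]_g (a ^+ 2 * g ^+ 2) <=
     \int[gamma]_g (1 * expR (a * g) + 1 * (expR (- a * g) + - 2)).
    apply: le_gauss.
    - exact: egrowZ.
    - apply: egrowD; apply: egrowZ; first exact: egrow_exp_lin.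
      by apply: egrowD; [exact: egrow_exp_lin|exact: egrow_cst].
    - by move=> g; have := expR_cosh_ge (a * g); rewrite exprMn mulNr !mul1r addrA.
  rewrite gaussZ// gauss_lin; [|exact: egrow_exp_lin|by apply: egrowD; [exact: egrow_exp_lin|exact: egrow_cst]].
  rewrite gaussD; [|exact: egrow_exp_lin|exact: egrow_cst].
  rewrite gauss_cst !gauss_exp sqrrN -/V => h.
  have E : expR (a ^+ 2 / 2) <= 1 + a ^+ 2 / 2 + (a ^+ 2) ^+ 2 / 2.
    rewrite -[leLHS]invrK -expRN.
    have b1 : a ^+ 2 <= 1 by rewrite expr_le1// ltW.
    set b := a ^+ 2 in a20 b1 *.
    have h1 : 0 < 1 - b / 2 by lra.
    apply: (@le_trans _ _ (1 - b / 2)^-1).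
      by rewrite lef_pV2 ?posrE ?expR_gt0//; exact: (expR_ge1Dx (- (b / 2))).
    rewrite -[leLHS]div1r ler_pdivrMr//.
    have q : 0 <= b ^+ 2 * (1 - b) by rewrite mulr_ge0 ?sqr_ge0// subr_ge0.
    by lra.
  rewrite -(ler_pM2l a20); lra.
apply/ler_addgt0Pr => e e0.
pose a := Num.min 1 e.
have a0 : 0 < a by rewrite lt_min ltr01 e0.
have a1 : a <= 1 by rewrite ge_min lexx.
have ae : a <= e by rewrite ge_min lexx orbT.
apply: le_trans (H _ a0 a1) _; rewrite lerD2l; apply: le_trans ae.
by rewrite expr2 ler_piMl// ltW.
Qed.

Lemma gauss_abs_le1 : \int[gamma]_g `|g| <= 1.
Proof.
have en := egrow_norm (@egrow_id R).
have e2 := egrow_pow 2.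
have : \int[gamma]_g `|g| <= \int[gamma]_g (2^-1 * 1 + 2^-1 * g ^+ 2).
  apply: le_gauss => //.
    by apply: egrowD; apply: egrowZ => //; exact: egrow_cst.
  move=> g; rewrite -(real_normK (num_real g)).
  by have := sqr_ge0 (`|g| - 1); lra.
rewrite gauss_lin//; last exact: egrow_cst.
by rewrite gauss_cst; have := gauss_square_le1; lra.
Qed.

Definition quadratic_step_bound (s0 C : R) := forall m v F x,
  0 <= m -> m <= 1 -> 0 <= v -> Num.sqrt v <= s0 -> parisi_class F ->
  T m v F x <= T 0 v F x + m * v / 2 * (derive1 F x ^+ 2 + C * Num.sqrt v).

Definition linear_step_bound (s0 C : R) := forall m v F x,
  0 <= m -> m <= 1 -> 0 <= v -> Num.sqrt v <= s0 -> parisi_class F ->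
  T m v F x <= T 0 v F x + C * m * v /\ T m v F x <= F x + C * v.

Lemma pc_step0_ge F v x : 0 <= v -> parisi_class F -> F x <= T 0 v F x.
Proof.
move=> v0 pF; have lF := pc_lip pF.
have e1 := egrow_nonexp_move x v lF.
have e2 : egrow (fun g => - derive1 F x * (g * Num.sqrt v)).
  by apply: eq_egrow (egrowZ (- derive1 F x * Num.sqrt v) (@egrow_id R)) => g; ring.
rewrite step0E.
have -> : F x = \int[gamma]_g (F x + derive1 F x * Num.sqrt v * g).
  rewrite gaussD; [|exact: egrow_cst|apply: egrowZ; exact: egrow_id].
  rewrite gauss_cst gaussZ; last exact: egrow_id.
  by rewrite gauss_mean mulr0 addr0.
apply: le_gauss => //.
  by apply: egrowD; [exact: egrow_cst|apply: egrowZ; exact: egrow_id].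
by move=> g; have /andP[h _] := pc_taylor x (g * Num.sqrt v) pF; lra.
Qed.

Lemma pc_step0_le F v x : 0 <= v -> parisi_class F -> T 0 v F x <= F x + 4 * v.
Proof.
move=> v0 pF; have lF := pc_lip pF; rewrite step0E.
have e2 : egrow (fun g : R => derive1 F x * Num.sqrt v * g).
  by apply: egrowZ; exact: egrow_id.
have e3 : egrow (fun g : R => F x + derive1 F x * Num.sqrt v * g).
  by apply: egrowD => //; exact: egrow_cst.
have e4 : egrow (fun g : R => 4 * v * g ^+ 2) by apply: egrowZ; exact: egrow_pow.
apply: (@le_trans _ _ (\int[gamma]_g (F x + derive1 F x * Num.sqrt v * g + 4 * v * g ^+ 2))).
  apply: le_gauss; [exact: egrow_nonexp_move|exact: egrowD|move=> g].
  have /andP[_] := pc_taylor x (g * Num.sqrt v) pF.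
  by rewrite exprMn sqr_sqrtr//; lra.
rewrite gaussD// gaussD//; last exact: egrow_cst.
rewrite gauss_cst (gaussZ (4 * v) (egrow_pow 2)).
rewrite (gaussZ (derive1 F x * Num.sqrt v) (@egrow_id R)).
rewrite gauss_mean mulr0 addr0 lerD2l.
by rewrite ler_piMr ?mulr_ge0// gauss_square_le1.
Qed.

(** Here [Y] stands for the value of [F] recentred at its mean, and [a * s * g]
    for its linear part. *)
Let cube_aux (a v s g Y s0 : R) : 0 <= s -> s <= s0 -> v = s ^+ 2 ->
  `|Y - a * s * g| <= 4 * v * (g ^+ 2 + 1) -> `|Y| <= s * (`|g| + 1) -> `|a| <= 1 ->
  Y ^+ 2 + `|Y| ^+ 3 * expR `|Y| <= a ^+ 2 * v * g ^+ 2 +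
   v * s * (4 * (g ^+ 2 + 1) * (2 * `|g| + 1) + (`|g| + 1) ^+ 3 * expR (s0 * (`|g| + 1))).
Proof.
move=> sp ss0 vE h1 h2 a1.
have n0 := normr_ge0 g; have g1 : 0 <= `|g| + 1 by lra.
have -> : Y ^+ 2 = a ^+ 2 * v * g ^+ 2 + (Y - a * s * g) * (Y + a * s * g).
  by rewrite vE; ring.
rewrite -[leLHS]addrA lerD2l (mulrDr (v * s)); apply: lerD.
  apply: le_trans (ler_norm _) _; rewrite normrM.
  have h3 : `|Y + a * s * g| <= s * (2 * `|g| + 1).
    apply: le_trans (ler_normD _ _) _.
    have : `|a * s * g| <= s * `|g|.
      by rewrite !normrM (ger0_norm sp) ler_wpM2r// ler_piMl.
    by lra.
  rewrite [leRHS](_ : _ = (4 * v * (g ^+ 2 + 1)) * (s * (2 * `|g| + 1))); last by ring.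
  by rewrite ler_pM.
have -> : v * s * ((`|g| + 1) ^+ 3 * expR (s0 * (`|g| + 1))) =
  (s * (`|g| + 1)) ^+ 3 * expR (s0 * (`|g| + 1)) by rewrite vE; ring.
apply: ler_pM; rewrite ?exprn_ge0 ?expR_ge0//.
  by rewrite lerXn2r// nnegrE// mulr_ge0.
by rewrite ler_expR (le_trans h2)// ler_wpM2r.
Qed.

Let exp_aux (m Y Z : R) : 0 <= m -> m <= 1 -> Y ^+ 2 + `|Y| ^+ 3 * expR `|Y| <= Z ->
  expR (m * Y) <= 1 + m * Y + m ^+ 2 / 2 * Z.
Proof.
move=> m0 m1 H; apply: le_trans (expR_le_cubic _) _.
rewrite -addrA lerD2l normrM (ger0_norm m0) !exprMn.
have m2 : 0 <= m ^+ 2 / 2 by rewrite divr_ge0// sqr_ge0.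
apply: le_trans (ler_wpM2l m2 H).
have -> : m ^+ 2 * Y ^+ 2 / 2 + m ^+ 3 * `|Y| ^+ 3 / 2 * expR (m * `|Y|) =
  m ^+ 2 / 2 * (Y ^+ 2 + `|Y| ^+ 3 * (m * expR (m * `|Y|))) by ring.
rewrite ler_wpM2l// lerD2l ler_wpM2l ?exprn_ge0//.
apply: (@le_trans _ _ (1 * expR (m * `|Y|))); first by rewrite ler_wpM2r ?expR_ge0.
by rewrite mul1r ler_expR ler_piMl.
Qed.

(** Second-order expansion of the step in its parameter [m]: the variance of
    [F] under the Gaussian increment is at most [v * F'(x) ^ 2], up to an error
    of order [v ^ (3 / 2)]. *)
Lemma step_upper (s0 : R) : exists C, 0 <= C /\ quadratic_step_bound s0 C.
Proof.
pose Q (g : R) : R := 4 * (g ^+ 2 + 1) * (2 * `|g| + 1) + (`|g| + 1) ^+ 3 * expR (s0 * (`|g| + 1)).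
have en := egrow_norm (@egrow_id R).
have en1 : egrow (fun g : R => `|g| + 1) by apply: egrowD => //; exact: egrow_cst.
have eQ : egrow Q.
  apply: egrowD; apply: egrowM.
  - by apply: egrowZ; apply: egrowD; [exact: egrow_pow|exact: egrow_cst].
  - by apply: egrowD; [exact: egrowZ|exact: egrow_cst].
  - by apply: eq_egrow (egrowM en1 (egrowM en1 en1)) => g; rewrite !exprS expr0 mulr1.
  - have [s00|s00] := leP 0 s0.
      apply: eq_egrow (egrow_expZ (expR_ge0 s0) s00) => g.
      by rewrite -expRD mulrDr mulr1 addrC.
    split.
      move=> g; apply: continuous_comp; last exact: continuous_expR.
      by apply: cvgM; [exact: cvg_cst|exact: en1.1].
    exists 1, 0; split => // g; rewrite mul0r expR0 mulr1 ger0_norm ?expR_ge0//.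
    by rewrite expR_le1 nmulr_rle0// addr_ge0.
have Q0 (g : R) : 0 <= Q g.
  have n0 := normr_ge0 g; have g2 := sqr_ge0 g.
  rewrite /Q; apply: addr_ge0; apply: mulr_ge0; try exact: expR_ge0.
  - by apply: mulr_ge0 => //; lra.
  - by lra.
  - by apply: exprn_ge0; lra.
exists (\int[gamma]_g Q g); split; first exact: gauss_ge0.
move=> m v F x m0 m1 v0 vs pF; have lF := pc_lip pF.
move: m0; rewrite le_eqVlt => /predU1P[<-|mp]; first by rewrite !mul0r addr0.
set C := \int[gamma]_g Q g; set a := derive1 F x; set H := T 0 v F x.
set d := m * v / 2 * _.
apply: step_le => //.
pose s := Num.sqrt v.
have s_ge0 : 0 <= s := sqrtr_ge0 v.
have vE : v = s ^+ 2 by rewrite sqr_sqrtr.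
pose Y (g : R) : R := F (x + g * s) - H.
have eY : egrow Y by apply: egrowB; [exact: egrow_nonexp_move|exact: egrow_cst].
have hH1 : F x <= H := pc_step0_ge x v0 pF.
have hH2 : H <= F x + 4 * v := pc_step0_le x v0 pF.
have hH3 : H <= F x + s.
  rewrite /H step0E; apply: (@le_trans _ _ (\int[gamma]_g (F x + s * `|g|))).
    apply: le_gauss; [exact: egrow_nonexp_move|by apply: egrowD; [exact: egrow_cst|exact: egrowZ]|move=> g].
    apply: le_trans (nonexpansive_le _ x lF) _.
    by rewrite addrAC subrr add0r normrM (ger0_norm s_ge0) mulrC.
  rewrite gaussD; [|exact: egrow_cst|exact: egrowZ].
  by rewrite gauss_cst gaussZ// lerD2l ler_piMr// gauss_abs_le1.
have Y1 (g : R) : `|Y g - a * s * g| <= 4 * v * (g ^+ 2 + 1).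
  have /andP[h1 h2] := pc_taylor x (g * s) pF.
  move: h1 h2; rewrite -/a exprMn -vE /Y ler_norml => h1 h2.
  have g2 : 0 <= v * g ^+ 2 by rewrite mulr_ge0 ?sqr_ge0.
  by apply/andP; split; lra.
have Y2 (g : R) : `|Y g| <= s * (`|g| + 1).
  have h1 := nonexpansive_le (x + g * s) x lF.
  have h2 := nonexpansive_le x (x + g * s) lF.
  have E : `|x + g * s - x| = s * `|g|.
    by rewrite addrAC subrr add0r normrM (ger0_norm s_ge0) mulrC.
  have E' : `|x - (x + g * s)| = s * `|g| by rewrite distrC.
  move: h1 h2; rewrite E E' /Y ler_norml => h1 h2.
  have sg : 0 <= s * `|g| by rewrite mulr_ge0.
  by apply/andP; split; lra.
have a1 : `|a| <= 1 by exact: pc_slope_le1.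
have K (g : R) : expR (m * Y g) <= 1 + (m * Y g + (m ^+ 2 / 2) * (a ^+ 2 * v * g ^+ 2 + v * s * Q g)).
  rewrite addrA; apply: exp_aux => //; first exact: ltW.
  by apply: cube_aux => //; exact: Y2.
have IY : \int[gamma]_g Y g = 0.
  rewrite gaussB; [|exact: egrow_nonexp_move|exact: egrow_cst].
  by rewrite gauss_cst /H step0E subrr.
have e3 : egrow (fun g => a ^+ 2 * v * g ^+ 2 + v * s * Q g).
  by apply: egrowD; apply: egrowZ => //; exact: egrow_pow.
have eE : egrow (fun g => expR (m * Y g)) by exact: egrow_exp_move.
have B : \int[gamma]_g expR (m * Y g) <= 1 + m * d.
  apply: (@le_trans _ _ (\int[gamma]_g (1 + (m * Y g + (m ^+ 2 / 2) * (a ^+ 2 * v * g ^+ 2 + v * s * Q g))))).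
    apply: le_gauss => //; apply: egrowD; first exact: egrow_cst.
    by apply: egrowD; exact: egrowZ.
  rewrite gaussD; [|exact: egrow_cst|by apply: egrowD; exact: egrowZ].
  rewrite gauss_lin// IY gauss_cst mulr0 add0r lerD2l.
  rewrite gauss_lin//; last exact: egrow_pow.
  rewrite -/C /d -/s.
  have m2 : 0 <= m ^+ 2 / 2 by rewrite divr_ge0// sqr_ge0.
  have av : 0 <= a ^+ 2 * v by rewrite mulr_ge0 ?sqr_ge0.
  have -> : m * (m * v / 2 * (a ^+ 2 + C * s)) = m ^+ 2 / 2 * (a ^+ 2 * v + v * s * C) by ring.
  by rewrite ler_wpM2l// lerD2r ler_piMr// gauss_square_le1.
have -> : \int[gamma]_g expR (m * (F (x + g * Num.sqrt v) - (H + d))) =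
  expR (- (m * d)) * \int[gamma]_g expR (m * Y g).
  rewrite -gaussZ//; apply: eq_gauss => g; rewrite -expRD; congr expR.
  by rewrite /Y /s; ring.
rewrite expRN mulrC ler_pdivrMr ?expR_gt0// mul1r (le_trans B)//.
exact: expR_ge1Dx.
Qed.

Lemma step_ge_id m v F x : 0 <= m -> 0 <= v -> parisi_class F -> F x <= T m v F x.
Proof.
move=> m0 v0 pF; apply: le_trans (pc_step0_ge x v0 pF) _.
by apply: step_ge_step0 => //; exact: pc_lip.
Qed.

(** Crude consequences of [step_upper], in which the increment enters linearly
    and hence adds up over successive steps. *)
Lemma step_upper_linear (s0 : R) : exists C, 0 <= C /\ linear_step_bound s0 C.
Proof.
have [C [C0 H]] := step_upper s0.
have [s00|s00] := ltP s0 0.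
  exists 0; split => // m v F x m0 m1 v0 vs.
  by have := le_lt_trans (le_trans (sqrtr_ge0 v) vs) s00; rewrite ltxx.
exists ((1 + C * s0) / 2 + 4).
have CC : 0 <= (1 + C * s0) / 2 by rewrite divr_ge0// addr_ge0// mulr_ge0.
split; first by rewrite addr_ge0.
move=> m v F x m0 m1 v0 vs pF.
have h1 := H m v F x m0 m1 v0 vs pF.
have h2 : m * v / 2 * (derive1 F x ^+ 2 + C * Num.sqrt v) <= (1 + C * s0) / 2 * (m * v).
  have -> : (1 + C * s0) / 2 * (m * v) = m * v / 2 * (1 + C * s0) by ring.
  rewrite ler_wpM2l ?divr_ge0 ?mulr_ge0// lerD//; last by rewrite ler_wpM2l.
  by rewrite -(real_normK (num_real _)) expr_le1// pc_slope_le1.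
have mv : 0 <= m * v by rewrite mulr_ge0.
have mv' : m * v <= v by rewrite ler_piMl.
have h3 := pc_step0_le x v0 pF.
have h4 := ler_wpM2l CC mv'.
split.
  apply: le_trans h1 _; rewrite lerD2l; apply: le_trans h2 _.
  by rewrite -[leRHS]mulrA ler_wpM2r// lerDl.
apply: le_trans (le_trans h1 (lerD h3 (le_trans h2 h4))) _.
by rewrite -addrA lerD2l [leRHS]mulrDl addrC.
Qed.

End step_upper.

(** * The discrete solution, one layer at a time *)
Section layers.
Context {R : realType}.
Local Notation gamma := (@std_gauss R).
Local Notation T := log_exp_step.
Variables (xi : R -> R) (k : nat) (m q : nat -> R).
Hypothesis adm : admissible k m q.
Hypothesis dxi_mono : forall x y : R, 0 <= x -> x <= y -> derive1 xi x <= derive1 xi y.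
Local Notation dxi := (derive1 xi).
Implicit Types (p r n : nat) (s t x y : R).

Let q_le p r : (p <= r)%N -> (r <= k.+2)%N -> q p <= q r.
Proof.
have [_ _ _ _ [qS _]] := adm.
elim: r => [|r IH]; first by rewrite leqn0 => /eqP ->.
rewrite leq_eqVlt => /predU1P[->//|pr] rk.
by apply: le_trans (qS r rk); apply: IH => //; exact: ltnW.
Qed.

Let m_le p r : (p <= r)%N -> (r <= k.+1)%N -> m p <= m r.
Proof.
have [_ mS _ _ _] := adm.
elim: r => [|r IH]; first by rewrite leqn0 => /eqP ->.
rewrite leq_eqVlt => /predU1P[->//|pr] rk.
by apply: le_trans (mS r rk); apply: IH => //; exact: ltnW.
Qed.

Let q0 : q 0%N = 0. Proof. by case: adm. Qed.
Let q1 : q k.+2 = 1. Proof. by case: adm => _ _ _ _ []. Qed.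
Let m0 : m 0%N = 0. Proof. by case: adm. Qed.
Let m1 : m k.+1 = 1. Proof. by case: adm. Qed.

Lemma adm_m_ge0 p : (p <= k.+1)%N -> 0 <= m p.
Proof. by move=> pk; rewrite -m0; apply: m_le. Qed.

Lemma adm_m_le1 p : (p <= k.+1)%N -> m p <= 1.
Proof. by move=> pk; rewrite -m1; apply: m_le. Qed.

Lemma adm_m_le p r : (p <= r)%N -> (r <= k.+1)%N -> m p <= m r.
Proof. exact: m_le. Qed.

Lemma adm_q_le p r : (p <= r)%N -> (r <= k.+2)%N -> q p <= q r.
Proof. exact: q_le. Qed.

Lemma adm_q_ge0 p : (p <= k.+2)%N -> 0 <= q p.
Proof. by move=> pk; rewrite -q0; apply: q_le. Qed.

Lemma adm_q_le1 p : (p <= k.+2)%N -> q p <= 1.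
Proof. by move=> pk; rewrite -q1; apply: q_le. Qed.

Local Notation Phi := (PhiD xi (Triplet k m q)).

Let PhiD_recS n p x s : PhiD_rec xi m q n.+1 p x s =
  if s < q p.+1 then T (m p) (dxi (q p.+1) - dxi s)
    (fun y => PhiD_rec xi m q n p.+1 y (q p.+1)) x
  else PhiD_rec xi m q n p.+1 x s.
Proof. by []. Qed.

Lemma PhiD_rec_class n p s : (p + n = k.+2)%N ->
  parisi_class (fun x => PhiD_rec xi m q n p x s).
Proof.
elim: n p s => [|n IH] p s pn /=; first exact: logcosh_parisi_class.
have pn' : (p.+1 + n = k.+2)%N by rewrite addSnnS.
have pk : (p <= k.+1)%N by rewrite -ltnS -pn -addSnnS leq_addr.
have [sq|sq] := ltP s (q p.+1); last exact: IH.
by apply: step_parisi_class; [exact: adm_m_ge0|exact: adm_m_le1|exact: IH].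
Qed.

Lemma PhiD_class s : parisi_class (Phi ^~ s).
Proof. exact: PhiD_rec_class. Qed.

Lemma PhiD_nonexp s : nonexpansive (Phi ^~ s).
Proof. exact: pc_lip (PhiD_class s). Qed.

Lemma PhiD_skip p x s : (p <= k.+2)%N -> q p <= s ->
  Phi x s = PhiD_rec xi m q (k.+2 - p) p x s.
Proof.
elim: p => [|p IH] pk qs; first by rewrite subn0.
rewrite IH; [|exact: ltnW|by apply: le_trans qs; exact: q_le].
by rewrite (subSn (pk : (p <= k.+1)%N)) PhiD_recS ltNge qs subSS.
Qed.

Let PhiD_node p s x : (p <= k.+1)%N -> q p <= s -> s <= q p.+1 ->
  Phi x s = T (m p) (dxi (q p.+1) - dxi s) (Phi ^~ (q p.+1)) x.
Proof.
move=> pk ps; rewrite le_eqVlt => /predU1P[->|sq].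
  by rewrite subrr step_v0//; exact: PhiD_nonexp.
have -> : Phi ^~ (q p.+1) = (fun y => PhiD_rec xi m q (k.+1 - p) p.+1 y (q p.+1)).
  by apply/funext => y; rewrite (@PhiD_skip p.+1) ?subSS.
by rewrite (PhiD_skip x (leqW pk) ps) (subSn pk) PhiD_recS sq.
Qed.

(** By the semigroup property a layer can be cut at an arbitrary time. *)
Lemma PhiD_layer p s t x : (p <= k.+1)%N -> q p <= s -> s <= t -> t <= q p.+1 ->
  Phi x s = T (m p) (dxi t - dxi s) (Phi ^~ t) x.
Proof.
move=> pk ps st tq.
have s0 : 0 <= s by apply: le_trans ps; apply: adm_q_ge0; exact: leqW.
rewrite (PhiD_node x pk ps (le_trans st tq)).
have -> : Phi ^~ t = T (m p) (dxi (q p.+1) - dxi t) (Phi ^~ (q p.+1)).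
  by apply/funext => y; exact: PhiD_node y pk (le_trans ps st) tq.
rewrite step_conv.
- by rewrite (addrC (dxi t - dxi s)) addrA subrK.
- by rewrite subr_ge0; exact: dxi_mono.
- by rewrite subr_ge0; apply: dxi_mono => //; exact: le_trans st.
- exact: adm_m_ge0.
- exact: PhiD_nonexp.
Qed.

(** Carries the one-layer facts [PhiD_layer] and [weight_int_layer] from [b]
    down to an arbitrary earlier time [a]. *)
Lemma layer_induction (Q : R -> Prop) (a b : R) : 0 <= a -> a <= b -> b <= 1 -> Q b ->
  (forall p s t, (p <= k.+1)%N -> q p <= s -> s < t -> t <= q p.+1 ->
    a <= s -> t <= b -> Q t -> Q s) -> Q a.
Proof.
move=> a0 ab b1 Qb step.
suff H n : (n <= k.+2)%N -> forall s, a <= s -> s <= b -> q (k.+2 - n) <= s -> Q s.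
  by apply: (H k.+2) => //; rewrite subnn q0.
elim: n => [|n IH] nk s as_ sb.
  rewrite subn0 q1 => s1.
  by have -> : s = b by apply/le_anti; rewrite sb (le_trans b1).
have := subnSK nk; set p := (k.+2 - n.+1)%N => pE ps.
have pk : (p <= k.+1)%N by rewrite /p subSS leq_subr.
move: IH => /(_ (ltnW nk)); rewrite -pE => IH.
have [qs|sq] := leP (q p.+1) s; first exact: IH.
have [bq|qb] := leP b (q p.+1).
  move: sb; rewrite le_eqVlt => /predU1P[->//|sb].
  exact: (step p s b).
apply: (step p s (q p.+1)) => //; first exact: ltW.
by apply: IH => //; [exact: le_trans (ltW sq)|exact: ltW].
Qed.

(** [weight_int om s] is the Stieltjes integral of [u |-> mu ([0, u])] against
    [d om] over [[s, 1]]. *)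
Definition weight_int (om : R -> R) (s : R) : R :=
  \sum_(0 <= p < k.+2) m p * (om (Num.max s (q p.+1)) - om (Num.max s (q p))).

Lemma weight_int_layer om p s t : (p <= k.+1)%N -> q p <= s -> s <= t -> t <= q p.+1 ->
  weight_int om s = weight_int om t + m p * (om t - om s).
Proof.
move=> pk ps st tq; rewrite /weight_int !big_mkord.
have pk2 : (p < k.+2)%N by [].
rewrite (bigD1 (Ordinal pk2))//= [in RHS](bigD1 (Ordinal pk2))//=.
have sq := le_trans st tq; have pt := le_trans ps st.
rewrite (max_r sq) (max_r tq) (max_l ps) (max_l pt).
rewrite (eq_bigr (fun i : 'I_k.+2 => m i * (om (Num.max t (q i.+1)) - om (Num.max t (q i))))).
  by rewrite addrAC -mulrDr addrA subrK.
move=> i; rewrite -val_eqE /= neq_ltn => /orP[ip|pi].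
  have h1 : q i.+1 <= q p by apply: q_le => //; exact: leqW.
  have h2 : q i <= q p by apply: q_le; [exact: ltnW|exact: leqW].
  rewrite (max_l (le_trans h1 ps)) (max_l (le_trans h2 ps)).
  by rewrite (max_l (le_trans h1 pt)) (max_l (le_trans h2 pt)) !subrr.
have h1 : q p.+1 <= q i by apply: q_le => //; exact: ltnW.
have h2 : q p.+1 <= q i.+1 by apply: q_le => //; exact: ltnW.
rewrite (max_r (le_trans sq h1)) (max_r (le_trans sq h2)).
by rewrite (max_r (le_trans tq h1)) (max_r (le_trans tq h2)).
Qed.

Lemma weight_int0 om :
  weight_int om 0 = \sum_(1 <= p < k.+2) m p * (om (q p.+1) - om (q p)).
Proof.
rewrite /weight_int big_nat_recl// m0 mul0r add0r big_add1 /=.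
rewrite !big_nat; apply: eq_bigr => p /andP[_ pk].
by rewrite !max_r// ?adm_q_ge0// leqW.
Qed.

Let Psi j x := PhiD_rec xi m q j (k.+2 - j) x (q (k.+2 - j)%N).

Let Psi_class j : (j <= k.+2)%N -> parisi_class (Psi j).
Proof. by move=> jk; apply: PhiD_rec_class; rewrite subnK. Qed.

Let PsiS j : (j <= k.+1)%N ->
  Psi j.+1 = T (m (k.+1 - j)) (dxi (q (k.+1 - j).+1) - dxi (q (k.+1 - j)%N)) (Psi j).
Proof.
move=> jk; apply/funext => x; rewrite {1}/Psi PhiD_recS subSS -(subSn jk).
have := q_le (leqnSn (k.+1 - j)) _; rewrite -subSn// leq_subr => /(_ isT).
rewrite le_eqVlt => /predU1P[->|->//].
by rewrite ltxx subrr step_v0//; exact: pc_lip (Psi_class (leqW jk)).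
Qed.

(** Only the mean over [z p] acts on a function of the sum of the first
    variables. *)
Let E_from_sum p (f : R -> R) y z : (p <= k.+1)%N ->
  E_from xi k q p (fun y z => f (y + \sum_(0 <= i < p.+1) z i)) y z =
  \int[gamma]_g f (y + \sum_(0 <= i < p) z i + g * Num.sqrt (dxi (q p.+1) - dxi (q p))).
Proof.
move=> pk; rewrite /E_from (subSn pk) [iota _ _]/= [foldr _ _ _]/=.
have -> : foldr (E_coord xi q) (fun y z => f (y + \sum_(0 <= i < p.+1) z i)) (iota p.+1 (k.+1 - p)) =
    (fun y z => f (y + \sum_(0 <= i < p.+1) z i)).
  have : all (fun i => p < i)%N (iota p.+1 (k.+1 - p)).
    by apply/allP => i; rewrite mem_iota => /andP[].
  elim: (iota _ _) => //= i l IH /andP[pi /IH ->].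
  apply/funext => y'; apply/funext => z'; rewrite /E_coord.
  rewrite -[RHS]gauss_cst; apply: eq_gauss => g; congr (f (_ + _)).
  rewrite !big_nat; apply: eq_bigr => r /andP[_ rp].
  by rewrite /set_coord ltn_eqF// (leq_trans rp).
rewrite /E_coord; apply: eq_gauss => g; congr f.
rewrite big_nat_recr//= addrA; congr (_ + _ + _).
  rewrite !big_nat; apply: eq_bigr => r /andP[_ rp].
  by rewrite /set_coord ltn_eqF.
by rewrite /set_coord eqxx mulrC.
Qed.

(** The recursion of the functional and the one of the discrete solution agree:
    [X_p] depends on [h] and the [z_i] through their sum, and it is the value of
    the discrete solution at time [q p]. *)
Let X_downE j y z : (j <= k.+1)%N ->
  X_down xi k m q j y z = Psi j (y + \sum_(0 <= i < k.+2 - j) z i).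
Proof.
elim: j y z => [|j IH] y z jk; first by rewrite subn0.
have pk : (k.+1 - j <= k.+1)%N by exact: leq_subr.
have E : X_down xi k m q j = (fun y z => Psi j (y + \sum_(0 <= i < (k.+1 - j).+1) z i)).
  apply/funext => y'; apply/funext => z'; rewrite IH; last exact: ltnW.
  by rewrite -subSn// ltnW.
rewrite /= E PsiS; last exact: ltnW.
rewrite subSS /log_exp_step; case: ifP => _; first by rewrite E_from_sum.
by rewrite (E_from_sum (fun x => expR (m (k.+1 - j)%N * Psi j x))).
Qed.

Lemma parisi_X0E d (Om : measurableType d) (P : probability Om R) (h : Om -> R) :
  parisi_X0 P h xi k m q = \int[P]_w Phi (h w) 0.
Proof.
rewrite /parisi_X0; apply: eq_Rintegral => w _.
have -> : parisi_X xi k m q 1 = (fun y z => Psi k.+1 (y + \sum_(0 <= i < 1) z i)).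
  rewrite /parisi_X subSS subn0; apply/funext => y; apply/funext => z.
  by rewrite X_downE// subSnn.
rewrite E_from_sum// big_nil addr0.
have := congr1 (fun f => f (h w)) (PsiS (leqnn k.+1)).
rewrite subnn m0 /log_exp_step eqxx => <-.
by rewrite /Psi subnn q0.
Qed.

Lemma parisi_functionalE d (Om : measurableType d) (P : probability Om R) (h : Om -> R) :
  parisi_functional P h xi k m q =
  ln 2 + \int[P]_w Phi (h w) 0 - 2^-1 * weight_int (theta xi) 0.
Proof. by rewrite /parisi_functional parisi_X0E weight_int0. Qed.

End layers.

(** * The mixture function *)
Section mixture_facts.
Context {R : realType}.
Implicit Types (f : R -> R) (x y s t : R).

Lemma mean_value f s t : s < t -> (forall x, s <= x <= t -> derivable f x 1) ->
  exists c, [/\ s < c, c < t & f t - f s = derive1 f c * (t - s)].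
Proof.
move=> st df.
have D (x : R) : x \in `]s, t[%R -> is_derive (x : R^o) (1 : R^o) (f : R^o -> R^o) (derive1 f x).
  rewrite in_itv/= => /andP[sx xt].
  by apply: DeriveDef; [apply: df; rewrite !ltW|rewrite derive1E].
have cf : {within `[s, t], continuous f}.
  apply: continuous_in_subspaceT => x; rewrite inE/= in_itv/= => sxt.
  exact/differentiable_continuous/derivable1_diffP/df.
have [c] := MVT st D cf; rewrite in_itv/= => /andP[sc ct] E.
by exists c; split.
Qed.

Variable xi : R -> R.
Hypothesis mix : is_mixture xi.
Local Notation dxi := (derive1 xi).

Lemma derivable_continuous f : (forall x, derivable f x 1) -> continuous f.
Proof. by move=> df x; exact/differentiable_continuous/derivable1_diffP/df. Qed.

Lemma dxi_continuous : continuous dxi.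
Proof. by apply: derivable_continuous; exact: mixture_derivable2. Qed.

Lemma dxi0 : dxi 0 = 0.
Proof.
have E : xi = xi \o -%R by apply/funext => x /=; exact: mixture_even.
have dN : derivable (-%R : R -> R) 0 1 by apply: derivableN; exact: derivable_id.
have := @derive1_comp R -%R xi 0 dN (@mixture_derivable _ _ mix (- 0)).
rewrite -E /= oppr0 => H.
have : dxi 0 = - dxi 0.
  rewrite {1}H (derive1E -%R) deriveN; last exact: derivable_id.
  by rewrite derive_id mulrN1.
by lra.
Qed.

Lemma dxi_lt s t : 0 <= s -> s < t -> dxi s < dxi t.
Proof.
move=> s0 st.
have [c [sc ct E]] := mean_value st (fun x _ => @mixture_derivable2 _ _ mix x).
rewrite -subr_gt0 E mulr_gt0// ?subr_gt0//.
have := @mixture_deriv2 _ _ mix c; apply.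
by rewrite gt_eqF// (le_lt_trans s0).
Qed.

Lemma dxi_le s t : 0 <= s -> s <= t -> dxi s <= dxi t.
Proof. by move=> s0; rewrite le_eqVlt => /predU1P[->//|st]; exact/ltW/dxi_lt. Qed.

Lemma dxi_ge0 s : 0 <= s -> 0 <= dxi s.
Proof. by move=> s0; rewrite -dxi0 dxi_le. Qed.

Let mid_aux (a b c : R) : c - a <= b - c -> 2 * c <= a + b.
Proof. by lra. Qed.

(** The derivative of [xi'] is nondecreasing on the open half line.  The mean
    value theorem is applied on each side of the midpoint, so that only points
    away from 0 are used. *)
Lemma dxi_midpoint s t : 0 <= s -> 0 <= t ->
  2 * dxi ((s + t) / 2) <= dxi s + dxi t.
Proof.
wlog st : s t / s <= t => [H s0 t0|].
  have [|/ltW ts] := leP s t; first by move=> st; exact: H.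
  by rewrite (addrC s) (addrC (dxi s)); exact: H.
move: st; rewrite le_eqVlt => /predU1P[->|st] s0 t0.
  have -> : (t + t) / 2 = t by field.
  by rewrite mulr_natl mulr2n.
set c := (s + t) / 2.
have sc : s < c by rewrite /c; lra.
have ct : c < t by rewrite /c; lra.
have [a [sa ac Ea]] := mean_value sc (fun x _ => @mixture_derivable2 _ _ mix x).
have [b [cb bt Eb]] := mean_value ct (fun x _ => @mixture_derivable2 _ _ mix x).
have a0 : 0 < a by exact: le_lt_trans sa.
have ab : a < b by exact: lt_trans cb.
have [e [ae eb Ee]] := @mean_value (derive1n 2 xi) a b ab
  (fun x xab => @mixture_derivable3 _ _ mix x (lt_le_trans a0 (proj1 (andP xab)))).
have e0 : 0 < e by exact: lt_trans ae.
have h3 : derive1 dxi a <= derive1 dxi b.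
  rewrite -subr_ge0; rewrite [X in 0 <= X]Ee mulr_ge0 ?subr_ge0 ?(ltW ab)//.
  exact: (mixture_deriv3 mix e0).
have hcs : 0 <= t - c by rewrite subr_ge0 ltW.
apply: mid_aux.
rewrite [leLHS]Ea [leRHS]Eb (_ : c - s = t - c); last by rewrite /c; field.
exact: ler_wpM2r.
Qed.

(** Formally [d theta = u * d xi'], integrated between [s] and [t]. *)
Lemma theta_bounds s t : 0 <= s -> s <= t ->
  s * (dxi t - dxi s) <= theta xi t - theta xi s /\
  theta xi t - theta xi s <= t * (dxi t - dxi s).
Proof.
move=> s0; rewrite le_eqVlt => /predU1P[->|st]; first by rewrite !subrr !mulr0.
have [c [sc ct E]] := mean_value st (fun x _ => @mixture_derivable _ _ mix x).
have c0 : 0 <= c by rewrite (le_trans s0)// ltW.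
have h1 : 0 <= (t - s) * (dxi t - dxi c).
  by rewrite mulr_ge0// subr_ge0 ?dxi_le ?(ltW ct)// ltW.
have h2 : 0 <= (t - s) * (dxi c - dxi s).
  by rewrite mulr_ge0// subr_ge0 ?dxi_le ?(ltW sc)// ltW.
rewrite /theta.
have -> : t * dxi t - xi t - (s * dxi s - xi s) = t * dxi t - s * dxi s - (xi t - xi s) by ring.
by rewrite E; split; lra.
Qed.

Lemma theta_le s t : 0 <= s -> s <= t -> theta xi s <= theta xi t.
Proof.
move=> s0 st; have [h _] := theta_bounds s0 st.
by rewrite -subr_ge0 (le_trans _ h)// mulr_ge0// subr_ge0 dxi_le.
Qed.

End mixture_facts.

(** * Bounds across several layers *)
Section layer_bounds.
Context {R : realType}.
Local Notation gamma := (@std_gauss R).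
Local Notation T := log_exp_step.
Variables (xi : R -> R) (mix : is_mixture xi).
Variables (k : nat) (m q : nat -> R) (adm : admissible k m q).
Local Notation dxi := (derive1 xi).
Local Notation Phi := (PhiD xi (Triplet k m q)).
Local Notation J := (weight_int k m q).
Implicit Types (p : nat) (s t x y a b : R).

Let mono := dxi_le mix.

Let telescope (a b c : R) : c - a = (b - a) + (c - b).
Proof. by rewrite [RHS]addrC addrA subrK. Qed.

(** The function [om'] plays the role of a primitive of the integrand: it is
    enough to compare increments inside one layer. *)
Lemma weight_int_le (om om' : R -> R) a b : 0 <= a -> a <= b -> b <= 1 ->
  (forall p s t, (p <= k.+1)%N -> q p <= s -> s < t -> t <= q p.+1 ->
    a <= s -> t <= b -> m p * (om t - om s) <= om' t - om' s) ->
  J om a - J om b <= om' b - om' a.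
Proof.
move=> a0 ab b1 H.
apply: (layer_induction adm (Q := fun s => J om s - J om b <= om' b - om' s) a0 ab b1).
  by rewrite !subrr.
move=> p s t pk ps st tq as_ tb IH.
rewrite (weight_int_layer adm om pk ps (ltW st) tq).
by have := H p s t pk ps st tq as_ tb; move: IH; lra.
Qed.

Lemma weight_int_ge (om om' : R -> R) a b : 0 <= a -> a <= b -> b <= 1 ->
  (forall p s t, (p <= k.+1)%N -> q p <= s -> s < t -> t <= q p.+1 ->
    a <= s -> t <= b -> om' t - om' s <= m p * (om t - om s)) ->
  om' b - om' a <= J om a - J om b.
Proof.
move=> a0 ab b1 H.
apply: (layer_induction adm (Q := fun s => om' b - om' s <= J om s - J om b) a0 ab b1).
  by rewrite !subrr.
move=> p s t pk ps st tq as_ tb IH.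
rewrite (weight_int_layer adm om pk ps (ltW st) tq).
by have := H p s t pk ps st tq as_ tb; move: IH; lra.
Qed.

(** The bounds [step_shift_ge] compose because the drift is the same in every
    layer: displacements and costs both add up to a Stieltjes integral. *)
Lemma PhiD_shift_ge a b x (al : R) : 0 <= a -> a <= b -> b <= 1 ->
  T 0 (dxi b - dxi a) (Phi ^~ b) (x + (J dxi a - J dxi b) * al)
    - (J dxi a - J dxi b) * al ^+ 2 / 2 <= Phi x a.
Proof.
move=> a0 ab b1; move: x.
apply: (layer_induction adm (Q := fun s => forall x,
  T 0 (dxi b - dxi s) (Phi ^~ b) (x + (J dxi s - J dxi b) * al)
    - (J dxi s - J dxi b) * al ^+ 2 / 2 <= Phi x s) a0 ab b1).
  move=> x; rewrite !subrr !mul0r addr0 subr0 step_v0//.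
  exact: (PhiD_nonexp xi adm).
move=> p s t pk ps st tq as_ tb IH x.
have s0 : 0 <= s by exact: le_trans as_.
have t0 : 0 <= t by rewrite (le_trans s0)// ltW.
have v0 : 0 <= dxi t - dxi s by rewrite subr_ge0 mono// ltW.
have v1 : 0 <= dxi b - dxi t by rewrite subr_ge0 mono.
rewrite (PhiD_layer adm mono x pk ps (ltW st) tq).
have m0 := adm_m_ge0 adm pk.
have lt : nonexpansive (Phi ^~ t) by exact: (PhiD_nonexp xi adm).
have lb : nonexpansive (Phi ^~ b) by exact: (PhiD_nonexp xi adm).
have h := step_shift_ge x al m0 v0 lt.
apply: le_trans h.
have -> : J dxi s = J dxi t + m p * (dxi t - dxi s).
  exact: (weight_int_layer adm dxi pk ps (ltW st) tq).
set V := dxi t - dxi s in v0 *.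
have [K KE] : exists K, K = J dxi t - J dxi b by eexists.
have -> : J dxi t + m p * V - J dxi b = K + m p * V by rewrite KE addrAC.
have -> : dxi b - dxi s = V + (dxi b - dxi t) by exact: telescope.
rewrite -(step_conv _ v0 v1 (lexx 0) lb).
have h2 : T 0 V (T 0 (dxi b - dxi t) (Phi ^~ b)) (x + (K + m p * V) * al) <=
  T 0 V (Phi ^~ t) (x + m p * V * al) + K * al ^+ 2 / 2.
  apply: step_mono => //; first exact: step_nonexpansive.
  move=> z; have := IH (x + m p * V * al + z); rewrite -KE lerBlDr.
  by have -> : x + m p * V * al + z + K * al = x + (K + m p * V) * al + z by ring.
rewrite lerBlDr; apply: le_trans h2 _.
rewrite -addrA lerD2l le_eqVlt; apply/orP; left; apply/eqP.
by ring.
Qed.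

Lemma PhiD_heat_ge a b x : 0 <= a -> a <= b -> b <= 1 ->
  T 0 (dxi b - dxi a) (Phi ^~ b) x <= Phi x a.
Proof.
move=> a0 ab b1; have := PhiD_shift_ge x 0 a0 ab b1.
by rewrite expr0n mulr0 addr0 !(mulr0, mul0r) subr0.
Qed.

Variable C : R.
Hypothesis C0 : 0 <= C.
Hypothesis C_upper : linear_step_bound (Num.sqrt (dxi 1)) C.

Let sqrt_dxi s t : 0 <= s -> s <= t -> t <= 1 -> Num.sqrt (dxi t - dxi s) <= Num.sqrt (dxi 1).
Proof.
move=> s0 st t1; rewrite ler_sqrt; last by rewrite (dxi_ge0 mix).
rewrite lerBlDr (le_trans (mono _ t1)) ?(le_trans s0)//.
by rewrite lerDl (dxi_ge0 mix).
Qed.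

(** The excess of a step over the heat flow is linear in its parameter. *)
Lemma PhiD_heat_le (e : R) a b x : 0 <= a -> a <= b -> b <= 1 -> 0 <= e ->
  (forall p, (p <= k.+1)%N -> q p < b -> m p <= e) ->
  Phi x a <= T 0 (dxi b - dxi a) (Phi ^~ b) x + C * e * (dxi b - dxi a).
Proof.
move=> a0 ab b1 e0 He; move: x.
apply: (layer_induction adm (Q := fun s => forall x,
  Phi x s <= T 0 (dxi b - dxi s) (Phi ^~ b) x + C * e * (dxi b - dxi s)) a0 ab b1).
  move=> x; rewrite !subrr mulr0 addr0 step_v0//.
  exact: (PhiD_nonexp xi adm).
move=> p s t pk ps st tq as_ tb IH x.
have s0 : 0 <= s by exact: le_trans as_.
have t0 : 0 <= t by rewrite (le_trans s0)// ltW.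
have v0 : 0 <= dxi t - dxi s by rewrite subr_ge0 mono// ltW.
have v1 : 0 <= dxi b - dxi t by rewrite subr_ge0 mono.
rewrite (PhiD_layer adm mono x pk ps (ltW st) tq).
have lb : nonexpansive (Phi ^~ b) by exact: (PhiD_nonexp xi adm).
have [h _] := C_upper x (adm_m_ge0 adm pk) (adm_m_le1 adm pk) v0
  (sqrt_dxi s0 (ltW st) (le_trans tb b1)) (PhiD_class xi adm t).
apply: le_trans h _.
have h2 : C * m p * (dxi t - dxi s) <= C * e * (dxi t - dxi s).
  by rewrite ler_wpM2r// ler_wpM2l// He// (le_lt_trans ps)// (lt_le_trans st).
have h3 : T 0 (dxi t - dxi s) (Phi ^~ t) x <=
    T 0 (dxi b - dxi s) (Phi ^~ b) x + C * e * (dxi b - dxi t).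
  rewrite (telescope (dxi s) (dxi t) (dxi b)).
  rewrite -(step_conv _ v0 v1 (lexx 0) lb).
  apply: step_mono.
  - exact: lexx.
  - exact: (PhiD_nonexp xi adm).
  - exact: step_nonexpansive.
  - by move=> z; exact: IH.
apply: le_trans (lerD h3 h2) _.
rewrite -addrA lerD2l -mulrDr le_eqVlt; apply/orP; left; apply/eqP.
by rewrite addrA subrK.
Qed.

Lemma PhiD_time a b x : 0 <= a -> a <= b -> b <= 1 ->
  Phi x b <= Phi x a /\ Phi x a <= Phi x b + C * (dxi b - dxi a).
Proof.
move=> a0 ab b1; move: x.
apply: (layer_induction adm (Q := fun s => forall x,
  Phi x b <= Phi x s /\ Phi x s <= Phi x b + C * (dxi b - dxi s)) a0 ab b1).
  by move=> x; rewrite subrr mulr0 addr0.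
move=> p s t pk ps st tq as_ tb IH x.
have s0 : 0 <= s by exact: le_trans as_.
have v0 : 0 <= dxi t - dxi s by rewrite subr_ge0 mono// ltW.
have [h1 h2] := IH x.
rewrite (PhiD_layer adm mono x pk ps (ltW st) tq).
split.
  exact: le_trans h1 (step_ge_id x (adm_m_ge0 adm pk) v0 (PhiD_class xi adm t)).
have [_ h] := C_upper x (adm_m_ge0 adm pk) (adm_m_le1 adm pk) v0
  (sqrt_dxi s0 (ltW st) (le_trans tb b1)) (PhiD_class xi adm t).
apply: le_trans h _; apply: le_trans (lerD h2 (lexx _)) _.
by rewrite -addrA lerD2l -mulrDr addrA subrK.
Qed.

End layer_bounds.

(** * Integration over the external field *)
Section compose_field.
Context {R : realType} d (Om : measurableType d) (P : probability Om R).
Variable h : {RV P >-> R}.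
Hypothesis h_int : P.-integrable [set: Om] (fun w => (h w)%:E).
Implicit Types (f g F G : R -> R).

(** Linear growth matches the hypothesis that [h] has a first moment. *)
Definition lingrow f := continuous f /\ exists A B, forall x, `|f x| <= A + B * `|x|.

Lemma lingrow_integrable f : lingrow f -> P.-integrable [set: Om] (fun w => (f (h w))%:E).
Proof.
move=> [cf [A [B fAB]]].
have iA : P.-integrable [set: Om] (fun=> A%:E).
  exact: finite_measure_integrable_cst.
have iB : P.-integrable [set: Om] (fun w => (B%:E * (`|h w|)%:E)%E).
  apply: integrableZl => //; exact: (integrable_norm h_int).
apply: (@le_integrable _ _ _ P setT measurableT _ (fun w => A%:E + (B%:E * (`|h w|)%:E))%E).
- apply/measurable_EFinP; apply: measurableT_comp => //.
  exact: continuous_measurableT.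
- move=> w _; rewrite -EFinM -EFinD /= lee_fin.
  by apply: le_trans (fAB _) _; exact: ler_norm.
- exact: integrableD.
Qed.

Lemma nonexpansive_lingrow F : nonexpansive F -> lingrow F.
Proof.
move=> lF; split; first exact: nonexpansive_continuous.
exists `|F 0|, 1 => x; rewrite mul1r.
have := lF x 0; rewrite subr0 => h1.
have -> : F x = F 0 + (F x - F 0) by rewrite addrC subrK.
by apply: le_trans (ler_normD _ _) _; rewrite lerD2l.
Qed.

Lemma lingrow_cst (c : R) : lingrow (fun=> c).
Proof.
split; first exact: cst_continuous.
by exists `|c|, 0 => x; rewrite mul0r addr0.
Qed.

Lemma lingrow_lin (a b : R) f g : lingrow f -> lingrow g -> lingrow (fun x => a * f x + b * g x).
Proof.
move=> [cf [A [B fAB]]] [cg [A' [B' gAB]]]; split.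
  move=> x; apply: cvgD; apply: cvgM; [exact: cvg_cst|exact: cf|exact: cvg_cst|exact: cg].
exists (`|a| * A + `|b| * A'), (`|a| * B + `|b| * B') => x.
apply: le_trans (ler_normD _ _) _; rewrite !normrM.
have := ler_wpM2l (normr_ge0 a) (fAB x); have := ler_wpM2l (normr_ge0 b) (gAB x).
by move=> h1 h2; apply: le_trans (lerD h2 h1) _; lra.
Qed.

Lemma lingrow_addc (c : R) f : lingrow f -> lingrow (fun x => f x + c).
Proof.
move=> lf; have := lingrow_lin 1 1 lf (lingrow_cst c).
by rewrite (_ : (fun x => 1 * f x + 1 * c) = (fun x => f x + c))//; apply/funext => x; rewrite !mul1r.
Qed.

Lemma le_field f g : lingrow f -> lingrow g -> (forall x, f x <= g x) ->
  \int[P]_w f (h w) <= \int[P]_w g (h w).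
Proof.
move=> lf lg fg; apply: le_Rintegral => //; exact: lingrow_integrable.
Qed.

Lemma field_lin (a b : R) f g : lingrow f -> lingrow g ->
  \int[P]_w (a * f (h w) + b * g (h w)) = a * \int[P]_w f (h w) + b * \int[P]_w g (h w).
Proof.
move=> lf lg; have := lingrow_integrable lf; have := lingrow_integrable lg => ig if_.
have l0 := lingrow_cst 0.
have Z c f0 : lingrow f0 -> P.-integrable [set: Om] (fun w => (c * f0 (h w))%:E).
  move=> l; apply: eq_integrable (lingrow_integrable (lingrow_lin c 0 l l0)) => //.
  by move=> w _; rewrite mul0r addr0.
by rewrite RintegralD//; [rewrite !RintegralZl|exact: Z|exact: Z].
Qed.

Lemma field_cst (c : R) : \int[P]_w c = c.
Proof.
rewrite Rintegral_cst//; set u := (X in fine X).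
by have -> : u = 1%E; [exact: probability_setT|rewrite mulr1].
Qed.

Lemma le_field_lin (a b : R) f g G : lingrow f -> lingrow g -> lingrow G ->
  (forall x, a * f x + b * g x <= G x) ->
  a * \int[P]_w f (h w) + b * \int[P]_w g (h w) <= \int[P]_w G (h w).
Proof. by move=> lf lg lG H; rewrite -field_lin//; apply: (@le_field (fun x => a * f x + b * g x) G) => //; exact: lingrow_lin. Qed.

End compose_field.

(** * Two competitors of a minimizer *)
Section competitors.
Context {R : realType}.
Local Notation gamma := (@std_gauss R).
Local Notation T := log_exp_step.
Variables (xi : R -> R) (mix : is_mixture xi).
Local Notation dxi := (derive1 xi).
Variables (k : nat) (m q : nat -> R) (adm : admissible k m q).
Local Notation Phi := (PhiD xi (Triplet k m q)).
Local Notation J := (weight_int k m q).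
Let mono := dxi_le mix.

Let max_gt (b s x y : R) : Num.max b x = Num.max b y -> b <= s -> s < x -> x = y.
Proof.
move=> E bs sx; have bx : b <= x by rewrite (le_trans bs)// ltW.
have : Num.max b x = x by rewrite max_r.
rewrite E => xE; have [by_|yb] := leP b y; first by rewrite -xE max_r.
by move: sx; rewrite -xE max_l ?ltW// ltNge bs.
Qed.

Let max_trans (b s x y : R) : Num.max b x = Num.max b y -> b <= s ->
  Num.max s x = Num.max s y.
Proof.
move=> E bs; have K (z : R) : Num.max s z = Num.max s (Num.max b z) by rewrite maxA (max_l bs).
by rewrite (K x) (K y) E.
Qed.

Section agree.
Variables (q' : nat -> R) (b : R).
Hypothesis agree : forall r, Num.max b (q' r) = Num.max b (q r).

(** Taking the maximum with [b] erases what happens before [b], so [agree] says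
    that the two sequences coincide on the right of [b]; the solution at a time
    beyond [b] sees nothing else. *)
Lemma PhiD_agree x s : b <= s -> PhiD xi (Triplet k m q') x s = Phi x s.
Proof.
suff H n p : b <= s -> PhiD_rec xi m q' n p x s = PhiD_rec xi m q n p x s by exact: H.
elim: n p x s => [//|n IH] p x s bs.
have E : (s < q' p.+1) = (s < q p.+1).
  apply/idP/idP => H.
    by rewrite -(max_gt (agree p.+1) bs H).
  by rewrite -(max_gt (esym (agree p.+1)) bs H).
rewrite /= E; case: ifP => [sq|_]; last exact: IH.
rewrite -(max_gt (esym (agree p.+1)) bs sq).
have bq : b <= q p.+1 by rewrite (le_trans bs)// ltW.
by have -> : (fun y => PhiD_rec xi m q' n p.+1 y (q p.+1)) =
    (fun y => PhiD_rec xi m q n p.+1 y (q p.+1)) by apply/funext => y; exact: IH.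
Qed.

Lemma weight_int_agree om s : b <= s -> weight_int k m q' om s = J om s.
Proof.
move=> bs; rewrite /weight_int; apply: eq_bigr => p _.
by rewrite (max_trans (agree p) bs) (max_trans (agree p.+1) bs).
Qed.

End agree.

Context d (Om : measurableType d) (P : probability Om R).
Variable h : {RV P >-> R}.
Hypothesis h_int : P.-integrable [set: Om] (fun w => (h w)%:E).
Hypothesis minimal : forall m' q', admissible k m' q' ->
  parisi_functional P h xi k m q <= parisi_functional P h xi k m' q'.

Let shuffle_aux (a b c e : R) : a - 2^-1 * c <= b - 2^-1 * e -> a <= b + 2^-1 * (c - e).
Proof. by lra. Qed.

Let minimalE q' : admissible k m q' ->
  \int[P]_w Phi (h w) 0 - 2^-1 * J (theta xi) 0 <=
  \int[P]_w PhiD xi (Triplet k m q') (h w) 0 - 2^-1 * weight_int k m q' (theta xi) 0.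
Proof.
move=> adm'; have := minimal adm'.
by rewrite (parisi_functionalE xi adm) (parisi_functionalE xi adm') -!addrA lerD2l.
Qed.

(** The competitor has all the mass of [[0, b]] at the point [b]: its parameter
    vanishes on [[0, b]], where its solution is a heat flow. *)
Lemma move_mass_right (b : R) : 0 <= b -> b <= 1 ->
  \int[P]_w Phi (h w) 0 <= \int[P]_w T 0 (dxi b) (Phi ^~ b) (h w)
    + 2^-1 * (J (theta xi) 0 - J (theta xi) b).
Proof.
move=> b0 b1.
(* The index 0 is kept at 0; the positions 1 and above are pushed to the right of [b]. *)
pose q' p := if p is 0%N then 0 else Num.max (q p) b.
have [m00 mS m11 q00 [qS q11]] := adm.
have adm' : admissible k m q'.
  split => //; split; last by rewrite /q' q11 max_l.
  case=> [_|p pk]; first by rewrite /q' le_max b0 orbT.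
  by rewrite /q' ge_max !le_max lexx (qS p.+1 pk) orbT.
have agree r : Num.max b (q' r) = Num.max b (q r).
  case: r => [|r]; first by rewrite /q' q00.
  by rewrite /q' maxCA maxxx maxC.
have := minimalE adm'.
have bq : b <= q' 1%N by rewrite /q' le_max lexx orbT.
rewrite (weight_int_layer adm' (theta xi) (leq0n k.+1) (lexx 0) b0 bq) m00 mul0r addr0.
rewrite (weight_int_agree agree _ (lexx b)).
have -> : (fun w => PhiD xi (Triplet k m q') (h w) 0) = (fun w => T 0 (dxi b) (Phi ^~ b) (h w)).
  apply/funext => w; rewrite (PhiD_layer adm' mono (h w) (leq0n k.+1) (lexx 0) b0 bq).
  rewrite m00 (dxi0 mix) subr0.
  have -> : (PhiD xi (Triplet k m q'))^~ b = Phi ^~ b.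
    by apply/funext => y; exact: PhiD_agree agree _ _ (lexx b).
  by [].
exact: shuffle_aux.
Qed.

Variable C : R.
Hypothesis C0 : 0 <= C.
Hypothesis C_upper : linear_step_bound (Num.sqrt (dxi 1)) C.

Let shuffle_aux2 (a b c e u g : R) : a - 2^-1 * c <= b - 2^-1 * e ->
  b <= u -> g <= e -> a <= u + 2^-1 * (c - g).
Proof. by lra. Qed.

(** The competitor is obtained by truncating [q 0, ..., q p0] at [a]: its
    parameter is [m p0] on all of [[a, b]]. *)
Lemma move_mass_left (a b e : R) p0 : (p0 <= k.+1)%N -> 0 <= a -> a <= q p0 -> q p0 <= b ->
  b <= q p0.+1 -> 0 <= e -> (forall p, (p <= k.+1)%N -> q p < a -> m p <= e) ->
  \int[P]_w Phi (h w) 0 <=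
    \int[P]_w (T 0 (dxi a) (T (m p0) (dxi b - dxi a) (Phi ^~ b)) (h w) + C * e * dxi a)
    + 2^-1 * (J (theta xi) 0 - (J (theta xi) b + m p0 * (theta xi b - theta xi a))).
Proof.
move=> pk a0 aq qb bq e0 He.
have ab : a <= b by exact: le_trans qb.
have [m00 mS m11 q00 [qS q11]] := adm.
have q_le := adm_q_le adm.
have b1 : b <= 1 by rewrite (le_trans bq)// (adm_q_le1 adm).
pose q' p := if (p <= p0)%N then Num.min (q p) a else q p.
have adm' : admissible k m q'.
  split => //; first by rewrite /q' leq0n q00 min_l.
  split; last by rewrite /q' leqNgt ltnS pk /= q11.
  move=> p pk1; rewrite /q'; case: (leqP p.+1 p0) => [pp|pp].
    by rewrite (ltnW pp) le_min2 ?lexx// qS.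
  by case: ifP => _; rewrite ?ge_min qS.
have agree r : Num.max b (q' r) = Num.max b (q r).
  rewrite /q'; case: ifP => // rp.
  have rb : q r <= b by rewrite (le_trans _ qb)// q_le// leqW.
  by rewrite !max_l// ge_min rb.
have qa : q' p0 = a by rewrite /q' leqnn min_r.
have qb' : q' p0.+1 = q p0.+1 by rewrite /q' ltnn.
have [qa' bq'] : q' p0 <= a /\ b <= q' p0.+1 by rewrite qa qb' lexx.
have Ea : (PhiD xi (Triplet k m q'))^~ a = T (m p0) (dxi b - dxi a) (Phi ^~ b).
  apply/funext => x; rewrite (PhiD_layer adm' mono x pk qa' ab bq').
  have -> // : (PhiD xi (Triplet k m q'))^~ b = Phi ^~ b.
  by apply/funext => y; exact: PhiD_agree agree _ _ (lexx b).
have He' p : (p <= k.+1)%N -> q' p < a -> m p <= e.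
  move=> pk1; rewrite /q'; case: ifP => pp; first by rewrite gt_min ltxx orbF; exact: He.
  move=> qpa; move/negbT: pp; rewrite -ltnNge => pp.
  by move: (lt_le_trans qpa aq); rewrite ltNge q_le// ltnW// leqW.
have H1 x := PhiD_heat_le mix adm' C0 C_upper x (lexx 0) a0 (le_trans ab b1) e0 He'.
have lT : nonexpansive (T 0 (dxi a) (T (m p0) (dxi b - dxi a) (Phi ^~ b))).
  apply: step_nonexpansive; first exact: lexx.
  by apply: step_nonexpansive; [exact: (adm_m_ge0 adm pk)|exact: (PhiD_nonexp xi adm)].
apply: shuffle_aux2 (minimalE adm') _ _.
  apply: (@le_field _ _ _ P h h_int ((PhiD xi (Triplet k m q'))^~ 0) (fun x => T 0 (dxi a) (T (m p0) (dxi b - dxi a) (Phi ^~ b)) x + C * e * dxi a)).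
  - exact: nonexpansive_lingrow (PhiD_nonexp xi adm' 0).
  - exact: lingrow_addc (nonexpansive_lingrow lT).
  - by move=> x; have := H1 x; rewrite Ea (dxi0 mix) subr0.
rewrite -(weight_int_agree agree _ (lexx b)) -(weight_int_layer adm' (theta xi) pk qa' ab bq').
rewrite -subr_ge0.
have H := @weight_int_ge R k m q' adm' (theta xi) (fun=> 0) 0 a (lexx 0) a0 (le_trans ab b1).
have z0 : 0 - 0 = 0 :> R by rewrite subrr.
rewrite -[leLHS]z0; apply: H => p s t pk1 ps st tq s0 ta.
rewrite z0 mulr_ge0// ?(adm_m_ge0 adm)// subr_ge0.
by apply: theta_le => //; exact: ltW.
Qed.

End competitors.

(** * Heat flow of Lipschitz functions *)
Section bounded_lipschitz.
Context {R : realType}.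
Local Notation gamma := (@std_gauss R).
Local Notation T := log_exp_step.
Variable D : R -> R.
Hypothesis D_le1 : forall y, `|D y| <= 1.
Hypothesis D_lip : forall x y, `|D x - D y| <= 8 * `|x - y|.

Lemma lip_continuous (f : R -> R) (L : R) : (forall x y, `|f x - f y| <= L * `|x - y|) -> continuous f.
Proof.
move=> lf.
have L1 : 0 < `|L| + 1 by rewrite ltr_pwDr.
have n : nonexpansive (fun x => f x / (`|L| + 1)).
  move=> x y; rewrite -mulrBl normrM normfV (gtr0_norm L1) ler_pdivrMr//.
  apply: le_trans (lf x y) _; rewrite mulrC ler_wpM2l//.
  by apply: le_trans (ler_norm _) _; rewrite lerDl.
have -> : f = (fun x => (`|L| + 1) * (f x / (`|L| + 1))).
  by apply/funext => x; rewrite mulrC divfK// gt_eqF.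
by move=> x; apply: cvgM; [exact: cvg_cst|exact: (nonexpansive_continuous n)].
Qed.

Lemma egrow_bounded (f : R -> R) (B : R) : continuous f -> (forall x, `|f x| <= B) -> egrow f.
Proof.
move=> cf fB; split => //; exists `|B|, 0; split => // x.
by rewrite mul0r expR0 mulr1 (le_trans (fB x))// ler_norm.
Qed.

Lemma heat_dist (f F : R -> R) (r v x : R) : egrow f -> egrow F ->
  (forall y, `|f y - F y| <= r) -> `|T 0 v f x - T 0 v F x| <= r.
Proof.
move=> ef eF fF; rewrite !step0E ler_distl.
have ef' := egrow_move x v ef; have eF' := egrow_move x v eF.
apply/andP; split.
  rewrite lerBlDr -[X in _ + X]gauss_cst -gaussD//; last exact: egrow_cst.
  apply: le_gauss => // [|g]; first by apply: egrowD => //; exact: egrow_cst.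
  by have := fF (x + g * Num.sqrt v); rewrite ler_distl lerBlDr => /andP[].
rewrite -[X in _ + X]gauss_cst -gaussD//; last exact: egrow_cst.
apply: le_gauss => // [|g]; first by apply: egrowD => //; exact: egrow_cst.
by have := fF (x + g * Num.sqrt v); rewrite ler_distl => /andP[].
Qed.


Lemma heat_lip (f : R -> R) (L v x y : R) : egrow f ->
  (forall x y, `|f x - f y| <= L * `|x - y|) -> `|T 0 v f x - T 0 v f y| <= L * `|x - y|.
Proof.
move=> ef lf; pose F (z : R) : R := f (y - x + 1 * z).
have -> : T 0 v f y = T 0 v F x.
  by rewrite !step0E; apply: eq_gauss => g; rewrite /F; congr f; ring.
apply: (heat_dist v x ef (egrow_affine (y - x) 1 ef)) => z.
have -> : x - y = z - (y - x + 1 * z) by ring.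
exact: lf.
Qed.

Lemma heat_time (f : R -> R) (L v w x : R) : 0 <= L -> egrow f ->
  (forall x y, `|f x - f y| <= L * `|x - y|) ->
  `|T 0 v f x - T 0 w f x| <= L * `|Num.sqrt v - Num.sqrt w|.
Proof.
move=> L0 ef lf; have e u := egrow_move x u ef.
have en := egrow_norm (@egrow_id R).
have H a b : T 0 a f x <= T 0 b f x + L * `|Num.sqrt a - Num.sqrt b|.
  rewrite !step0E.
  apply: (@le_trans _ _ (\int[gamma]_g (f (x + g * Num.sqrt b) + L * `|Num.sqrt a - Num.sqrt b| * `|g|))).
    apply: le_gauss; [exact: e|by apply: egrowD; [exact: e|exact: egrowZ]|move=> g].
    have := lf (x + g * Num.sqrt a) (x + g * Num.sqrt b).
    have -> : x + g * Num.sqrt a - (x + g * Num.sqrt b) = g * (Num.sqrt a - Num.sqrt b) by ring.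
    rewrite normrM ler_norml => /andP[_ h]; rewrite -lerBlDl.
    by rewrite -mulrA (mulrC `|_ - _|).
  rewrite gaussD; [|exact: e|exact: egrowZ].
  rewrite gaussZ// lerD2l ler_piMr ?mulr_ge0//; exact: gauss_abs_le1.
by rewrite ler_distl; apply/andP; split; rewrite ?H// lerBlDr distrC H.
Qed.

Let sq_lip x y : `|D x ^+ 2 - D y ^+ 2| <= 16 * `|x - y|.
Proof.
rewrite subr_sqr normrM; have h := D_lip x y.
have h2 : `|D x + D y| <= 2.
  by apply: le_trans (ler_normD _ _) _; have := D_le1 x; have := D_le1 y; lra.
have -> : 16 * `|x - y| = (8 * `|x - y|) * 2 by ring.
by apply: ler_pM.
Qed.

Lemma slope_egrow : egrow D.
Proof. exact: egrow_bounded (lip_continuous D_lip) D_le1. Qed.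

Definition sqf y := D y ^+ 2.

Lemma sqf_egrow : egrow sqf.
Proof. by apply: eq_egrow (egrowM slope_egrow slope_egrow) => y; rewrite /sqf expr2. Qed.

Lemma sqf_ge0 y : 0 <= sqf y. Proof. exact: sqr_ge0. Qed.

Lemma sqf_le1 y : sqf y <= 1.
Proof. by rewrite /sqf -(real_normK (num_real _)) expr_le1. Qed.

Lemma heat_sqf_lip v x y : `|T 0 v sqf x - T 0 v sqf y| <= 16 * `|x - y|.
Proof. exact: heat_lip sqf_egrow sq_lip. Qed.

Lemma heat_sqf_time v w x :
  `|T 0 v sqf x - T 0 w sqf x| <= 16 * `|Num.sqrt v - Num.sqrt w|.
Proof. exact: heat_time sqf_egrow sq_lip. Qed.

Lemma heat_sqf_lingrow v : lingrow (T 0 v sqf).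
Proof.
split; first exact: lip_continuous (heat_sqf_lip v).
exists 1, 0 => x; rewrite mul0r addr0 step0E ger0_norm; last first.
  by apply: gauss_ge0 => g; exact: sqf_ge0.
by apply: gauss_le => [|g]; [exact: egrow_move sqf_egrow|exact: sqf_le1].
Qed.

End bounded_lipschitz.

(** * First-order conditions at a finite level *)
Section right_inequality.
Context {R : realType}.
Local Notation gamma := (@std_gauss R).
Local Notation T := log_exp_step.
Variables (xi : R -> R) (mix : is_mixture xi).
Local Notation dxi := (derive1 xi).
Variables (k : nat) (m q : nat -> R) (adm : admissible k m q).
Local Notation Phi := (PhiD xi (Triplet k m q)).
Local Notation J := (weight_int k m q).
Let mono := dxi_le mix.
Context d (Om : measurableType d) (P : probability Om R).
Variable h : {RV P >-> R}.
Hypothesis h_int : P.-integrable [set: Om] (fun w => (h w)%:E).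
Hypothesis minimal : forall m' q', admissible k m' q' ->
  parisi_functional P h xi k m q <= parisi_functional P h xi k m' q'.
Variable D : R -> R.
Hypothesis D_le1 : forall y, `|D y| <= 1.
Hypothesis D_lip : forall x y, `|D x - D y| <= 8 * `|x - y|.
Local Notation ED v := (\int[P]_w T 0 v (sqf D) (h w)).
Variables (b r : R).
Hypothesis b1 : b <= 1.
Hypothesis r_ge0 : 0 <= r.
Hypothesis D_close : forall y, `|derive1 (Phi ^~ b) y - D y| <= r.
Local Notation A := (Phi ^~ b).
Let lA : nonexpansive A := PhiD_nonexp xi adm b.
Let pA : parisi_class A := PhiD_class xi adm b.

Let drift_aux (a al K s g : R) : 0 <= K -> `|al| <= 1 -> `|a - al| <= 8 * (s * `|g|) + r ->
  K * (al ^+ 2 - r) + - (8 * K * s) * `|g| <= a * (K * al).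
Proof.
move=> K0 al1 ha.
have h1 : `|(a - al) * al| <= 8 * (s * `|g|) + r.
  by rewrite normrM -[leRHS]mulr1 ler_pM.
have /(ler_wpM2l K0) : al ^+ 2 - (8 * (s * `|g|) + r) <= a * al.
  by move: h1; rewrite ler_norml => /andP[h1 _]; lra.
by lra.
Qed.

(** The drift [D y] shifts the heat flow by [K * D y].  The tangent to [A] turns
    this into a gain [K * D y ^+ 2], half of which pays for the shift, and
    [D_close] and the Lipschitz bounds account for replacing the slope of [A]
    at the shifted Gaussian point by [D y]. *)
Let pointwise_right c y : 0 <= c -> c <= b -> let K := J dxi c - J dxi b in 0 <= K ->
  T 0 (dxi b - dxi c) A y + K * (sqf D y / 2 - (8 * Num.sqrt (dxi b - dxi c) + r))
   <= Phi y c.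
Proof.
move=> c0 cb K K0.
set s := Num.sqrt (dxi b - dxi c).
have s0 : 0 <= s by exact: sqrtr_ge0.
have := PhiD_shift_ge mix adm y (D y) c0 cb b1; rewrite -/K => H.
suff H2 : T 0 (dxi b - dxi c) A y + K * (sqf D y - r - 8 * s) <=
    T 0 (dxi b - dxi c) A (y + K * D y).
  apply: le_trans H; rewrite lerBrDr; apply: le_trans H2.
  by rewrite -addrA lerD2l /sqf le_eqVlt; apply/orP; left; apply/eqP; field.
have en := egrow_norm (@egrow_id R).
have e1 : egrow (fun g : R => K * (sqf D y - r) + - (8 * K * s) * `|g|).
  by apply: egrowD; [exact: egrow_cst|exact: egrowZ].
have eA (z : R) : egrow (fun g => A (z + g * s)) by exact: (egrow_nonexp_move z (dxi b - dxi c) lA).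
rewrite !step0E -/s.
apply: (@le_trans _ _ (\int[gamma]_g (A (y + g * s) + (K * (sqf D y - r) + - (8 * K * s) * `|g|)))).
  rewrite gaussD// lerD2l gaussD; [|exact: egrow_cst|exact: egrowZ].
  rewrite gauss_cst gaussZ// mulrBr lerD2l mulNr mulrA (mulrC K) lerN2.
  by rewrite ler_piMr ?mulr_ge0// gauss_abs_le1.
apply: le_gauss; [exact: egrowD|exact: eA|move=> g].
have /andP[h1 _] := pc_taylor (y + g * s) (K * D y) pA.
have h2 := pc_slope_lip y (y + g * s) pA.
have h3 := D_close y.
have h4 : `|derive1 A (y + g * s) - D y| <= 8 * (s * `|g|) + r.
  have -> : derive1 A (y + g * s) - D y = (derive1 A (y + g * s) - derive1 A y) + (derive1 A y - D y).
    by rewrite addrA subrK.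
  apply: le_trans (ler_normD _ _) (lerD _ h3).
  by move: h2; rewrite addrAC subrr add0r normrM (ger0_norm s0) (mulrC s).
have h5 := drift_aux K0 (D_le1 y) h4.
rewrite (_ : y + K * D y + g * s = y + g * s + K * D y); last by rewrite addrAC.
by move: h1; rewrite subr_ge0 lerBrDl; apply: le_trans; rewrite lerD2l.
Qed.

Let right_aux (X Y E K s t u v w : R) :
  X + K * (E / 2 - s) <= Y -> Y <= X + 2^-1 * t -> t <= u + (v + b * K) -> w = u + v ->
  K * (E - 2 * s) <= w + b * K.
Proof. by move=> ? ? ? ->; lra. Qed.

Let lin_aux (X Y K s : R) : 1 * (1 * X + - (K * s) * 1) + K / 2 * Y = X + K * (Y / 2 - s).
Proof. by ring. Qed.

(** Minimality against [move_mass_right].  The recursion loses at least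
    [K / 2] times the mean of [D ^ 2], while the [theta] term changes by at most
    [b * K / 2] up to the contribution of [[0, c]], which is small when the mass
    on the left of [a'] is at most [e] and [a'] is close to [c]. *)
Lemma right_inequality (a' c e : R) : 0 <= a' -> a' <= c -> c <= b -> 0 <= e ->
  (forall p, (p <= k.+1)%N -> q p < a' -> m p <= e) ->
  forall K, K = J dxi c - J dxi b ->
  K * (ED (dxi c) - 2 * (8 * Num.sqrt (dxi b - dxi c) + r)) <=
  e * (theta xi a' - theta xi 0) + (theta xi c - theta xi a') + b * K.
Proof.
move=> a'0 ac cb e0 He K KE.
have c0 : 0 <= c by exact: le_trans ac.
have c1 : c <= 1 by exact: le_trans b1.
have b0 : 0 <= b by exact: le_trans cb.
have a'1 : a' <= 1 by exact: le_trans c1.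
have vc : 0 <= dxi c by exact: dxi_ge0 mix _ c0.
have vb : 0 <= dxi b - dxi c by rewrite subr_ge0 mono.
have z0 : 0 - 0 = 0 :> R by rewrite subrr.
have K0 : 0 <= K.
  rewrite KE -[leLHS]z0; apply: (@weight_int_ge R k m q adm dxi (fun=> 0)) => // p s t pk ps st tq cs tb.
  rewrite z0 mulr_ge0// ?(adm_m_ge0 adm)// subr_ge0 mono//; last exact: ltW.
  exact: le_trans cs.
set s := 8 * Num.sqrt (dxi b - dxi c) + r.
have P2 x : T 0 (dxi b) A x + K * (T 0 (dxi c) (sqf D) x / 2 - s) <= Phi x 0.
  have := PhiD_heat_ge mix adm x (lexx 0) c0 c1; rewrite (dxi0 mix) subr0.
  apply: le_trans.
  rewrite (_ : dxi b = dxi c + (dxi b - dxi c)); last by rewrite addrC subrK.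
  rewrite -(step_conv _ vc vb (lexx 0) lA) [T 0 (dxi c) (T _ _ _) x]step0E [T 0 (dxi c) (sqf D) x]step0E.
  rewrite [leRHS]step0E.
  have eT : egrow (fun g => T 0 (dxi b - dxi c) A (x + g * Num.sqrt (dxi c))).
    by apply: egrow_nonexp_move; exact: step_nonexpansive.
  have eD : egrow (fun g => sqf D (x + g * Num.sqrt (dxi c))).
    by apply: egrow_move; exact: sqf_egrow.
  have -> : K * ((\int[gamma]_g sqf D (x + g * Num.sqrt (dxi c))) / 2 - s) =
     \int[gamma]_g ((K / 2) * sqf D (x + g * Num.sqrt (dxi c)) + - (K * s)).
    rewrite gaussD; [|exact: egrowZ|exact: egrow_cst].
    by rewrite gaussZ// gauss_cst; ring.
  have e2 : egrow (fun g => K / 2 * sqf D (x + g * Num.sqrt (dxi c)) + - (K * s)).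
    by apply: egrowD; [exact: egrowZ|exact: egrow_cst].
  rewrite -gaussD//; apply: le_gauss.
  - exact: egrowD.
  - exact: (egrow_nonexp_move x (dxi c) (PhiD_nonexp xi adm c)).
  - move=> g; have := pointwise_right (x + g * Num.sqrt (dxi c)) c0 cb; rewrite -KE -/s => /(_ K0).
    by apply: le_trans; rewrite lerD2l le_eqVlt; apply/orP; left; apply/eqP; ring.
have F1 : lingrow (T 0 (dxi b) A).
  by apply: nonexpansive_lingrow; exact: step_nonexpansive.
have F2 := heat_sqf_lingrow D_le1 D_lip (dxi c).
have F3 : lingrow (fun x => 1 * T 0 (dxi b) A x + - (K * s) * 1).
  exact: lingrow_lin F1 (lingrow_cst 1).
have I1 : 1 * \int[P]_w (1 * T 0 (dxi b) A (h w) + - (K * s) * 1) + (K / 2) * ED (dxi c) <=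
    \int[P]_w Phi (h w) 0.
  apply: (@le_field_lin _ _ _ P h h_int 1 (K / 2) (fun x => 1 * T 0 (dxi b) A x + - (K * s) * 1) (T 0 (dxi c) (sqf D)) (Phi ^~ 0)) => //.
    by apply: nonexpansive_lingrow; exact: (PhiD_nonexp xi adm).
  by move=> x; have := P2 x; rewrite -lin_aux.
move: I1; rewrite (field_lin h_int 1 (- (K * s)) F1 (lingrow_cst 1)) field_cst => I1.
have I2 := move_mass_right mix adm minimal b0 b1.
have J1 : J (theta xi) 0 - J (theta xi) a' <= e * theta xi a' - e * theta xi 0.
  apply: (@weight_int_le R k m q adm (theta xi) (fun u => e * theta xi u)) => // p u t pk pu ut tq u0 ta.
  rewrite -mulrBr ler_wpM2r ?subr_ge0 ?(theta_le mix) ?(ltW ut)//.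
  by rewrite He// (le_lt_trans pu)// (lt_le_trans ut).
have J2 : J (theta xi) a' - J (theta xi) c <= theta xi c - theta xi a'.
  apply: (@weight_int_le R k m q adm (theta xi) (theta xi)) => // p u t pk pu ut tq u0 tc.
  rewrite ler_piMl ?(adm_m_le1 adm)// subr_ge0 (theta_le mix) ?(ltW ut)//.
  exact: le_trans u0.
have J3 : J (theta xi) c - J (theta xi) b <= b * K.
  have -> : b * K = - (b * J dxi b) - (- (b * J dxi c)) by rewrite KE; ring.
  apply: (@weight_int_le R k m q adm (theta xi) (fun u => - (b * J dxi u))) => // p u t pk pu ut tq u0 tc.
  rewrite (weight_int_layer adm dxi pk pu (ltW ut) tq).
  have u00 : 0 <= u by exact: le_trans u0.
  have [_ th] := theta_bounds mix u00 (ltW ut).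
  have -> : - (b * J dxi t) - - (b * (J dxi t + m p * (dxi t - dxi u))) = m p * (b * (dxi t - dxi u)) by ring.
  rewrite ler_wpM2l ?(adm_m_ge0 adm)//; apply: le_trans th _.
  by rewrite ler_wpM2r// subr_ge0 mono// ltW.
apply: (@right_aux (\int[P]_w T 0 (dxi b) A (h w)) _ _ K s _
  (e * theta xi a' - e * theta xi 0) (theta xi c - theta xi a') _ _ I2).
- by rewrite -lin_aux.
- have -> : J (theta xi) 0 - J (theta xi) b = (J (theta xi) 0 - J (theta xi) a') +
     ((J (theta xi) a' - J (theta xi) c) + (J (theta xi) c - J (theta xi) b)) by ring.
  exact: (lerD J1 (lerD J2 J3)).
- by rewrite mulrBr.
Qed.

End right_inequality.

Section left_inequality.
Context {R : realType}.
Local Notation gamma := (@std_gauss R).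
Local Notation T := log_exp_step.
Variables (xi : R -> R) (mix : is_mixture xi).
Local Notation dxi := (derive1 xi).
Variables (k : nat) (m q : nat -> R) (adm : admissible k m q).
Local Notation Phi := (PhiD xi (Triplet k m q)).
Local Notation J := (weight_int k m q).
Let mono := dxi_le mix.
Context d (Om : measurableType d) (P : probability Om R).
Variable h : {RV P >-> R}.
Hypothesis h_int : P.-integrable [set: Om] (fun w => (h w)%:E).
Hypothesis minimal : forall m' q', admissible k m' q' ->
  parisi_functional P h xi k m q <= parisi_functional P h xi k m' q'.
Variable D : R -> R.
Hypothesis D_le1 : forall y, `|D y| <= 1.
Hypothesis D_lip : forall x y, `|D x - D y| <= 8 * `|x - y|.
Local Notation ED v := (\int[P]_w T 0 v (sqf D) (h w)).
Variables (b r : R).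
Hypothesis r_ge0 : 0 <= r.
Hypothesis D_close : forall y, `|derive1 (Phi ^~ b) y - D y| <= r.
Local Notation A := (Phi ^~ b).
Let lA : nonexpansive A := PhiD_nonexp xi adm b.
Let pA : parisi_class A := PhiD_class xi adm b.
Variable C : R.
Hypothesis C0 : 0 <= C.
Hypothesis C_upper : linear_step_bound (Num.sqrt (dxi 1)) C.
Variable Cu : R.
Hypothesis Cu_upper : quadratic_step_bound (Num.sqrt (dxi 1)) Cu.

Let left_aux (I X Y M V E s w t g0 gb ga' ga J0 Ja Jb : R) :
  I <= X + t + 2^-1 * (J0 - (Jb + M * (gb - ga))) -> X <= Y + M * V / 2 * (E + s) -> Y <= I ->
  J0 - Ja <= w -> Ja - Jb <= M * gb - M * ga' -> M * g0 <= M * (ga' - ga) ->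
  M * g0 <= M * V * (E + s) + (2 * t + w).
Proof. by lra. Qed.

Let lin_aux (X E K s : R) : 1 * (1 * X + K * s * 1) + K * E = X + K * (E + s).
Proof. by ring. Qed.

(** Minimality against [move_mass_left].  The inserted step of parameter [m p0]
    and variance [V] exceeds the heat flow by at most [m p0 * V / 2] times the
    mean of [D ^ 2], up to errors that vanish with [r], [V] and [e]; the [theta] term
    gains at least [m p0 * a * (xi' a' - xi' a) / 2]. *)
Lemma left_inequality (a a' e : R) p0 : (p0 <= k.+1)%N -> 0 <= a -> a <= q p0 ->
  q p0 <= b -> b <= q p0.+1 -> a <= a' -> a' <= b -> 0 <= e ->
  (forall p, (p <= k.+1)%N -> q p < a' -> m p <= e) ->
  forall V, V = dxi b - dxi a ->
  m p0 * (a * (dxi a' - dxi a)) <=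
  m p0 * V * (ED (dxi a) + (2 * r + Cu * Num.sqrt V))
    + (2 * (C * e * dxi a) + (e * theta xi a' - e * theta xi 0)).
Proof.
move=> pk a0 aq qb bq aa' ab' e0 He V VE.
have ab : a <= b by exact: le_trans qb.
have a'0 : 0 <= a' by exact: le_trans aa'.
have b0 : 0 <= b by exact: le_trans ab.
have b1 : b <= 1 by rewrite (le_trans bq)// (adm_q_le1 adm).
have a1 : a <= 1 by exact: le_trans b1.
have a'1 : a' <= 1 by exact: le_trans b1.
have va : 0 <= dxi a by exact: dxi_ge0 mix _ a0.
have V0 : 0 <= V by rewrite VE subr_ge0 mono.
have M0 := adm_m_ge0 adm pk.
have M1 := adm_m_le1 adm pk.
have Vs : Num.sqrt V <= Num.sqrt (dxi 1).
  rewrite ler_sqrt; last by rewrite (dxi_ge0 mix).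
  by rewrite VE lerBlDr (le_trans (mono b0 b1))// lerDl.
set s := 2 * r + Cu * Num.sqrt V.
have P1 y : T (m p0) V A y <= T 0 V A y + m p0 * V / 2 * (sqf D y + s).
  apply: le_trans (Cu_upper y M0 M1 V0 Vs pA) _.
  rewrite lerD2l ler_wpM2l ?divr_ge0 ?mulr_ge0// /s addrA lerD2r.
  rewrite -lerBlDl /sqf subr_sqr; apply: le_trans (ler_norm _) _; rewrite normrM mulrC.
  apply: ler_pM => //.
  apply: le_trans (ler_normD _ _) _.
  by apply: le_trans (lerD (pc_slope_le1 y pA) (D_le1 y)) _; rewrite -mulr2n.
set K := m p0 * V / 2 in P1.
have lV M (M0' : 0 <= M) : nonexpansive (T M V A) by exact: step_nonexpansive.
have P2 x : T 0 (dxi a) (T (m p0) V A) x <=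
    1 * (1 * T 0 (dxi b) A x + K * s * 1) + K * T 0 (dxi a) (sqf D) x.
  rewrite lin_aux (_ : dxi b = dxi a + V); last by rewrite VE addrC subrK.
  rewrite -(step_conv _ va V0 (lexx 0) lA).
  rewrite [leLHS]step0E [T 0 (dxi a) (T 0 V A) x]step0E [T 0 (dxi a) (sqf D) x]step0E.
  have eT M (M0' : 0 <= M) : egrow (fun g => T M V A (x + g * Num.sqrt (dxi a))).
    by apply: egrow_nonexp_move; exact: lV.
  have eD : egrow (fun g => sqf D (x + g * Num.sqrt (dxi a))).
    by apply: egrow_move; exact: sqf_egrow.
  have -> : K * ((\int[gamma]_g sqf D (x + g * Num.sqrt (dxi a))) + s) =
     \int[gamma]_g (K * (sqf D (x + g * Num.sqrt (dxi a)) + s)).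
    rewrite gaussZ; last by apply: egrowD => //; exact: egrow_cst.
    by rewrite gaussD//; [rewrite gauss_cst|exact: egrow_cst].
  have e2 : egrow (fun g => K * (sqf D (x + g * Num.sqrt (dxi a)) + s)).
    by apply: egrowZ; apply: egrowD => //; exact: egrow_cst.
  rewrite -gaussD//; last exact: eT.
  apply: le_gauss; [exact: eT|by apply: egrowD => //; exact: eT|move=> g; exact: P1].
have F1 : lingrow (T 0 (dxi b) A).
  by apply: nonexpansive_lingrow; exact: step_nonexpansive.
have F2 := heat_sqf_lingrow D_le1 D_lip (dxi a).
have F3 : lingrow (fun x => 1 * T 0 (dxi b) A x + K * s * 1).
  exact: lingrow_lin F1 (lingrow_cst 1).
have F4 : lingrow (T 0 (dxi a) (T (m p0) V A)).
  by apply: nonexpansive_lingrow; apply: step_nonexpansive => //; exact: lV.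
have I1 : \int[P]_w T 0 (dxi a) (T (m p0) V A) (h w) <=
   \int[P]_w (T 0 (dxi b) A (h w)) + K * (ED (dxi a) + s).
  have := @le_field _ _ _ P h h_int (T 0 (dxi a) (T (m p0) V A)) _ F4 (lingrow_lin 1 K F3 F2) P2.
  rewrite (field_lin h_int 1 K F3 F2) (field_lin h_int 1 (K * s) F1 (lingrow_cst 1)).
  by rewrite field_cst lin_aux.
have I2 := @move_mass_left R xi mix k m q adm _ Om P h h_int minimal C C0 C_upper a b e p0 pk a0 aq qb bq e0.
have He2 p : (p <= k.+1)%N -> q p < a -> m p <= e.
  by move=> pk1 qa; apply: He => //; exact: lt_le_trans aa'.
move: I2 => /(_ He2); rewrite -VE => I2.
have I3 : \int[P]_w T 0 (dxi b) A (h w) <= \int[P]_w Phi (h w) 0.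
  apply: (@le_field _ _ _ P h h_int (T 0 (dxi b) A) (Phi ^~ 0)) => //.
    by apply: nonexpansive_lingrow; exact: (PhiD_nonexp xi adm).
  by move=> x; have := PhiD_heat_ge mix adm x (lexx 0) b0 b1; rewrite (dxi0 mix) subr0.
have I4 : \int[P]_w (T 0 (dxi a) (T (m p0) V A) (h w) + C * e * dxi a) =
   \int[P]_w T 0 (dxi a) (T (m p0) V A) (h w) + C * e * dxi a.
  rewrite -[in RHS](field_cst P (C * e * dxi a)) RintegralD//.
    exact: (lingrow_integrable h_int F4).
  exact: (lingrow_integrable h_int (lingrow_cst (C * e * dxi a))).
have J1 : J (theta xi) 0 - J (theta xi) a' <= e * theta xi a' - e * theta xi 0.
  apply: (@weight_int_le R k m q adm (theta xi) (fun u => e * theta xi u)) => // p u t pk1 pu ut tq u0 ta.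
  rewrite -mulrBr ler_wpM2r ?subr_ge0 ?(theta_le mix) ?(ltW ut)//.
  by rewrite He// (le_lt_trans pu)// (lt_le_trans ut).
have J2 : J (theta xi) a' - J (theta xi) b <= m p0 * theta xi b - m p0 * theta xi a'.
  apply: (@weight_int_le R k m q adm (theta xi) (fun u => m p0 * theta xi u)) => // p u t pk1 pu ut tq u0 tb.
  have pp : (p <= p0)%N.
    rewrite leqNgt; apply/negP => pp.
    have := adm_q_le adm pp (leqW pk1); rewrite leNgt => /negP; apply.
    by rewrite (le_lt_trans pu)// (lt_le_trans ut)// (le_trans tb).
  rewrite -mulrBr ler_wpM2r ?(adm_m_le adm)// subr_ge0 (theta_le mix) ?(ltW ut)//.
  exact: le_trans u0.
rewrite I4 in I2.
apply: (left_aux I2 I1 I3 J1 J2).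
rewrite ler_wpM2l//; exact: (proj1 (theta_bounds mix a0 aa')).
Qed.

End left_inequality.

(** * Mass near the smallest point of the support *)
Section ramp.
Context {R : realType}.
Implicit Types (nu : probability (measurableTypeR R) R) (s t x : R).
Local Notation I01 := (`[0, 1]%classic : set R).

Definition ramp s t x : R := Num.min 1 (Num.max 0 ((t - x) / (t - s))).

Lemma ramp_continuous s t : continuous (ramp s t).
Proof.
move=> x; apply: (@continuous_min R R (fun=> 1) (fun x => Num.max 0 ((t - x) / (t - s)))); first exact: cvg_cst.
apply: (@continuous_max R R (fun=> 0) (fun x => (t - x) / (t - s))); first exact: cvg_cst.
by apply: cvgM; [apply: cvgB; [exact: cvg_cst|exact: cvg_id]|exact: cvg_cst].
Qed.

Lemma ramp_ge0 s t x : 0 <= ramp s t x.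
Proof. by rewrite /ramp le_min ler01 le_max lexx. Qed.

Lemma ramp_le1 s t x : ramp s t x <= 1.
Proof. by rewrite /ramp ge_min lexx. Qed.

Lemma ramp_left s t x : s < t -> x <= s -> ramp s t x = 1.
Proof.
move=> st xs; apply/min_idPl; rewrite le_max; apply/orP; right.
by rewrite ler_pdivlMr ?subr_gt0// mul1r lerD2l lerN2.
Qed.

Lemma ramp_right s t x : s < t -> t <= x -> ramp s t x = 0.
Proof.
move=> st tx; rewrite /ramp max_l ?min_r//.
by rewrite ler_pdivrMr ?subr_gt0// mul0r subr_le0.
Qed.

Lemma ramp_measurable s t (A : set R) :
  measurable_fun (A : set (measurableTypeR R)) (fun x => (ramp s t x)%:E).
Proof.
apply: measurable_funTS; apply/measurable_EFinP.
exact: (continuous_measurableT (@ramp_continuous s t)).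
Qed.

Let I01_measurable : measurable (I01 : set (measurableTypeR R)).
Proof. exact: measurable_itv. Qed.

Lemma measure_le_ramp nu (A : set R) s t :
  measurable (A : set (measurableTypeR R)) -> s < t -> A `<=` I01 ->
  (forall x, A x -> x <= s) ->
  fine (nu A) <= \int[nu]_(x in I01) ramp s t x.
Proof.
move=> mA st A01 As; rewrite /Rintegral.
have fin : (\int[nu]_(x in I01) (ramp s t x)%:E <= nu I01)%E.
  rewrite -[leRHS]mul1e -integral_cst//; apply: ge0_le_integral => //.
  - by move=> x _; rewrite lee_fin ramp_ge0.
  - exact: ramp_measurable.
  - by move=> x _; rewrite lee_fin ramp_le1.
have ge0 : (0 <= \int[nu]_(x in I01) (ramp s t x)%:E)%E.
  by apply: integral_ge0 => x _; rewrite lee_fin ramp_ge0.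
apply: fine_le.
- exact: fin_num_measure.
- by rewrite ge0_fin_numE// (le_lt_trans fin)// (le_lt_trans (probability_le1 nu _)) ?ltry.
have -> : nu A = (\int[nu]_(x in A) (ramp s t x)%:E)%E.
  rewrite (eq_integral (cst 1%E)) ?integral_cst ?mul1e//.
  by move=> x; rewrite inE => Ax; rewrite ramp_left// As.
apply: ge0_subset_integral => //; first exact: ramp_measurable.
by move=> x _; rewrite lee_fin ramp_ge0.
Qed.

Lemma ramp_le_measure nu (A : set R) s t :
  measurable (A : set (measurableTypeR R)) -> s < t ->
  (forall x, I01 x -> x < t -> A x) ->
  \int[nu]_(x in I01) ramp s t x <= fine (nu A).
Proof.
move=> mA st At; rewrite /Rintegral.
have H : (\int[nu]_(x in I01) (ramp s t x)%:E <= nu A)%E.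
  apply: (@le_trans _ _ (\int[nu]_(x in I01) (\1_A x)%:E)%E).
    apply: ge0_le_integral => //.
    - by move=> x _; rewrite lee_fin ramp_ge0.
    - exact: ramp_measurable.
    - by apply/measurable_EFinP; exact: measurable_indic.
    - move=> x x01; rewrite lee_fin indicE; have [xt|tx] := ltP x t.
        by rewrite mem_set ?ramp_le1//; exact: At.
      by rewrite ramp_right// ler0n.
  rewrite integral_indic//; apply: le_measure; rewrite ?inE//.
  exact: measurableI.
have ge0 : (0 <= \int[nu]_(x in I01) (ramp s t x)%:E)%E.
  by apply: integral_ge0 => x _; rewrite lee_fin ramp_ge0.
apply: fine_le => //; last exact: fin_num_measure.
by rewrite ge0_fin_numE// (le_lt_trans H)// (le_lt_trans (probability_le1 nu mA)) ?ltry.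
Qed.

End ramp.

Section parisi_measure_limit.
Context {R : realType}.
Local Notation I01 := (`[0, 1]%classic : set R).
Variables (mu : probability (measurableTypeR R) R) (c : R).
Hypothesis mu01 : mu I01 = 1%E.
Hypothesis c_smallest : is_smallest (measure_support mu) c.

Let I01_measurable : measurable (I01 : set (measurableTypeR R)).
Proof. exact: measurable_itv. Qed.

Let muC01 : mu (~` I01) = 0%E.
Proof. by rewrite probability_setC// mu01 subee. Qed.

Lemma smallest_support_in01 : 0 <= c <= 1.
Proof.
have [supp _] := c_smallest.
apply: contrapT => nc.
have oC : open (~` I01) by rewrite openC; exact: interval_closed.
have cC : (~` I01) c by rewrite /= in_itv.
by have := supp _ oC cC; rewrite muC01 ltxx.
Qed.

(** Each point below [c] has a null neighbourhood, which contains a rational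
    interval around it: countably many null sets cover the half line. *)
Lemma null_below_support : mu [set x | x < c] = 0%E.
Proof.
have mb (a b : R) : measurable (`]a, b[%classic : set (measurableTypeR R)) by exact: measurable_itv.
have mc : measurable ([set x | x < c] : set (measurableTypeR R)).
  by have := @measurable_itv R `]-oo, c[%R; congr measurable; apply/seteqP; split => x /=; rewrite in_itv.
apply/negligibleP => //.
pose G (ab : rat * rat) : set (measurableTypeR R) :=
  if mu (`](ratr ab.1 : R), ratr ab.2[%classic) == 0%E then `](ratr ab.1 : R), ratr ab.2[%classic else set0.
pose F (i : nat) : set (measurableTypeR R) := oapp G set0 (unpickle i).
have FE ab : F (pickle ab) = G ab by rewrite /F pickleK.
apply: (@negligibleS _ _ _ mu (\bigcup_i F i)).
  move=> x /= xc; have [_ lb] := c_smallest.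
  have : ~ measure_support mu x by move=> /lb; rewrite leNgt xc.
  move=> /existsNP[U] /not_implyP[oU] /not_implyP[Ux] /negP; rewrite -leNgt => muU.
  have /nbhs_ballP[e /= e0 eU] : nbhs x U by exact: open_nbhs_nbhs.
  have [a ax] : exists a : rat, ratr a \in `](x - e), x[%R.
    by apply: rat_in_itvoo; rewrite ltrBlDr ltrDl.
  have [b xb] : exists b : rat, ratr b \in `]x, (x + e)[%R.
    by apply: rat_in_itvoo; rewrite ltrDl.
  move: ax xb; rewrite !in_itv/= => /andP[ea ax] /andP[xb be].
  exists (pickle (a, b)); first exact: I.
  rewrite FE /G [(a, b).1]/= [(a, b).2]/=.
  have -> : mu `](ratr a : R), ratr b[%classic == 0%E.
    rewrite eq_le measure_ge0 andbT; apply: le_trans muU.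
    apply: le_measure; rewrite ?inE//; first exact: open_measurable.
    move=> y /=; rewrite in_itv/= => /andP[ay yb]; apply: eU.
    rewrite /ball/= ltr_distl; apply/andP; split; lra.
  by rewrite /= in_itv/= ax xb.
apply: negligible_bigcup => i; rewrite /F; case: (unpickle i) => [[a b]|]; rewrite [oapp _ _ _]/= ?/G; last exact: negligible_set0.
rewrite [(a, b).1]/= [(a, b).2]/=; case: eqP => [E|_]; last exact: negligible_set0.
by apply/negligibleP.
Qed.

Lemma ramp_int_below s : s < c -> \int[mu]_(x in I01) ramp s c x = 0.
Proof.
move=> sc; apply/le_anti/andP; split.
  rewrite -[leRHS](_ : fine (mu [set x | x < c]) = 0); last by rewrite null_below_support.
  apply: ramp_le_measure => //.
  by have := @measurable_itv R `]-oo, c[%R; congr measurable; apply/seteqP; split => x /=; rewrite in_itv.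
by apply: fine_ge0; apply: integral_ge0 => x _; rewrite lee_fin ramp_ge0.
Qed.

Lemma ramp_int_above s t : c < s -> s < t -> 0 < \int[mu]_(x in I01) ramp s t x.
Proof.
move=> cs st; have [supp _] := c_smallest.
pose S : set (measurableTypeR R) := [set x | x < s].
have E : S = `]-oo, s[%classic by apply/seteqP; split => x /=; rewrite in_itv.
have ms : measurable (S : set (measurableTypeR R)) by rewrite E; exact: measurable_itv.
have mI : measurable (S `&` I01 : set (measurableTypeR R)) by exact: measurableI.
have pos : (0 < mu S)%E.
  by apply: supp => //; rewrite E; exact: interval_open.
apply: (@lt_le_trans _ _ (fine (mu (S `&` I01)))); last first.
  by apply: measure_le_ramp => // x [] // /= xs _; exact: ltW.
have : (mu S <= mu (S `&` I01))%E.
  have Z : mu (S `\` I01) = 0%E.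
    apply: (@subset_measure0 _ _ _ mu _ (~` I01)) => //; [exact: measurableD|exact: measurableC].
  rewrite [leLHS](measureDI mu ms I01_measurable).
  by rewrite [X in (X + _)%E](Z : _ = _) add0e.
move=> /(lt_le_trans pos) p; apply: fine_gt0; rewrite p/=.
by rewrite (le_lt_trans (probability_le1 mu mI)) ?ltry.
Qed.

Variables (tau : nat -> triplet R) (nu : nat -> probability (measurableTypeR R) R).
Hypothesis adm : forall n, admissible (tk (tau n)) (tm (tau n)) (tq (tau n)).
Hypothesis assoc : forall n, associated_measure (tau n) (nu n).
Hypothesis weak : weak_limit01 nu mu.

Let ramp_cvg s t : (\int[nu n]_(x in I01) ramp s t x) @[n --> \oo] --> \int[mu]_(x in I01) ramp s t x.
Proof.
by apply: weak; apply: continuous_subspaceT; exact: ramp_continuous.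
Qed.

(** The ramp from [a'] to [c] is a continuous majorant of the indicator of the
    points below [a'], and its integral against the limit vanishes. *)
Lemma eventually_light_left a' e : a' < c -> 0 < e ->
  \forall n \near \oo, forall p, (p <= (tk (tau n)).+1)%N -> tq (tau n) p < a' -> tm (tau n) p <= e.
Proof.
move=> ac e0.
have := @ramp_cvg a' c; rewrite ramp_int_below// => /cvgr_le/(_ _ e0).
apply: filterS => n le p pk qa.
case: p pk qa => [|p] pk qa.
  by have [-> _ _ _ _] := adm n; exact: ltW.
have [_ /(_ p.+1)] := assoc n; rewrite pk => /(_ isT) E.
have -> : tm (tau n) p.+1 = fine (nu n `[0, tq (tau n) p.+1]%classic) by rewrite E.
apply: le_trans le; apply: measure_le_ramp => //.
- move=> x /=; rewrite !in_itv/= => /andP[-> xq]/=.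
  by rewrite (le_trans xq)// (adm_q_le1 (adm n))// ltnW.
- move=> x /=; rewrite !in_itv/= => /andP[_ xq].
  by rewrite (le_trans xq)// ltW.
Qed.

(** A ramp minorizes the indicator of [[0, c2]] and has a positive integral
    against the limit.  When [c2 < q_(p+1)], the atoms of the discrete measure
    that lie in [[0, c2]] are among [q_1, ..., q_p], so [m_p] is at least the
    mass of [[0, c2]]; for [p = 0] there is no such atom, and the mass would be
    0. *)
Lemma eventually_heavy_left c2 : c < c2 -> exists2 M0, 0 < M0 &
  \forall n \near \oo, forall p, (p <= (tk (tau n)).+1)%N -> c2 < tq (tau n) p.+1 -> M0 <= tm (tau n) p.
Proof.
move=> cc2; set s := (c + c2) / 2.
have [cs sc2] : c < s /\ s < c2 by rewrite /s; split; lra.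
have I0 := ramp_int_above cs sc2.
set I := \int[mu]_(x in _) _ in I0.
have I2 : 0 < I / 2 by rewrite divr_gt0.
exists (I / 2) => //.
have lt : I / 2 < I by rewrite ltr_pdivrMr// ltr_pMr// ltr1n.
have := @ramp_cvg s c2; rewrite -/I => /cvgr_ge/(_ _ lt).
apply: filterS => n le p pk qc.
have [at1 atE] := assoc n.
set At := [set x | _] in at1.
have mA : measurable (At : set (measurableTypeR R)).
  apply: countable_measurable => [x|]; first exact: measurable_set1.
  apply: (@sub_countable _ _ _ (range (tq (tau n)))).
    by apply: subset_card_le => x [j _ ->]; exists j.
  exact: card_image_le.
have m2 : measurable (`[0, c2]%classic : set (measurableTypeR R)) by exact: measurable_itv.
have le2 : I / 2 <= fine (nu n `[0, c2]%classic).
  apply: le_trans le _; apply: ramp_le_measure => // x /=; rewrite !in_itv/= => /andP[-> _]/=; exact: ltW.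
have nuC : nu n (~` At) = 0%E by rewrite probability_setC// at1 subee.
have E : nu n `[0, c2]%classic = nu n (`[0, c2]%classic `&` At).
  have Z : nu n (`[0, c2]%classic `\` At) = 0%E.
    apply: (@subset_measure0 _ _ _ (nu n) _ (~` At)) => //; [exact: measurableD|exact: measurableC].
  rewrite [LHS](measureDI (nu n) m2 mA).
  by rewrite [X in (X + _)%E](Z : _ = _) add0e.
have sub x : (`[0, c2]%classic `&` At) x -> (0 < p)%N /\ 0 <= x <= tq (tau n) p.
  move=> [] /=; rewrite in_itv/= => /andP[x0 xc] [j /andP[j1 jk] xq].
  have jp : (j <= p)%N.
    rewrite leqNgt; apply/negP => pj.
    have : tq (tau n) p.+1 <= tq (tau n) j by apply: (adm_q_le (adm n)) => //; rewrite ltnW.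
    by rewrite leNgt -xq (le_lt_trans xc).
  split; first exact: leq_trans jp.
  by rewrite x0/= xq (adm_q_le (adm n))// leqW.
move: le2; rewrite E; case: (posnP p) => [p0|p0].
  have -> : `[0, c2]%classic `&` At = set0.
    by apply/seteqP; split => x // /sub []; rewrite p0.
  by rewrite measure0/= => /(lt_le_trans I2); rewrite ltxx.
move=> /le_trans; apply.
have -> : tm (tau n) p = fine (nu n `[0, tq (tau n) p]%classic) by rewrite atE// p0.
apply: fine_le; [exact: fin_num_measure (measurableI _ _ m2 mA)|by apply: fin_num_measure; exact: measurable_itv|].
apply: le_measure; rewrite ?inE//; first exact: measurableI.
by move=> x /sub[_]; rewrite /= in_itv.
Qed.

End parisi_measure_limit.

(** * Passage to the limit *)
Section limits.
Context {R : realType}.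

Lemma le_limit (f : R -> R) (A x : R) : {for x, continuous f} ->
  (forall e, 0 < e -> exists2 y, `|x - y| < e & A <= f y) -> A <= f x.
Proof.
move=> cf H; rewrite leNgt; apply/negP => fA.
have /nbhs_ballP[e /= e0 eU] : nbhs x [set y | f y < A] by exact: (@cvgr_lt _ _ _ _ f (f x) cf A fA).
have [y xy] := H _ e0; rewrite leNgt => /negP; apply.
exact: eU.
Qed.

Lemma le_right_limit (f : R -> R) (A x : R) : {for x, continuous f} ->
  (forall y, x < y -> A <= f y) -> A <= f x.
Proof.
move=> cf H; apply: le_limit => // e e0; exists (x + e / 2); last by apply: H; rewrite ltrDl divr_gt0.
rewrite opprD addrA subrr add0r normrN gtr0_norm ?divr_gt0//.
by rewrite ltr_pdivrMr// ltr_pMr// ltr1n.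
Qed.

Lemma parisi_class_limit (G : nat -> R -> R) (F : R -> R) :
  (forall n, parisi_class (G n)) -> (forall x, (G n x) @[n --> \oo] --> F x) -> parisi_class F.
Proof.
move=> pG GF.
have H (u v : nat -> R) (a b : R) : (u n) @[n --> \oo] --> a -> (v n) @[n --> \oo] --> b ->
    (forall n, u n <= v n) -> a <= b.
  by move=> ua vb uv; rewrite -(cvg_lim _ ua)// -(cvg_lim _ vb)//; apply: ler_lim;
    [apply/cvg_ex; exists a|apply/cvg_ex; exists b|exact: nearW].
have cst (a : R) : (fun=> a) @ \oo --> a by exact: cvg_cst.
have cE (f : nat -> R) (a : R) : (f n) @[n --> \oo] --> a -> (expR (f n)) @[n --> \oo] --> expR a.
  by move=> fa; apply: continuous_cvg => //; exact: continuous_expR.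
split.
- move=> x y; apply: (H (fun n => `|G n x - G n y|) (fun=> `|x - y|)) => //.
    by apply: cvg_norm; exact: cvgB.
  by move=> n; exact: pc_lip.
- move=> l x y l0 l1.
  apply: (H (fun n => G n (l * x + (1 - l) * y)) (fun n => l * G n x + (1 - l) * G n y)) => //.
    by apply: cvgD; apply: cvgM => //; exact: cst.
  by move=> n; exact: pc_convex.
- move=> x; apply: (cvg_unique _ (GF (- x))) => //.
  have -> : (fun n => G n (- x)) = (fun n => G n x) by apply/funext => n; rewrite pc_even.
  exact: GF.
- move=> x y.
  apply: (H (fun n => expR (G n (x + y)) + expR (G n (x - y))) (fun n => (expR y + expR (- y)) * expR (G n x))).
  + by apply: cvgD; exact: cE.
  + by apply: cvgM; [exact: cst|exact: cE].
  + by move=> n; exact: pc_upper.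
- move=> x y.
  apply: (H (fun n => 2 * logcosh y * expR (- 2 * G n x)) (fun n => G n (x + y) + G n (x - y) - 2 * G n x)).
  + by apply: cvgM; [exact: cst|apply: cE; apply: cvgM => //; exact: cst].
  + by apply: cvgB; [exact: cvgD|apply: cvgM => //; exact: cst].
  + by move=> n; exact: pc_lower.
Qed.

End limits.

Section approximation.
Context {R : realType}.
Local Notation T := log_exp_step.
Variables (xi : R -> R) (mix : is_mixture xi).
Local Notation dxi := (derive1 xi).

Lemma dxi_left c e : 0 < c -> 0 < e -> exists a, [/\ 0 < a, a < c, c - a <= e & dxi c - dxi a <= e].
Proof.
move=> c0 e0.
have lt : dxi c - e < dxi c by rewrite gtrBl.
have /nbhs_ballP[r /= r0 rU] : nbhs c [set y | dxi c - e < dxi y].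
  exact: (@cvgr_gt _ _ _ _ dxi (dxi c) (dxi_continuous mix (x:=c)) _ lt).
(* The three bounds give [0 < c - s], [s <= e] and [c - s] in the neighbourhood of [c]. *)
pose s : R := Num.min (c / 2) (Num.min e (r / 2)).
have s0 : 0 < s by rewrite !lt_min !divr_gt0// e0.
have [sc se sr] : [/\ s <= c / 2, s <= e & s <= r / 2] by rewrite /s !ge_min !lexx !orbT.
clearbody s.
exists (c - s); split; [lra|lra|lra|].
have : dxi c - e < dxi (c - s).
  apply: rU; rewrite /ball/= opprB addrC subrK gtr0_norm//; lra.
by lra.
Qed.

Lemma dxi_right c e : c < 1 -> 0 < e -> exists b, [/\ c < b, b < 1, b - c <= e & dxi b - dxi c <= e].
Proof.
move=> c1 e0.
have lt : dxi c < dxi c + e by rewrite ltrDl.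
have /nbhs_ballP[r /= r0 rU] : nbhs c [set y | dxi y < dxi c + e].
  exact: (@cvgr_lt _ _ _ _ dxi (dxi c) (dxi_continuous mix (x:=c)) _ lt).
pose s : R := Num.min ((1 - c) / 2) (Num.min e (r / 2)).
have c10 : 0 < 1 - c by rewrite subr_gt0.
have s0 : 0 < s by rewrite !lt_min !divr_gt0// e0.
have [sc se sr] : [/\ s <= (1 - c) / 2, s <= e & s <= r / 2] by rewrite /s !ge_min !lexx !orbT.
clearbody s.
exists (c + s); split; [lra|lra|lra|].
have : dxi (c + s) < dxi c + e.
  apply: rU; rewrite /ball/= opprD addrA subrr add0r normrN gtr0_norm//; lra.
by lra.
Qed.

Lemma theta_increment a' c : 0 <= a' -> a' <= c -> c <= 1 ->
  theta xi c - theta xi a' <= dxi c - dxi a'.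
Proof.
move=> a0 ac c1; have [_ th] := theta_bounds mix a0 ac.
apply: le_trans th _; rewrite ler_piMl// subr_ge0; exact: (dxi_le mix).
Qed.

Lemma theta_le_dxi1 a : 0 <= a -> a <= 1 -> theta xi a - theta xi 0 <= dxi 1.
Proof.
move=> a0 a1; apply: le_trans (theta_increment (lexx 0) a0 a1) _.
by rewrite (dxi0 mix) subr0 (dxi_le mix).
Qed.

Variables (tau : nat -> triplet R) (Phi : R -> R -> R).
Hypothesis adm : forall n, admissible (tk (tau n)) (tm (tau n)) (tq (tau n)).
Hypothesis Phi_limit : is_Phi xi tau Phi.

Lemma Phi_close e : 0 < e -> \forall n \near \oo, forall y s, 0 <= s -> s <= 1 ->
  `|PhiD xi (tau n) y s - Phi y s| <= e.
Proof.
move=> e0; pose I2 : set (R * R) := [set: R] `*` `[0, 1]%classic.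
pose f (xs : R * R) : R := Phi xs.1 xs.2.
pose Q : set (R * R -> R) := [set g | forall xs, I2 xs -> `|g xs - f xs| <= e].
have N : nbhs (f : {uniform` I2 -> R}) Q.
  apply/uniform_nbhs; exists [set ab | ball ab.1 e ab.2]; split.
    exact: (entourage_ball R (PosNum e0)).
  by move=> g H xs /H /=; rewrite /ball/= distrC => /ltW.
have : \forall n \near \oo, Q (fun xs : R * R => PhiD xi (tau n) xs.1 xs.2) by exact: (Phi_limit N).
apply: filterS => n H y s s0 s1.
by apply: (H (y, s)); split => //=; rewrite in_itv/= s0.
Qed.

Lemma Phi_class s : 0 <= s -> s <= 1 -> parisi_class (Phi ^~ s).
Proof.
move=> s0 s1; apply: (@parisi_class_limit _ (fun n => PhiD xi (tau n) ^~ s)).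
  by move=> n; exact: (PhiD_class xi (adm n) s).
move=> x; apply/cvgrPdist_le => e e0.
have := Phi_close e0; apply: filterS => n /(_ x s s0 s1).
by rewrite distrC.
Qed.

Variable C : R.
Hypothesis C0 : 0 <= C.
Hypothesis C_upper : linear_step_bound (Num.sqrt (dxi 1)) C.

(** The discrete solution at time [b] differs from the limit at time [c] by at
    most [de] plus the variation [C * de] of the former in time; [pc_slope_close]
    takes the square root. *)
Lemma slope_close b c de : 0 <= c -> c <= b -> b <= 1 -> 0 < de -> dxi b - dxi c <= de ->
  \forall n \near \oo, forall y,
  `|derive1 (PhiD xi (tau n) ^~ b) y - derive1 (Phi ^~ c) y| <= 6 * Num.sqrt ((C + 1) * de).
Proof.
move=> c0 cb b1 de0 dbc; have := Phi_close de0; apply: filterS => n close y.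
have Cde : 0 < (C + 1) * de by rewrite mulr_gt0// ltr_wpDl.
have c1 : c <= 1 by exact: le_trans b1.
apply: pc_slope_close; [by rewrite sqrtr_gt0|exact: (PhiD_class xi (adm n) b)|exact: Phi_class|].
move=> z; rewrite sqr_sqrtr ?(ltW Cde)//.
have [t1 t2] := PhiD_time mix (adm n) C_upper z c0 cb b1.
have t3 : C * (dxi b - dxi c) <= C * de by rewrite ler_wpM2l.
have := close z c c0 c1.
move: t1 t2; rewrite /PhiD/=.
move: (PhiD_rec _ _ _ _ _ _ b) (PhiD_rec _ _ _ _ _ _ c) (Phi z c) => u v w t1 t2.
rewrite !ler_distl => /andP[h1 h2]; apply/andP; split; lra.
Qed.

End approximation.

(** * The overlap at the smallest point of the support *)
Section self_overlap.
Context {R : realType}.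
Local Notation T := log_exp_step.
Variables (xi : R -> R) (mix : is_mixture xi).
Local Notation dxi := (derive1 xi).
Context d (Om : measurableType d) (P : probability Om R).
Variable h : {RV P >-> R}.
Hypothesis h_int : P.-integrable [set: Om] (fun w => (h w)%:E).
Variables (tau : nat -> triplet R) (mu : probability (measurableTypeR R) R) (c : R).
Hypothesis mu_parisi : parisi_measure_along P h xi tau mu.
Hypothesis c_smallest : is_smallest (measure_support mu) c.
Variable Phi : R -> R -> R.
Hypothesis Phi_limit : is_Phi xi tau Phi.
Let D := derive1 (Phi ^~ c).
Local Notation ED v := (\int[P]_w T 0 v (sqf D) (h w)).
Local Notation k n := (tk (tau n)).
Local Notation m n := (tm (tau n)).
Local Notation q n := (tq (tau n)).

Let c01 : 0 <= c <= 1.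
Proof. by have [mu01 _] := mu_parisi; exact: smallest_support_in01 mu01 c_smallest. Qed.

Lemma parisi_admissible n : admissible (k n) (m n) (q n).
Proof.
have [_ [eps [nu [_ _ /(_ n)[[m0 mm m1 q0 [qq q1]] _ _] _ _]]]] := mu_parisi.
by split => //; [move=> p /mm/ltW|split=> // p /qq/ltW].
Qed.

Lemma parisi_minimal n m' q' : admissible (k n) m' q' ->
  parisi_functional P h xi (k n) (m n) (q n) <= parisi_functional P h xi (k n) m' q'.
Proof. by have [_ [eps [nu [_ _ /(_ n)[_ _ H] _ _]]]] := mu_parisi; exact: H. Qed.

Lemma parisi_light a' e : a' < c -> 0 < e ->
  \forall n \near \oo, forall p, (p <= (k n).+1)%N -> q n p < a' -> m n p <= e.
Proof.
have [mu01 [eps [nu [_ _ _ assoc weak]]]] := mu_parisi.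
move=> ac e0; exact: (eventually_light_left c_smallest parisi_admissible assoc weak ac e0).
Qed.

Lemma parisi_heavy c2 : c < c2 -> exists2 M0, 0 < M0 &
  \forall n \near \oo, forall p, (p <= (k n).+1)%N -> c2 < q n p.+1 -> M0 <= m n p.
Proof.
have [mu01 [eps [nu [_ _ _ assoc weak]]]] := mu_parisi.
move=> cc2; exact: (eventually_heavy_left mu01 c_smallest parisi_admissible assoc weak cc2).
Qed.

Let pD : parisi_class (Phi ^~ c).
Proof. by have /andP[c0 c1] := c01; exact: (Phi_class parisi_admissible Phi_limit c0 c1). Qed.

Lemma slope_limit_le1 y : `|D y| <= 1. Proof. exact: pc_slope_le1. Qed.

Lemma slope_limit_lip x y : `|D x - D y| <= 8 * `|x - y|. Proof. exact: pc_slope_lip. Qed.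

(** The error terms left of [c] are arbitrarily small.  If [c = 0], the point
    [a' = 0] does, since no [q p] is negative. *)
Let theta_small eps : 0 < eps -> exists a' e, [/\ 0 <= a', a' <= c, 0 <= e,
  e * (theta xi a' - theta xi 0) + (theta xi c - theta xi a') <= eps &
  \forall n \near \oo, forall p, (p <= (k n).+1)%N -> q n p < a' -> m n p <= e].
Proof.
move=> eps0; have /andP[c0 c1] := c01.
have [c_eq|cpos] := eqVneq c 0.
  exists 0, 0; split => //; first by rewrite c_eq mul0r add0r subrr ltW.
  apply: nearW => n p pk; rewrite ltNge => /negP; case.
  by apply: (adm_q_ge0 (parisi_admissible n)); exact: leqW.
have {}cpos : 0 < c by rewrite lt_neqAle eq_sym cpos.
have e20 : 0 < eps / 2 by rewrite divr_gt0.
have [a [a0 ac _ da]] := dxi_left mix cpos e20.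
have d1 : 0 <= dxi 1 by rewrite (dxi_ge0 mix).
have d2 : 0 < 2 * (dxi 1 + 1) by rewrite mulr_gt0// ltr_wpDl.
exists a, (eps / (2 * (dxi 1 + 1))); split.
- exact: ltW.
- exact: ltW.
- by rewrite divr_ge0// ltW.
- have t1 := theta_increment mix (ltW a0) (ltW ac) c1.
  have t2 := theta_le_dxi1 mix (ltW a0) (le_trans (ltW ac) c1).
  have : eps / (2 * (dxi 1 + 1)) * (theta xi a - theta xi 0) <= eps / 2.
    rewrite mulrAC ler_pdivrMr// mulrA divfK// ler_pM2l//.
    by apply: le_trans t2 _; rewrite lerDl.
  by move=> t3; apply: le_trans (lerD t3 (le_trans t1 da)) _; rewrite -splitr.
- by apply: parisi_light => //; exact: divr_gt0.
Qed.

Variable C : R.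
Hypothesis C0 : 0 <= C.
Hypothesis C_upper : linear_step_bound (Num.sqrt (dxi 1)) C.

Let right_aux (kap X b B : R) : 0 < kap ->
  (forall eps, 0 < eps -> exists K, kap <= K /\ K * (X - B) <= eps + b * K) -> X <= B + b.
Proof.
move=> kap0 H; rewrite leNgt; apply/negP => lt.
have lt' : 0 < X - B - b by lra.
have [K0 [kK]] := H _ (divr_gt0 (mulr_gt0 kap0 lt') (ltr0n R 2)).
have : kap * (X - B - b) <= K0 * (X - B - b) by rewrite ler_wpM2r// ltW.
have := mulr_gt0 kap0 lt'.
rewrite (mulrC b) mulrBr (mulrBr K0 _ b); move: (kap * _) => z z0 h1 h2; lra.
Qed.

(** On [[c2, b]] the parameter is at least [M0], which bounds from below the
    integral by which the inequality is divided. *)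
Let heavy_weight n b c2 M0 : 0 < M0 -> c < c2 -> c2 < b -> b <= 1 ->
  (forall p, (p <= (k n).+1)%N -> c2 < q n p.+1 -> M0 <= m n p) ->
  M0 * (dxi b - dxi c2) <=
    weight_int (k n) (m n) (q n) dxi c - weight_int (k n) (m n) (q n) dxi b.
Proof.
move=> M00 cc2 c2b b1 heavy; have /andP[c0 _] := c01.
have c20 : 0 <= c2 by rewrite (le_trans c0)// ltW.
have := @weight_int_ge R _ _ _ (parisi_admissible n) dxi
  (fun s => M0 * dxi (Num.max s c2)) c b c0 (ltW (lt_trans cc2 c2b)) b1.
rewrite (max_l (ltW c2b)) (max_r (ltW cc2)) -mulrBr; apply => p s t pk qs st tq cs tb.
have s0 : 0 <= s by exact: le_trans cs.
have mono := dxi_le mix.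
have dst : 0 <= dxi t - dxi s by rewrite subr_ge0 mono// ltW.
have [tc|ct] := leP t c2.
  by rewrite (max_r (le_trans (ltW st) tc)) subrr mulr_ge0// (adm_m_ge0 (parisi_admissible n)).
have Mm := heavy p pk (lt_le_trans ct tq).
rewrite -mulrBr; apply: ler_pM => //; first exact: ltW.
  by rewrite subr_ge0; case: (leP s c2) => sc; rewrite mono// ltW.
by rewrite lerD2l lerN2 mono// le_max lexx.
Qed.

(** After division by the weight of [[c, b]], which is bounded below along the
    sequence, [right_inequality] gives the bound [b] plus terms of the order of
    the square root of [xi' b - xi' c]; then [b] tends to [c]. *)
Let overlap_le : c < 1 -> ED (dxi c) <= c.
Proof.
move=> c1; have /andP[c0 _] := c01.
pose g (de : R) : R := 2 * (8 * Num.sqrt de + 6 * Num.sqrt ((C + 1) * de)) + (c + de).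
have g0 : g 0 = c by rewrite /g mulr0 sqrtr0 !mulr0 !addr0 mulr0 add0r.
rewrite -[leRHS]g0; apply: le_right_limit => [|de de0].
  apply: cvgD; last by apply: cvgD; [exact: cvg_cst|exact: cvg_id].
  apply: cvgM; first exact: cvg_cst.
  apply: cvgD; (apply: cvgM; first exact: cvg_cst).
    exact: sqrt_continuous.
  apply: continuous_comp; last exact: sqrt_continuous.
  by apply: cvgM; [exact: cvg_cst|exact: cvg_id].
have [b [cb b1 bc db]] := dxi_right mix c1 de0.
have dcb : 0 <= dxi b - dxi c by rewrite subr_ge0 (dxi_le mix)// ltW.
pose c2 := (c + b) / 2.
have [cc2 c2b] : c < c2 /\ c2 < b by rewrite /c2; split; lra.
have [M0 M00 heavy] := parisi_heavy cc2.
pose r := 6 * Num.sqrt ((C + 1) * de).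
have r0 : 0 <= r by rewrite mulr_ge0// sqrtr_ge0.
apply: (@le_trans _ _ (2 * (8 * Num.sqrt (dxi b - dxi c) + r) + b)); last first.
  rewrite /g; apply: lerD; last by rewrite -lerBlDl.
  rewrite ler_wpM2l// lerD2r ler_wpM2l// ler_sqrt//; exact: ltW.
have kap0 : 0 < M0 * (dxi b - dxi c2).
  by rewrite mulr_gt0// subr_gt0 (dxi_lt mix)// (le_trans c0)// ltW.
apply: (right_aux kap0) => eps eps0.
have [a' [e [a'0 a'c e0 th light]]] := theta_small eps0.
have close := slope_close mix parisi_admissible Phi_limit C0 C_upper c0 (ltW cb) (ltW b1) de0 db.
have [n [[hn ln] cn]] := filter_ex (filterI (filterI heavy light) close).
have := heavy_weight M00 cc2 c2b (ltW b1) hn.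
set K := (weight_int _ _ _ _ c - _) => kK.
exists K; split; first exact: kK.
have := @right_inequality R xi mix (k n) (m n) (q n) (parisi_admissible n) _ Om P h h_int
  (@parisi_minimal n) D slope_limit_le1 slope_limit_lip b r (ltW b1) cn a' c e a'0 a'c (ltW cb) e0 ln K erefl.
by move=> /le_trans; apply; rewrite lerD2r.
Qed.

Variable Cu : R.
Hypothesis Cu0 : 0 <= Cu.
Hypothesis Cu_upper : quadratic_step_bound (Num.sqrt (dxi 1)) Cu.

Let crossing (f : nat -> R) (b : R) j : f 0%N <= b -> b < f j ->
  exists p, [/\ (p < j)%N, f p <= b & b < f p.+1].
Proof.
elim: j => [|j IH] f0 bj; first by have := lt_le_trans bj f0; rewrite ltxx.
have [fj|fj] := leP (f j) b; first by exists j.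
by have [p [pj fp bp]] := IH f0 fj; exists p; split => //; exact: ltnW.
Qed.

(** A point [b] just above [c] (or [b = 1] if [c = 1]), and the layer that
    contains it. *)
Let heavy_layer de : 0 < de -> exists b M0, [/\ c <= b, b <= 1, dxi b - dxi c <= de, 0 < M0 &
  \forall n \near \oo, exists p0, [/\ (p0 <= (k n).+1)%N, q n p0 <= b, b <= q n p0.+1 & M0 <= m n p0]].
Proof.
move=> de0; have /andP[c0 c1] := c01.
have [ce|cn] := eqVneq c 1.
  exists 1, 1; split => //; rewrite ?ce ?subrr//; first exact: ltW.
  apply: nearW => n; have adm := parisi_admissible n.
  exists (k n).+1; split => //; first exact: (adm_q_le1 adm).
    by have [_ _ _ _ [_ ->]] := adm.
  by have [_ _ -> _ _] := adm.
have {cn}c_lt1 : c < 1 by rewrite lt_neqAle cn.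
have [b [cb b1 _ db]] := dxi_right mix c_lt1 de0.
have [M0 M00 heavy] := parisi_heavy cb.
exists b, M0; split => //; [exact: ltW|exact: ltW|].
apply: filterS heavy => n heavy; have adm := parisi_admissible n.
have [p [pk qb bq]] : exists p, [/\ (p < (k n).+2)%N, q n p <= b & b < q n p.+1].
  have [_ _ _ q0 [_ q1]] := adm.
  by apply: crossing; rewrite ?q0 ?q1 ?(le_trans c0)// ltW.
by exists p; split => //; [exact: ltW|exact: heavy].
Qed.

Let left_aux (M0 X Y B : R) : 0 < M0 -> 0 <= B ->
  (forall e, 0 < e -> e < M0 -> exists M, M0 <= M /\ M * X <= M * Y + e * B) -> X <= Y.
Proof.
move=> M00 B0 H; rewrite leNgt; apply/negP => lt.
have XY : 0 < X - Y by rewrite subr_gt0.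
have B1 : 0 < 2 * (B + 1) by rewrite mulr_gt0// ltr_wpDl.
pose e := Num.min (M0 / 2) (M0 * (X - Y) / (2 * (B + 1))).
have e0 : 0 < e by rewrite lt_min !divr_gt0// mulr_gt0.
have eM : e < M0 by rewrite gt_min ltr_pdivrMr// ltr_pMr// ltr1n.
have eB : e * B <= M0 * (X - Y) / 2.
  have : e <= M0 * (X - Y) / (2 * (B + 1)) by rewrite /e ge_min lexx orbT.
  rewrite ler_pdivlMr// => h1; rewrite ler_pdivlMr// -mulrA; apply: le_trans h1.
  by rewrite ler_wpM2l// ?(ltW e0)// mulrC ler_wpM2l// lerDl.
have [M [MM]] := H _ e0 eM.
have h1 : M0 * (X - Y) <= M * (X - Y) by rewrite ler_wpM2r// ltW.
have h2 := mulr_gt0 M00 XY.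
move: h1; rewrite (mulrBr M) => h1 h3; move: (M0 * (X - Y)) eB h1 h2 => z; lra.
Qed.

Let ED_ge0 v : 0 <= ED v.
Proof.
apply: (@le_trans _ _ (\int[P]_w (0 : R))); first by rewrite field_cst.
apply: (@le_field _ _ _ P h h_int (fun=> 0) (T 0 v (sqf D))).
- exact: lingrow_cst.
- exact: heat_sqf_lingrow slope_limit_le1 slope_limit_lip v.
- by move=> x; rewrite step0E; apply: gauss_ge0 => g; exact: sqf_ge0.
Qed.

Let ED_time v w : ED v <= ED w + 16 * `|Num.sqrt v - Num.sqrt w|.
Proof.
have lg u := heat_sqf_lingrow slope_limit_le1 slope_limit_lip u.
set s := 16 * _.
have := @le_field _ _ _ P h h_int (T 0 v (sqf D)) _ (lg v) (lingrow_lin 1 s (lg w) (lingrow_cst 1)).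
rewrite (field_lin h_int 1 s (lg w) (lingrow_cst 1)) field_cst mul1r mulr1; apply => x.
have := heat_sqf_time slope_limit_le1 slope_limit_lip v w x.
by rewrite ler_distl ?mulr1 ?mul1r => /andP[_].
Qed.

Let sqrt_sub (u v : R) : 0 <= u -> u <= v -> `|Num.sqrt u - Num.sqrt v| <= Num.sqrt (v - u).
Proof.
move=> u0 uv; have v0 := le_trans u0 uv.
have su := sqrtr_ge0 u; have sd := sqrtr_ge0 (v - u).
rewrite distrC ger0_norm ?subr_ge0 ?ler_sqrt// lerBlDr.
rewrite -ler_sqr ?nnegrE ?sqrtr_ge0 ?addr_ge0// sqrrD !sqr_sqrtr ?subr_ge0//.
by have := mulr_ge0 sd su; lra.
Qed.

Let light_aux (e u v w t : R) : 0 < e -> u - v <= w -> 2 * (C * e * t) + (e * u - e * v) <= e * (2 * (C * t) + w).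
Proof.
by move=> e0 uv; have := ler_wpM2l (ltW e0) uv; rewrite mulrBr mulrDr; lra.
Qed.

(** The limit of [left_inequality] along the sequence, with [b] tending to [c]
    through [de], and [a'] to [c], at fixed [a]. *)
Let overlap_ge_at a de : 0 < a -> a < c -> 0 < de ->
  a * (dxi c - dxi a) <= (dxi c + de - dxi a) *
   (ED (dxi a) + (2 * (6 * Num.sqrt ((C + 1) * de)) + Cu * Num.sqrt (dxi c + de - dxi a))).
Proof.
move=> a0 ac de0; have /andP[c0 c1] := c01; have mono := dxi_le mix.
have [b [M0 [cb b1 db M00 layer]]] := heavy_layer de0.
set r := 6 * Num.sqrt ((C + 1) * de).
have r0 : 0 <= r by rewrite mulr_ge0// sqrtr_ge0.
have da0 : 0 <= dxi a by rewrite (dxi_ge0 mix)// ltW.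
have d1 : 0 <= dxi 1 by rewrite (dxi_ge0 mix).
pose V := dxi b - dxi a.
have V0 : 0 <= V by rewrite subr_ge0 mono// ?(ltW a0)// (le_trans (ltW ac)).
apply: (@le_trans _ _ (V * (ED (dxi a) + (2 * r + Cu * Num.sqrt V)))); last first.
  have VV : V <= dxi c + de - dxi a by rewrite lerD2r -lerBlDl.
  have VV0 : 0 <= dxi c + de - dxi a by exact: le_trans VV.
  apply: ler_pM => //; first by rewrite !addr_ge0// mulr_ge0// sqrtr_ge0.
  by rewrite !lerD2l ler_wpM2l// ler_sqrt.
apply/ler_addgt0Pr => eta eta0.
(* Taking [a'] within [c - a] of [c] ensures [a <= a']. *)
have eta1 : 0 < Num.min eta (c - a) by rewrite lt_min eta0 subr_gt0.
have [a' [a'0 a'c ca' da']] := dxi_left mix (lt_trans a0 ac) eta1.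
have aa' : a <= a' by move: ca'; rewrite le_min => /andP[_]; lra.
have {}da' : dxi c - dxi a' <= eta by move: da'; rewrite le_min => /andP[].
have step : a * (dxi a' - dxi a) <= V * (ED (dxi a) + (2 * r + Cu * Num.sqrt V)).
  apply: (@left_aux M0 _ _ (2 * (C * dxi a) + dxi 1)) => // [|e e0 eM].
    by rewrite addr_ge0// !mulr_ge0.
  have light := parisi_light a'c e0.
  have close := slope_close mix parisi_admissible Phi_limit C0 C_upper c0 cb b1 de0 db.
  have [n [[[p0 [pk qb bq Mm]] ln] cn]] := filter_ex (filterI (filterI layer light) close).
  have aq : a <= q n p0.
    rewrite leNgt; apply/negP => qa.
    have := ln p0 pk (lt_le_trans qa aa').
    by rewrite leNgt (lt_le_trans eM).
  exists (m n p0); split => //.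
  have := @left_inequality R xi mix (k n) (m n) (q n) (parisi_admissible n) _ Om P h h_int
    (@parisi_minimal n) D slope_limit_le1 slope_limit_lip b r cn C C0 C_upper Cu Cu_upper a a' e p0 pk
    (ltW a0) aq qb bq aa' (le_trans (ltW a'c) cb) (ltW e0) ln V erefl.
  move=> /le_trans; apply; rewrite -[m n p0 * V * _]mulrA lerD2l.
  have th := theta_le_dxi1 mix (ltW a'0) (le_trans (ltW a'c) c1).
  exact: light_aux th.
apply: le_trans (lerD step da').
rewrite -subr_ge0.
have -> : a * (dxi a' - dxi a) + (dxi c - dxi a') - a * (dxi c - dxi a) = (1 - a) * (dxi c - dxi a') by ring.
by rewrite mulr_ge0 ?subr_ge0 ?mono ?(ltW a'c) ?(ltW a'0)// (le_trans (ltW ac)).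
Qed.

Let ge_aux (a u v n w x de : R) : a <= u + Cu * w -> u <= v + 16 * n -> n <= w -> w <= x ->
  Cu * w <= Cu * x -> c - a <= de -> c <= de + v + (16 + Cu) * x.
Proof. by rewrite (mulrDl 16 Cu x); lra. Qed.

Let overlap_ge : c <= ED (dxi c).
Proof.
have /andP[c0 c1] := c01.
have [->|cneq] := eqVneq c 0; first exact: ED_ge0.
have cpos : 0 < c by rewrite lt_neqAle eq_sym cneq.
have at_a a : 0 < a -> a < c -> a <= ED (dxi a) + Cu * Num.sqrt (dxi c - dxi a).
  move=> a0 ac; set E := ED (dxi a).
  have W0 : 0 < dxi c - dxi a by rewrite subr_gt0 (dxi_lt mix)// ltW.
  set W := dxi c - dxi a.
  pose g (de : R) : R := (dxi c + de - dxi a) *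
     (E + (2 * (6 * Num.sqrt ((C + 1) * de)) + Cu * Num.sqrt (dxi c + de - dxi a))).
  have g0 : g 0 = W * (E + Cu * Num.sqrt W).
    by rewrite /g mulr0 sqrtr0 !mulr0 add0r addr0.
  rewrite -(ler_pM2l W0) -g0 mulrC; apply: le_right_limit => [|de de0]; last exact: overlap_ge_at.
  have c_aff (x : R) : {for x, continuous (fun de : R => dxi c + de - dxi a)}.
    by apply: cvgB; [apply: cvgD; [exact: cvg_cst|exact: cvg_id]|exact: cvg_cst].
  apply: cvgM; first exact: c_aff.
  apply: cvgD; first exact: cvg_cst.
  apply: cvgD; (apply: cvgM; first exact: cvg_cst).
    apply: cvgM; first exact: cvg_cst.
    apply: continuous_comp; last exact: sqrt_continuous.
    by apply: cvgM; [exact: cvg_cst|exact: cvg_id].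
  by apply: continuous_comp; [exact: c_aff|exact: sqrt_continuous].
pose g (de : R) : R := de + ED (dxi c) + (16 + Cu) * Num.sqrt de.
have g0 : g 0 = ED (dxi c) by rewrite /g sqrtr0 mulr0 add0r addr0.
rewrite -g0; apply: le_right_limit => [|de de0].
  apply: cvgD; first by apply: cvgD; [exact: cvg_id|exact: cvg_cst].
  by apply: cvgM; [exact: cvg_cst|exact: sqrt_continuous].
have [a [a0 ac ca da]] := dxi_left mix cpos de0.
have h1 := at_a a a0 ac.
have h2 := ED_time (dxi a) (dxi c).
have h3 := sqrt_sub (dxi_ge0 mix (ltW a0)) (dxi_le mix (ltW a0) (ltW ac)).
have h4 : Num.sqrt (dxi c - dxi a) <= Num.sqrt de by rewrite ler_sqrt// ltW.
have h5 := ler_wpM2l Cu0 h4.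
exact: (ge_aux h1 h2 h3 h4 h5 ca).
Qed.

Lemma self_overlap : ED (dxi c) = c.
Proof.
apply/le_anti; rewrite overlap_ge andbT.
have [c1|cn] := eqVneq c 1; last first.
  by apply: overlap_le; rewrite lt_neqAle cn; have /andP[] := c01.
apply: (@le_trans _ _ (\int[P]_w (1 : R))); last by rewrite field_cst c1.
apply: (@le_field _ _ _ P h h_int (T 0 (dxi c) (sqf D)) (fun=> 1)).
- exact: heat_sqf_lingrow slope_limit_le1 slope_limit_lip _.
- exact: lingrow_cst.
- move=> x; rewrite step0E; apply: gauss_le => [|g].
    exact: egrow_move (sqf_egrow slope_limit_le1 slope_limit_lip).
  exact: sqf_le1 slope_limit_le1 _.
Qed.

End self_overlap.

(** * Variances of Gaussian averages *)
Section gauss_fubini.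
Context {R : realType}.
Local Notation gamma := (@std_gauss R).
Local Notation mR := (measurableTypeR R).

Lemma gauss_fubini_ge0 (f : R -> R -> R) :
  measurable_fun [set: mR * mR] (fun z : mR * mR => f z.1 z.2) -> (forall a b, 0 <= f a b) ->
  (forall a, egrow (f a)) -> (forall b, egrow (f ^~ b)) ->
  \int[gamma]_a \int[gamma]_b f a b = \int[gamma]_b \int[gamma]_a f a b.
Proof.
move=> mf f0 e1 e2; rewrite /Rintegral; congr fine.
under eq_integral do rewrite -[X in X%:E]/(Rintegral gamma setT (f _)) -gauss_EFin//.
under [RHS]eq_integral => b _.
  rewrite -[X in X%:E]/(Rintegral gamma setT (f ^~ b)) -(gauss_EFin (e2 b)).
  over.
rewrite (fubini_tonelli (fun z : mR * mR => (f z.1 z.2)%:E))//.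
  exact/measurable_EFinP.
by move=> z; rewrite lee_fin.
Qed.

Lemma gauss_fubini (f : R -> R -> R) (M : R) :
  measurable_fun [set: mR * mR] (fun z : mR * mR => f z.1 z.2) -> (forall a b, `|f a b| <= M) ->
  (forall a, egrow (f a)) -> (forall b, egrow (f ^~ b)) ->
  egrow (fun a => \int[gamma]_b f a b) -> egrow (fun b => \int[gamma]_a f a b) ->
  \int[gamma]_a \int[gamma]_b f a b = \int[gamma]_b \int[gamma]_a f a b.
Proof.
move=> mf fM e1 e2 E1 E2.
have := @gauss_fubini_ge0 (fun a b => f a b + M).
have -> : \int[gamma]_a \int[gamma]_b (f a b + M) = \int[gamma]_a \int[gamma]_b f a b + M.
  rewrite -[in RHS](gauss_cst M) -gaussD//; last exact: egrow_cst.
  by apply: eq_gauss => a; rewrite gaussD//; [rewrite gauss_cst|exact: egrow_cst].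
have -> : \int[gamma]_b \int[gamma]_a (f a b + M) = \int[gamma]_b \int[gamma]_a f a b + M.
  rewrite -[in RHS](gauss_cst M) -gaussD//; last exact: egrow_cst.
  by apply: eq_gauss => b; rewrite (gaussD (e2 b)); [rewrite gauss_cst|exact: egrow_cst].
move=> H; apply: (addIr M); apply: H.
- by apply: measurable_funD.
- by move=> a b; have := fM a b; rewrite ler_norml => /andP[]; rewrite -subr_ge0 opprK.
- by move=> a; apply: egrowD => //; exact: egrow_cst.
- by move=> b; apply: (egrowD (e2 b)); exact: egrow_cst.
Qed.

Lemma gauss_variance (f : R -> R) : egrow f ->
  \int[gamma]_x (f x - \int[gamma]_y f y) ^+ 2 = \int[gamma]_x f x ^+ 2 - (\int[gamma]_y f y) ^+ 2.
Proof.
move=> ef; set mean := \int[gamma]_y f y.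
have e2 : egrow (fun x => f x ^+ 2) by apply: eq_egrow (egrowM ef ef) => x; rewrite expr2.
have -> : \int[gamma]_x (f x - mean) ^+ 2 = \int[gamma]_x (1 * f x ^+ 2 + 1 * (- (2 * mean) * f x + mean ^+ 2 * 1)).
  by apply: eq_gauss => x; ring.
have e3 : egrow (fun x => - (2 * mean) * f x + mean ^+ 2 * 1).
  by apply: egrowD; [exact: egrowZ|apply: egrowZ; exact: egrow_cst].
rewrite (gauss_lin 1 1 e2 e3) (gauss_lin _ _ ef (egrow_cst 1)) gauss_cst -/mean; ring.
Qed.

End gauss_fubini.

Section heat_bounded.
Context {R : realType}.
Local Notation gamma := (@std_gauss R).
Local Notation mR := (measurableTypeR R).
Local Notation T := log_exp_step.

Variable D : R -> R.
Hypothesis D_le1 : forall y, `|D y| <= 1.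
Hypothesis D_lip : forall x y, `|D x - D y| <= 8 * `|x - y|.
Let eD : egrow D := slope_egrow D_le1 D_lip.

Lemma heat_le1 v y : `|T 0 v D y| <= 1.
Proof.
rewrite step0E ler_norml; apply/andP; split.
  apply: gauss_ge => [|g]; first exact: egrow_move.
  by have := D_le1 (y + g * Num.sqrt v); rewrite ler_norml => /andP[].
apply: gauss_le => [|g]; first exact: egrow_move.
by have := D_le1 (y + g * Num.sqrt v); rewrite ler_norml => /andP[].
Qed.

Lemma heat_sqf_egrow v : egrow (T 0 v (sqf D)).
Proof.
apply: (@egrow_bounded _ _ 1); first exact: lip_continuous (heat_sqf_lip D_le1 D_lip v).
move=> x; rewrite step0E ger0_norm; last by apply: gauss_ge0 => g; exact: sqf_ge0.
apply: gauss_le => [|g]; first exact: egrow_move (sqf_egrow D_le1 D_lip).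
exact: sqf_le1.
Qed.

Lemma heat_jensen v x : sqf (T 0 v D) x <= T 0 v (sqf D) x.
Proof.
rewrite /sqf !step0E -subr_ge0 -(gauss_variance (egrow_move x v eD)).
by apply: gauss_ge0 => g; exact: sqr_ge0.
Qed.

Let young (k w : R) : 2 * (k * w) - w ^+ 2 <= k ^+ 2.
Proof. by have := sqr_ge0 (k - w); rewrite sqrrB; lra. Qed.

(** The variance in one of two independent Gaussian variables decreases when
    the other one is averaged out. *)
Lemma heat_variance de y :
  2 * T 0 de (sqf (T 0 de D)) y <= sqf (T 0 de (T 0 de D)) y + T 0 de (T 0 de (sqf D)) y.
Proof.
pose s := Num.sqrt de; pose K := T 0 de D.
have lK x z := heat_lip de x z eD D_lip; have bK := heat_le1 de.
have eK : egrow K by exact: slope_egrow.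
pose k (a b : R) : R := D (y + a * s + b * s).
pose k1 (b : R) : R := K (y + b * s).
pose k0 : R := \int[gamma]_b k1 b.
have ek1 : egrow k1 by exact: egrow_move.
have ek a : egrow (k a) by exact: egrow_move.
have ek' b : egrow (k ^~ b).
  apply: eq_egrow (egrow_move (y + b * s) de eD) => a.
  by rewrite /k/= addrAC.
have kE a : \int[gamma]_b k a b = k1 a by rewrite /k1 /K step0E.
have kE' b : \int[gamma]_a k a b = k1 b.
  by rewrite -kE; apply: eq_gauss => a; rewrite /k addrAC.
have ekk a : egrow (fun b => k a b * k1 b) by exact: egrowM.
have ekk' b : egrow (fun a => k a b * k1 b).
  by apply: eq_egrow (egrowZ (k1 b) (ek' b)) => a; rewrite mulrC.
have ek2 a : egrow (fun b => k a b ^+ 2) by apply: eq_egrow (egrowM (ek a) (ek a)) => b; rewrite expr2.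
have ek12 : egrow (fun b => k1 b ^+ 2) by apply: eq_egrow (egrowM ek1 ek1) => b; rewrite expr2.
have bk1 b : `|k1 b| <= 1 by exact: bK.
have bkk a b : `|k a b * k1 b| <= 1.
  by rewrite normrM; apply: mulr_ile1; [exact: normr_ge0|exact: normr_ge0|exact: D_le1|exact: bk1].
pose F (a : R) : R := \int[gamma]_b (k a b * k1 b).
have eF : egrow F.
  apply: (@egrow_bounded _ _ 1).
    apply: (@lip_continuous _ _ (8 * `|s|)).
    have H a a' : F a <= F a' + 8 * `|s| * `|a - a'|.
      rewrite /F -[X in _ + X]gauss_cst -gaussD//; last exact: egrow_cst.
      apply: le_gauss => // [|b]; first by apply: egrowD => //; exact: egrow_cst.
      rewrite -lerBlDl -mulrBl; apply: le_trans (ler_norm _) _.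
      rewrite normrM -[leRHS]mulr1; apply: ler_pM; [exact: normr_ge0|exact: normr_ge0| |exact: bk1].
      apply: le_trans (D_lip _ _) _.
      have -> : y + a * s + b * s - (y + a' * s + b * s) = s * (a - a') by ring.
      by rewrite normrM mulrA.
    by move=> a a'; rewrite ler_distl; apply/andP; split; rewrite ?H// lerBlDr distrC H.
  move=> a; rewrite ler_norml; apply/andP; split.
    apply: gauss_ge => [|b]; first exact: ekk.
    have := bkk a b; by rewrite ler_norml => /andP[].
  apply: gauss_le => [|b]; first exact: ekk.
  have := bkk a b; by rewrite ler_norml => /andP[].
have eFub b : \int[gamma]_a (k a b * k1 b) = k1 b ^+ 2.
  under eq_Rintegral do rewrite mulrC.
  by rewrite (gaussZ (k1 b) (ek' b)) kE' -expr2.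
set B := \int[gamma]_b (k1 b ^+ 2).
have fub : \int[gamma]_a F a = B.
  transitivity (\int[gamma]_b \int[gamma]_a (k a b * k1 b)); last exact: (eq_gauss eFub).
  apply: (@gauss_fubini R (fun a b => k a b * k1 b) 1).
  - apply: measurable_funM; last first.
      by apply: (@measurableT_comp _ _ _ _ _ _ k1); [exact: (continuous_measurableT (proj1 ek1))|exact: measurable_snd].
    apply: (@measurableT_comp _ _ _ _ _ _ D); first exact: (continuous_measurableT (proj1 eD)).
    by apply: measurable_funD; [apply: measurable_funD => //; apply: measurable_funM|apply: measurable_funM].
  - exact: bkk.
  - exact: ekk.
  - exact: ekk'.
  - exact: eF.
  - by apply: eq_egrow ek12 => b; rewrite eFub.
pose A2 (a : R) : R := \int[gamma]_b (k a b ^+ 2).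
have A2E a : A2 a = T 0 de (sqf D) (y + a * s) by rewrite step0E.
have eA2 : egrow A2.
  by apply: eq_egrow (egrow_move y de (heat_sqf_egrow de)) => a; rewrite A2E.
have step a : 2 * F a - B + (k1 a - k0) ^+ 2 <= A2 a.
  (* [young] with [w = k1 a + k1 b - k0], the part of [k a b] that is a sum of functions of one variable. *)
  pose u := k1 a - k0.
  have ew : egrow (fun b => (2 * u) * k a b + (- 1) * k1 b ^+ 2).
    by apply: egrowD; exact: egrowZ.
  have ew2 : egrow (fun b => (- (2 * u)) * k1 b + (- (u ^+ 2)) * 1).
    by apply: egrowD; apply: egrowZ => //; exact: egrow_cst.
  have ew3 : egrow (fun b => 1 * ((2 * u) * k a b + (- 1) * k1 b ^+ 2) + 1 * ((- (2 * u)) * k1 b + (- (u ^+ 2)) * 1)).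
    by apply: egrowD; exact: egrowZ.
  have ew4 : egrow (fun b => 2 * (k a b * k1 b) + 1 * (1 * ((2 * u) * k a b + (- 1) * k1 b ^+ 2) + 1 * ((- (2 * u)) * k1 b + (- (u ^+ 2)) * 1))).
    by apply: egrowD; exact: egrowZ.
  have := le_gauss ew4 (ek2 a).
  rewrite (gauss_lin _ _ (ekk a) ew3) (gauss_lin _ _ ew ew2) (gauss_lin _ _ (ek a) ek12).
  rewrite (gauss_lin _ _ ek1 (egrow_cst 1)) gauss_cst kE -/(F a) -/B -/k0 -/(A2 a) => H.
  have {H} : 2 * F a + 1 * (1 * (2 * u * k1 a + -1 * B) + 1 * (- (2 * u) * k0 + - u ^+ 2 * 1)) <= A2 a.
    apply: H => b; apply: le_trans (young (k a b) (k1 b + u)).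
    by rewrite le_eqVlt; apply/orP; left; apply/eqP; ring.
  apply: le_trans; rewrite le_eqVlt; apply/orP; left; apply/eqP; rewrite /u; ring.
have ed : egrow (fun a => (k1 a - k0) ^+ 2).
  have e : egrow (fun a => k1 a - k0) by apply: egrowB => //; exact: egrow_cst.
  by apply: eq_egrow (egrowM e e) => a; rewrite expr2.
have ef1 : egrow (fun a => 2 * F a + (- B) * 1) by apply: egrowD; apply: egrowZ => //; exact: egrow_cst.
have ef2 : egrow (fun a => 1 * (2 * F a + (- B) * 1) + 1 * (k1 a - k0) ^+ 2) by apply: egrowD; exact: egrowZ.
have := le_gauss ef2 eA2.
rewrite (gauss_lin _ _ ef1 ed) (gauss_lin _ _ eF (egrow_cst 1)) gauss_cst fub.
rewrite (gauss_variance ek1) -/k0 -/B => H.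
have {H} : 1 * (2 * B + - B * 1) + 1 * (B - k0 ^+ 2) <= \int[gamma]_a A2 a.
  by apply: H => a; apply: le_trans (step a); rewrite !mul1r mulr1.
have -> : T 0 de (sqf (T 0 de D)) y = B by rewrite step0E.
have -> : sqf (T 0 de (T 0 de D)) y = k0 ^+ 2 by rewrite /sqf [T 0 de (T 0 de D) y]step0E.
have -> : T 0 de (T 0 de (sqf D)) y = \int[gamma]_a A2 a.
  by rewrite [LHS]step0E; apply: eq_gauss => a; rewrite A2E.
by move: (Rintegral _ _ _) => z; lra.
Qed.

End heat_bounded.

(** * Overlaps of two Gaussian copies *)
Section positive_integral.
Context {R : realType}.
Local Notation gamma := (@std_gauss R).

Lemma Rintegral_eq0 d (Om : measurableType d) (P : probability Om R) (f : Om -> R) :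
  P.-integrable [set: Om] (fun w => (f w)%:E) -> (forall w, 0 <= f w) ->
  \int[P]_w f w = 0 -> P.-negligible [set w | f w != 0].
Proof.
move=> fi f0 E.
have Z : (\int[P]_w `|(f w)%:E| = 0)%E.
  under eq_integral => w _ do rewrite gee0_abs ?lee_fin//.
  by rewrite -(fineK (integrable_fin_num measurableT fi)) -[fine _]/(\int[P]_w f w) E.
have /integrableP[mf _] := fi.
have [ae _] := ae_eq_integral_abs P measurableT mf.
have {}ae : P.-negligible (~` [set w | [set: Om] w -> (f w)%:E = 0%E]) by exact: (ae Z).
apply: negligibleS ae => w /= /eqP fw /(_ I) [].
exact: fw.
Qed.

Lemma Rintegral_gt0 d (Om : measurableType d) (P : probability Om R) (f : Om -> R) :
  P.-integrable [set: Om] (fun w => (f w)%:E) -> (forall w, 0 <= f w) ->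
  P.-negligible [set w | f w = 0] -> 0 < \int[P]_w f w.
Proof.
move=> fi f0 null; rewrite lt_neqAle Rintegral_ge0// andbT; apply/eqP => E.
have : P.-negligible [set: Om].
  apply: negligibleS (negligibleU null (Rintegral_eq0 fi f0 (esym E))) => w _.
  by have [fw|fw] := eqVneq (f w) 0; [left|right].
have P1 : P [set: Om] = 1%E by exact: probability_setT.
move=> /negligibleP => /(_ measurableT) P0.
by have : (0%:E < 1 :> \bar R)%E by [exact: lte01]; rewrite -P1 P0 ltxx.
Qed.

Lemma gauss_negligible1 (x : R) : gamma.-negligible [set x].
Proof.
apply/negligibleP; first exact: measurable_set1.
have /null_content_dominatesP H := @normal_prob_dominates R 0 1.
by apply: H; [exact: measurable_set1|exact: lebesgue_measure_set1].
Qed.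

Lemma lt_gauss (f F : R -> R) : egrow f -> egrow F -> (forall x, f x < F x) ->
  \int[gamma]_x f x < \int[gamma]_x F x.
Proof.
move=> ef eF fF; rewrite -subr_gt0 -gaussB//; apply: Rintegral_gt0.
- exact: egrow_integrable (egrowB eF ef).
- by move=> x; rewrite subr_ge0 ltW.
- have -> : [set x | F x - f x = 0] = set0.
    by apply/seteqP; split => // x /= /eqP; rewrite gt_eqF// subr_gt0.
  exact: negligible_set0.
Qed.

End positive_integral.

Section cross_overlap.
Context {R : realType}.
Local Notation gamma := (@std_gauss R).
Local Notation T := log_exp_step.

Lemma heat_le_lin (A B C : R -> R) (v x : R) : egrow A -> egrow B -> egrow C ->
  (forall y, 2 * A y <= B y + C y) -> 2 * T 0 v A x <= 1 * T 0 v B x + 1 * T 0 v C x.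
Proof.
move=> eA eB eC H; rewrite !step0E.
have eA' := egrow_move x v eA; have eB' := egrow_move x v eB; have eC' := egrow_move x v eC.
rewrite -(gaussZ 2 eA') -(gauss_lin 1 1 eB' eC'); apply: le_gauss.
- exact: egrowZ.
- by apply: egrowD; exact: egrowZ.
- by move=> g; rewrite !mul1r.
Qed.

Lemma heat_variance_eq (G K L : R -> R) (W v y : R) :
  (forall y, `|G y| <= 1) -> (forall x y, `|G x - G y| <= 8 * `|x - y|) ->
  K = T 0 v G -> L = T 0 v K -> W = T 0 v (T 0 v (sqf G)) y ->
  2 * T 0 v (sqf K) y <= sqf L y + W.
Proof. by move=> G1 Gl -> -> ->; exact: heat_variance. Qed.

Variable D : R -> R.
Hypothesis D_le1 : forall y, `|D y| <= 1.
Hypothesis D_lip : forall x y, `|D x - D y| <= 8 * `|x - y|.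
Let eD : egrow D := slope_egrow D_le1 D_lip.

Lemma heat_jensen_lt v x : (forall y z, y < z -> D y < D z) -> 0 < v ->
  sqf (T 0 v D) x < T 0 v (sqf D) x.
Proof.
move=> D_lt v0; have sv : 0 < Num.sqrt v by rewrite sqrtr_gt0.
have e := egrow_move x v eD.
rewrite /sqf !step0E -subr_gt0 -(gauss_variance e).
set mean := \int[gamma]_g D (x + g * Num.sqrt v).
have e1 : egrow (fun g => D (x + g * Num.sqrt v) - mean) by apply: egrowB => //; exact: egrow_cst.
have e2 : egrow (fun g => (D (x + g * Num.sqrt v) - mean) ^+ 2).
  by apply: eq_egrow (egrowM e1 e1) => g; rewrite expr2.
apply: Rintegral_gt0.
- exact: egrow_integrable e2.
- by move=> g; exact: sqr_ge0.
have inj (g g' : R) : D (x + g * Num.sqrt v) = D (x + g' * Num.sqrt v) -> g = g'.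
  move=> E; apply/eqP; rewrite eq_le !leNgt; apply/andP; split; apply/negP => lt.
    have : D (x + g' * Num.sqrt v) < D (x + g * Num.sqrt v) by apply: D_lt; rewrite ltrD2l ltr_pM2r.
    by rewrite E ltxx.
  have : D (x + g * Num.sqrt v) < D (x + g' * Num.sqrt v) by apply: D_lt; rewrite ltrD2l ltr_pM2r.
  by rewrite E ltxx.
have zE g : (D (x + g * Num.sqrt v) - mean) ^+ 2 = 0 -> D (x + g * Num.sqrt v) = mean.
  by move=> /eqP; rewrite sqrf_eq0 subr_eq0 => /eqP.
have [[g0 g0E]|no] := pselect (exists g0, D (x + g0 * Num.sqrt v) = mean).
  apply: negligibleS (gauss_negligible1 g0) => g /= /zE E.
  by apply: inj; rewrite E g0E.
apply: (@negligibleS _ _ _ gamma set0); last exact: negligible_set0.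
by move=> g /= /zE E; apply: no; exists g.
Qed.

Variable V : R.
Hypothesis V0 : 0 <= V.
Local Notation H s := (T 0 (V - s) D).
Local Notation Q s := (T 0 s (sqf (H s))).

Let H_le1 s y : `|H s y| <= 1. Proof. exact: heat_le1. Qed.
Let H_lip s x y : `|H s x - H s y| <= 8 * `|x - y|. Proof. exact: heat_lip eD D_lip. Qed.
Let eS s : egrow (sqf (H s)). Proof. exact: sqf_egrow (H_le1 s) (H_lip s). Qed.

Let Q_modulus s s' x : `|Q s x - Q s' x| <= `|16 * Num.sqrt s - 16 * Num.sqrt s'|
   + `|16 * Num.sqrt (V - s) - 16 * Num.sqrt (V - s')|.
Proof.
rewrite -!mulrBr !normrM (ger0_norm (ler0n R 16)).
apply: le_trans (ler_distD (T 0 s' (sqf (H s)) x) _ _) _; apply: lerD.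
  exact: heat_sqf_time.
set r := 16 * _.
have rE y : `|sqf (H s) y - sqf (H s') y| <= r.
  rewrite /sqf subr_sqr normrM.
  have -> : r = (8 * `|Num.sqrt (V - s) - Num.sqrt (V - s')|) * 2 by rewrite /r; ring.
  apply: ler_pM; [exact: normr_ge0|exact: normr_ge0|exact: heat_time eD D_lip|].
  apply: le_trans (ler_normD _ _) _.
  by apply: le_trans (lerD (H_le1 s y) (H_le1 s' y)) _; rewrite -mulr2n.
exact: (heat_dist s' x (eS s) (eS s') rE).
Qed.

Let Q_ge0 s x : 0 <= Q s x.
Proof. by rewrite step0E; apply: gauss_ge0 => g; exact: sqf_ge0. Qed.

Let H_split s s' : 0 <= s' - s -> s' <= V -> H s = T 0 (s' - s) (H s').
Proof.
move=> ss sV; apply/funext => x.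
have w0 : 0 <= V - s' by rewrite subr_ge0.
have E : (s' - s) + (V - s') = V - s by ring.
by rewrite -E; symmetry; exact: (heat_conv x eD ss w0).
Qed.

Let Q_split s s' x : 0 <= s -> 0 <= s' - s -> Q s' x = T 0 s (T 0 (s' - s) (sqf (H s'))) x.
Proof.
move=> s0 ss; have E : s + (s' - s) = s' by ring.
have := heat_conv x (eS s') s0 ss; rewrite E => C; exact: esym C.
Qed.

Let eT s s' : egrow (T 0 s (sqf (H s'))).
Proof. exact: heat_sqf_egrow (H_le1 s') (H_lip s') s. Qed.

Let Q_le s s' x : 0 <= s -> s <= s' -> s' <= V -> Q s x <= Q s' x.
Proof.
move=> s0 ss sV; have ds : 0 <= s' - s by rewrite subr_ge0.
rewrite (Q_split x s0 ds) (H_split ds sV) !step0E; apply: le_gauss.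
- by rewrite -(H_split ds sV); exact: egrow_move (eS s).
- exact: egrow_move (eT _ _).
- by move=> g; exact: heat_jensen.
Qed.

Let Q_lt s x : (forall y z, y < z -> D y < D z) -> 0 <= s -> s < V -> Q s x < Q V x.
Proof.
move=> D_lt s0 sV; have ds : 0 <= V - s by rewrite subr_ge0 ltW.
have HV : H V = D by rewrite subrr; apply/funext => y; exact: heat_v0.
rewrite (Q_split x s0 ds) HV ![T 0 s _ x]step0E; apply: lt_gauss.
- exact: egrow_move (eS s).
- by rewrite -HV; exact: egrow_move (eT _ _).
- by move=> g; apply: heat_jensen_lt => //; rewrite subr_gt0.
Qed.

Let Q_midpoint s s' x : 0 <= s -> s <= s' -> s' <= V ->
  2 * Q ((s + s') / 2) x <= 1 * Q s x + 1 * Q s' x.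
Proof.
move=> s0 ss sV; set mid := (s + s') / 2.
have d1 : 0 <= mid - s by rewrite /mid; lra.
have d2 : 0 <= s' - mid by rewrite /mid; lra.
have d2E : s' - mid = mid - s by rewrite /mid; lra.
have d3 : 0 <= s' - s by rewrite subr_ge0.
have mV : mid <= V by rewrite /mid; lra.
have d12 : s' - s = (mid - s) + (mid - s) by rewrite /mid; lra.
have m0 : 0 <= mid by rewrite /mid; lra.
rewrite (Q_split x s0 d1) (Q_split x s0 d3).
have E1 y : T 0 (s' - s) (sqf (H s')) y = T 0 (mid - s) (T 0 (mid - s) (sqf (H s'))) y.
  by rewrite d12 (heat_conv y (eS s') d1 d1).
have E2 : H mid = T 0 (mid - s) (H s') by rewrite (H_split d2 sV) d2E.
have E3 : H s = T 0 (mid - s) (H mid) by exact: (H_split d1 mV).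
apply: (heat_le_lin s x (eT (mid - s) mid) (eS s) (eT (s' - s) s')) => y.
exact: (heat_variance_eq (H_le1 s') (H_lip s') E2 E3 (E1 y)).
Qed.

Context d (Om : measurableType d) (P : probability Om R).
Variable h : {RV P >-> R}.
Hypothesis h_int : P.-integrable [set: Om] (fun w => (h w)%:E).

(** The mean product of the values of [D] at [h + g1] and [h + g2], for jointly
    Gaussian [g1] and [g2] of variance [V] and covariance [s], computed by
    conditioning on their common part. *)
Definition cross_overlap s := \int[P]_w Q s (h w).

Let lQ s : lingrow (Q s). Proof. exact: heat_sqf_lingrow (H_le1 s) (H_lip s) s. Qed.

Lemma cross_overlap_continuous : continuous cross_overlap.
Proof.
have le s s' : cross_overlap s <= cross_overlap s' + (`|16 * Num.sqrt s - 16 * Num.sqrt s'|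
   + `|16 * Num.sqrt (V - s) - 16 * Num.sqrt (V - s')|).
  set r := (X in _ + X).
  have := @le_field _ _ _ P h h_int (Q s) _ (lQ s) (lingrow_lin 1 r (lQ s') (lingrow_cst 1)).
  rewrite (field_lin h_int 1 r (lQ s') (lingrow_cst 1)) field_cst mul1r mulr1; apply => x.
  have := Q_modulus s s' x; rewrite ler_distl -/r => /andP[_].
  by rewrite ?mulr1 ?mul1r.
have dist s s' : `|cross_overlap s - cross_overlap s'| <= `|16 * Num.sqrt s - 16 * Num.sqrt s'|
   + `|16 * Num.sqrt (V - s) - 16 * Num.sqrt (V - s')|.
  rewrite ler_distl le andbT lerBlDr.
  by apply: le_trans (le s' s) _; rewrite (distrC (16 * Num.sqrt s')) (distrC (16 * Num.sqrt (V - s'))).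
have c1 : continuous (fun s : R => 16 * Num.sqrt s).
  by move=> x; apply: cvgM; [exact: cvg_cst|exact: sqrt_continuous].
have c2 : continuous (fun s : R => 16 * Num.sqrt (V - s)).
  move=> x; apply: cvgM; first exact: cvg_cst.
  by apply: continuous_comp; [apply: cvgB; [exact: cvg_cst|exact: cvg_id]|exact: sqrt_continuous].
move=> s; apply/cvgrPdist_lt => e e0.
have e20 : 0 < e / 2 by rewrite divr_gt0.
have /cvgrPdist_lt/(_ _ e20) n1 := c1 s.
have /cvgrPdist_lt/(_ _ e20) n2 := c2 s.
apply: filterS2 n1 n2 => s' h1 h2; apply: le_lt_trans (dist s s') _.
by rewrite (splitr e); exact: ltrD.
Qed.

Lemma cross_overlap_ge0 s : 0 <= cross_overlap s.
Proof. by apply: Rintegral_ge0 => w _; exact: Q_ge0. Qed.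

Lemma cross_overlap_le s s' : 0 <= s -> s <= s' -> s' <= V -> cross_overlap s <= cross_overlap s'.
Proof. by move=> s0 ss sV; apply: (le_field h_int (lQ s) (lQ s')) => x; exact: Q_le. Qed.

Lemma cross_overlap_lt s : (forall y z, y < z -> D y < D z) -> 0 <= s -> s < V ->
  cross_overlap s < cross_overlap V.
Proof.
move=> D_lt s0 sV; rewrite /cross_overlap -subr_gt0 -RintegralB//; last first.
- exact: (lingrow_integrable h_int (lQ s)).
- exact: (lingrow_integrable h_int (lQ V)).
apply: Rintegral_gt0.
- have := integrableB measurableT (lingrow_integrable h_int (lQ V)) (lingrow_integrable h_int (lQ s)).
  exact.
- by move=> w; rewrite subr_ge0 ltW// Q_lt.
- set S := [set w | _]; have -> : S = set0.
    by apply/seteqP; split => // w; rewrite /S/= => /eqP; rewrite gt_eqF// subr_gt0 Q_lt.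
  exact: negligible_set0.
Qed.

Let lin_aux (a b u v : R) : 2 * a + 0 * b <= 1 * u + 1 * v -> 2 * a <= u + v.
Proof. by rewrite mul0r addr0 !mul1r. Qed.

Let lin_aux' (a u : R) : 2 * a <= u -> 2 * a + 0 * 0 <= u.
Proof. by rewrite mul0r addr0. Qed.

Lemma cross_overlap_midpoint s s' : 0 <= s -> s <= s' -> s' <= V ->
  2 * cross_overlap ((s + s') / 2) <= cross_overlap s + cross_overlap s'.
Proof.
move=> s0 ss sV; rewrite /cross_overlap.
have := @le_field _ _ _ P h h_int (fun x => 2 * Q ((s + s') / 2) x + 0 * 0) _
  (lingrow_lin 2 0 (lQ ((s + s') / 2)) (lingrow_cst 0)) (lingrow_lin 1 1 (lQ s) (lQ s')).
rewrite (field_lin h_int 1 1 (lQ s) (lQ s')) (field_lin h_int 2 0 (lQ ((s + s') / 2)) (lingrow_cst 0)).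
move=> K; apply: lin_aux; apply: K => x.
by apply: lin_aux'; exact: Q_midpoint.
Qed.

End cross_overlap.

(** * Zeros of the overlap equation *)
Section zero_of_convex.
Context {R : realType}.

Let slope_aux (A m s t a b y : R) : 0 < A -> A <= t + s - 2 * m ->
  0 <= m - t - b * (- y) -> 0 <= m - s - a * y -> 0 < (b - a) * y.
Proof. by move=> A0 h1 h2 h3; lra. Qed.

Lemma pc_slope_lt (F : R -> R) x z : parisi_class F -> x < z -> derive1 F x < derive1 F z.
Proof.
move=> pF xz; pose y := (z - x) / 2; have y0 : 0 < y by rewrite divr_gt0// subr_gt0.
have xy : x + y + y = z by rewrite /y; lra.
have xy' : x + y - y = x by rewrite addrK.
have := pc_lower pF (x + y) y; rewrite xy xy'.
have := mulr_gt0 (mulr_gt0 (ltr0n R 2) (logcosh_gt0 (lt0r_neq0 y0))) (expR_gt0 (- 2 * F (x + y))).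
have /andP[+ _] := pc_taylor x y pF.
have /andP[+ _] := pc_taylor z (- y) pF.
have -> : z + - y = x + y by rewrite -xy; lra.
move=> h1 h2 h3 h4; have := slope_aux h3 h4 h1 h2.
by rewrite pmulr_lgt0// subr_gt0.
Qed.

Lemma pc_slope0 (F : R -> R) : parisi_class F -> derive1 F 0 = 0.
Proof.
move=> pF.
have b y : 0 <= F y - F 0 - derive1 F 0 * y <= 4 * y ^+ 2.
  by have := pc_taylor 0 y pF; rewrite add0r.
have H y : 2 * derive1 F 0 * y <= 4 * y ^+ 2 /\ - (2 * derive1 F 0) * y <= 4 * y ^+ 2.
  have /andP[h1 h2] := b y; have /andP[h3 h4] := b (- y).
  move: h3 h4; rewrite (pc_even pF) sqrrN mulrN => h3 h4.
  by split; lra.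
have h1 : 2 * derive1 F 0 <= 0 by apply: (@le_of_quadratic _ _ 4) => // y _; exact: (proj1 (H y)).
have h2 : - (2 * derive1 F 0) <= 0 by apply: (@le_of_quadratic _ _ 4) => // y _; exact: (proj2 (H y)).
by lra.
Qed.

(** At a maximum point, reflect the nearer endpoint through it: the reflected
    value is at most the maximum and the value at the endpoint is nonpositive,
    so the maximum is at most half of itself. *)
Lemma midpoint_convex_le0 (f : R -> R) a b : a <= b -> {within `[a, b], continuous f} ->
  (forall u v, a <= u -> u <= v -> v <= b -> 2 * f ((u + v) / 2) <= f u + f v) ->
  f a <= 0 -> f b <= 0 -> forall u, a <= u <= b -> f u <= 0.
Proof.
move=> ab cf mid fa fb.
have [z zab zmax] := EVT_max ab cf.
move: zab; rewrite in_itv/= => /andP[az zb].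
have max u : a <= u -> u <= b -> f u <= f z by move=> au ub; apply: zmax; rewrite in_itv/= au.
suff fz : f z <= 0 by move=> u /andP[au ub]; exact: le_trans (max u au ub) fz.
have [l|l] := leP (z - a) (b - z).
  have v1 : 2 * z - a <= b by lra.
  have v0 : a <= 2 * z - a by lra.
  have := mid a (2 * z - a) (lexx a) v0 v1.
  have -> : (a + (2 * z - a)) / 2 = z by lra.
  by have := max _ v0 v1; lra.
have v1 : 2 * z - b <= b by lra.
have v0 : a <= 2 * z - b by lra.
have := mid (2 * z - b) b v0 v1 (lexx b).
have -> : (2 * z - b + b) / 2 = z by lra.
by have := max _ v0 v1; lra.
Qed.

End zero_of_convex.

Section zeros_of_varphi.
Context {R : realType}.
Local Notation gamma := (@std_gauss R).
Local Notation T := log_exp_step.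
Variables (xi : R -> R).
Local Notation dxi := (derive1 xi).
Context d (Om : measurableType d) (P : probability Om R).
Variable h : {RV P >-> R}.
Variable Phi : R -> R -> R.

Lemma gauss_square (k : R -> R) : egrow k ->
  \int[gamma]_a \int[gamma]_b (k a * k b) = (\int[gamma]_a k a) ^+ 2.
Proof.
move=> ek; set I := \int[gamma]_a k a; rewrite expr2 -(gaussZ I ek).
by apply: eq_gauss => a; rewrite (gaussZ (k a) ek) mulrC.
Qed.

(** Given the common variable [g], the double integral over [g1] and [g2] is a
    square. *)
Lemma varphi_cross v u t : parisi_class (Phi ^~ v) ->
  varphi P h xi Phi v u t = cross_overlap (derive1 (Phi ^~ v)) (dxi v) h (t * dxi u) - u.
Proof.
move=> pF; rewrite /varphi /cross_overlap; congr (_ - u).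
set D := derive1 (Phi ^~ v).
have eD : egrow D by apply: slope_egrow => [y|x y]; [exact: pc_slope_le1|exact: pc_slope_lip].
set s := t * _; set r := Num.sqrt (dxi v - s).
apply: eq_Rintegral => w _; rewrite [RHS]step0E; apply: eq_gauss => g.
pose k (a : R) : R := D (h w + g * Num.sqrt s + a * r).
have kE a : D (h w + (Num.sqrt s * g + r * a)) = k a.
  by rewrite /k; congr D; ring.
transitivity (\int[gamma]_a \int[gamma]_b (k a * k b)).
  by apply: eq_gauss => a; apply: eq_gauss => b; rewrite -(kE a) -(kE b).
rewrite gauss_square; last exact: egrow_move.
by rewrite /sqf step0E.
Qed.

Hypothesis mix : is_mixture xi.
Hypothesis h_int : P.-integrable [set: Om] (fun w => (h w)%:E).
Hypothesis h_sqr : (0 < 'E_P[fun w => (h w ^+ 2)%R])%E.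
Variables (tau : nat -> triplet R) (mu : probability (measurableTypeR R) R) (c : R).
Hypothesis mu_parisi : parisi_measure_along P h xi tau mu.
Hypothesis c_smallest : is_smallest (measure_support mu) c.
Hypothesis Phi_limit : is_Phi xi tau Phi.

Let c01 : 0 <= c <= 1.
Proof. by have [mu01 _] := mu_parisi; exact: smallest_support_in01 mu01 c_smallest. Qed.

Let D := derive1 (Phi ^~ c).

Let pD : parisi_class (Phi ^~ c).
Proof.
have /andP[c0 c1] := c01.
exact: (Phi_class (parisi_admissible mu_parisi) Phi_limit c0 c1).
Qed.

Let D_le1 y : `|D y| <= 1. Proof. exact: pc_slope_le1. Qed.
Let D_lip x y : `|D x - D y| <= 8 * `|x - y|. Proof. exact: pc_slope_lip. Qed.
Let D_lt y z : y < z -> D y < D z. Proof. exact: pc_slope_lt. Qed.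

Let overlap : \int[P]_w T 0 (dxi c) (sqf D) (h w) = c.
Proof.
have [C [C0 C_upper]] := step_upper_linear (Num.sqrt (dxi 1)).
have [Cu [Cu0 Cu_upper]] := step_upper (Num.sqrt (dxi 1)).
exact: (self_overlap mix h_int mu_parisi c_smallest Phi_limit C0 C_upper Cu0 Cu_upper).
Qed.

(** If [c = 0] then [D h = 0] almost surely, hence [h = 0] almost surely. *)
Lemma smallest_support_gt0 : 0 < c.
Proof.
have /andP[c0 _] := c01; rewrite lt_neqAle c0 andbT; apply/eqP => cE.
have E0 : \int[P]_w T 0 0 (sqf D) (h w) = 0 by have := overlap; rewrite -cE (dxi0 mix).
have nonneg w : 0 <= T 0 0 (sqf D) (h w).
  by rewrite step0E; apply: gauss_ge0 => g; exact: sqf_ge0.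
have ng := Rintegral_eq0 (lingrow_integrable h_int (heat_sqf_lingrow D_le1 D_lip 0)) nonneg E0.
have ng0 : P.-negligible [set w | h w != 0].
  apply: negligibleS ng => w /= hw; rewrite heat_v0 /sqf sqrf_eq0.
  have D0 : D 0 = 0 by exact: pc_slope0.
  move: hw; rewrite neq_lt => /orP[] /D_lt; rewrite D0 => lt.
    by rewrite lt_eqF.
  by rewrite gt_eqF.
have mh : measurable_fun [set: Om] (fun w => (h w ^+ 2)%:E).
  by apply/measurable_EFinP; apply: measurable_funX; exact: measurable_funPT.
have [_ ae] := ae_eq_integral_abs P measurableT mh.
have Z : (\int[P]_w `|(h w ^+ 2)%:E| = 0)%E.
  apply: ae; apply: negligibleS ng0 => w /= H; apply/eqP => hw; apply: H => _.
  by rewrite hw expr0n.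
move: h_sqr; rewrite unlock.
have -> : (\int[P]_w (h w ^+ 2)%:E = \int[P]_w `|(h w ^+ 2)%:E|)%E.
  by apply: eq_integral => w _; rewrite gee0_abs// lee_fin sqr_ge0.
by rewrite Z ltxx.
Qed.

Local Notation X := (cross_overlap D (dxi c) h).
Let c0 := smallest_support_gt0.
Let X_top : X (dxi c) = c.
Proof.
rewrite -[RHS]overlap /cross_overlap subrr.
by have -> : T 0 0 D = D by apply/funext => y; exact: heat_v0.
Qed.

Let phiE u t : varphi P h xi Phi c u t = X (t * dxi u) - u.
Proof. exact: varphi_cross. Qed.

Lemma varphi_top1 : varphi P h xi Phi c c 1 = 0.
Proof. by rewrite phiE mul1r X_top subrr. Qed.

Let V0 : 0 < dxi c. Proof. by rewrite -(dxi0 mix) (dxi_lt mix). Qed.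

Lemma varphi_top_lt0 t : 0 <= t -> t < 1 -> varphi P h xi Phi c c t < 0.
Proof.
move=> t0 t1; rewrite phiE subr_lt0 -[ltRHS]X_top; apply: cross_overlap_lt => //.
  by rewrite mulr_ge0// ltW.
by rewrite gtr_pMl.
Qed.

Lemma varphi_bot_ge0 t : 0 <= varphi P h xi Phi c 0 t.
Proof. by rewrite phiE subr0 cross_overlap_ge0. Qed.

Lemma varphi_continuous t : continuous (fun u => varphi P h xi Phi c u t).
Proof.
have -> : (fun u => varphi P h xi Phi c u t) = (fun u => X (t * dxi u) - u).
  by apply/funext => u; exact: phiE.
move=> u; apply: cvgB; last exact: cvg_id.
apply: (@continuous_comp _ _ _ (fun u => t * dxi u) X).
  by apply: cvgM; [exact: cvg_cst|exact: (dxi_continuous mix)].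
exact: cross_overlap_continuous.
Qed.

Let mid_aux (t x a b : R) : 0 <= t -> 2 * x <= a + b -> t * x <= (t * a + t * b) / 2.
Proof. by move=> t0 xab; have := ler_wpM2l t0 xab; rewrite mulrDr; lra. Qed.

Lemma varphi_midpoint t u v : 0 <= t -> t < 1 -> 0 <= u -> u <= v -> v <= c ->
  2 * varphi P h xi Phi c ((u + v) / 2) t <= varphi P h xi Phi c u t + varphi P h xi Phi c v t.
Proof.
move=> t0 t1 u0 uv vc; rewrite !phiE; have v0 := le_trans u0 uv.
have mono := dxi_le mix.
have le1 w : 0 <= w -> w <= c -> t * dxi w <= dxi c.
  move=> w0 wc; apply: (@le_trans _ _ (dxi w)); last exact: mono.
  by rewrite ler_piMl ?(dxi_ge0 mix)// ltW.
have w0 : 0 <= (u + v) / 2 by rewrite divr_ge0// addr_ge0.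
have dm := dxi_midpoint mix u0 v0.
have s0 : 0 <= t * dxi u by rewrite mulr_ge0// (dxi_ge0 mix).
have ss : t * dxi u <= t * dxi v by rewrite ler_wpM2l// mono.
have sv := le1 v v0 vc.
have h1 : X (t * dxi ((u + v) / 2)) <= X ((t * dxi u + t * dxi v) / 2).
  apply: cross_overlap_le => //.
  - by rewrite mulr_ge0// (dxi_ge0 mix).
  - exact: mid_aux t0 dm.
  - by rewrite ler_pdivrMr// mulr_natr mulr2n lerD// (le_trans ss).
have h2 := cross_overlap_midpoint D_le1 D_lip h_int s0 ss sv.
by move: h1 h2; move: (X _) (X _) (X _) (X _) => a b e f h1 h2; lra.
Qed.

(** Subtracting from [varphi] its chord between a zero and [c] leaves a midpoint
    convex function that vanishes at both ends; so [varphi] is below the chord,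
    which is negative. *)
Lemma varphi_unique_zero t : 0 <= t -> t < 1 ->
  exists! u : R, 0 <= u <= c /\ varphi P h xi Phi c u t = 0.
Proof.
move=> t0 t1; set f := fun u => varphi P h xi Phi c u t.
have fc : f c < 0 by exact: varphi_top_lt0.
have cf : continuous f by exact: varphi_continuous.
have no u v : 0 <= u -> u < v -> v <= c -> f u = 0 -> f v = 0 -> False.
  move=> u0 uv vc fu fv.
  have {}vc : v < c by rewrite lt_neqAle vc andbT; apply/eqP => E; move: fc; rewrite -E fv ltxx.
  have uc : u < c by exact: lt_trans vc.
  (* The slope of the chord from [(u, 0)] to [(c, f c)]. *)
  pose sl : R := f c / (c - u).
  pose g (x : R) : R := f x - sl * (x - u).
  have cu : c - u != 0 by rewrite subr_eq0 gt_eqF.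
  have cg : {within `[u, c], continuous g}.
    apply: continuous_subspaceT => x; apply: cvgB; first exact: cf.
    by apply: cvgM; [exact: cvg_cst|apply: cvgB; [exact: cvg_id|exact: cvg_cst]].
  have gmid x y : u <= x -> x <= y -> y <= c -> 2 * g ((x + y) / 2) <= g x + g y.
    move=> ux xy yc; have := varphi_midpoint t0 t1 (le_trans u0 ux) xy yc.
    rewrite -/(f x) -/(f y) -[varphi _ _ _ _ _ _ _]/(f ((x + y) / 2)) /g.
    have -> : 2 * (f ((x + y) / 2) - sl * ((x + y) / 2 - u)) =
      2 * f ((x + y) / 2) - (sl * (x - u) + sl * (y - u)) by field.
    by move: (sl * _) (sl * _) => p q; lra.
  have gu : g u <= 0 by rewrite /g subrr mulr0 subr0 fu.
  have gc : g c <= 0 by rewrite /g /sl divfK// subrr.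
  have uvc : u <= v <= c by rewrite !ltW.
  have := midpoint_convex_le0 (ltW uc) cg gmid gu gc uvc.
  rewrite /g fv sub0r oppr_le0 pmulr_lge0 ?subr_gt0//.
  by rewrite /sl pmulr_lge0 ?invr_gt0 ?subr_gt0// leNgt fc.
have [|u uc fu] := @IVT R f 0 c 0 (ltW c0) (continuous_subspaceT cf).
  by rewrite ge_min le_max varphi_bot_ge0 (ltW fc) orbT.
exists u; split; first by split=> //; move: uc; rewrite in_itv.
move: uc; rewrite in_itv/= => /andP[u0 uc] v [/andP[v0 vc] fv].
by have [uv|vu|//] := ltgtP u v; [case: (no u v)|case: (no v u)].
Qed.

End zeros_of_varphi.

Theorem proposition1 (R : realType) (xi : R -> R) (xi_mixture : is_mixture xi)
    (d : measure_display) (T : measurableType d) (P : probability T R)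
    (h : {RV P >-> R})
    (h_integrable : P.-integrable [set: T] (fun w => (h w)%:E))
    (h_sqr : (0 < 'E_P[fun w => (h w ^+ 2)%R])%E)
    (tau : nat -> triplet R) (mu : probability (measurableTypeR R) R)
    (mu_parisi : parisi_measure_along P h xi tau mu)
    (c : R) (c_smallest : is_smallest (measure_support mu) c)
    (Phi : R -> R -> R) (Phi_limit : is_Phi xi tau Phi) :
  [/\ forall t : R, 0 <= t < 1 ->
        exists! u : R, 0 <= u <= c /\ varphi P h xi Phi c u t = 0,
      forall t : R, 0 <= t < 1 -> varphi P h xi Phi c c t < 0
    & varphi P h xi Phi c c 1 = 0].
Proof.
split=> [t /andP[t0 t1]|t /andP[t0 t1]|].
- exact: (varphi_unique_zero xi_mixture h_integrable h_sqr mu_parisi c_smallest Phi_limit t0 t1).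
- exact: (varphi_top_lt0 xi_mixture h_integrable h_sqr mu_parisi c_smallest Phi_limit t0 t1).
- exact: (varphi_top1 xi_mixture h_integrable mu_parisi c_smallest Phi_limit).
Qed.
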